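(* Fix a real number $p\ge1$. Let $P\subset\mathbb{R}^d$ be any real, convex $d$-polytope. Then the following is an identity of meromorphic functions of $s\in\mathbb{C}^d$: $$\alpha_P(s)=\sum_{v\ \text{a vertex of } P}\alpha_{K_v}(s),$$ where $K_v:=\{v+\lambda(y-v): y\in P,\ \lambda\in\mathbb{R}_{\ge0}\}$ is the vertex tangent cone of $P$ at the vertex $v$.
   Context: A convex $d$-polytope is a $d$-dimensional bounded intersection of finitely many half-spaces and hyperplanes. ''Real'' means that its vertices may have arbitrary real coordinates (no rationality is assumed). Notation: $\|t\|_p=(|t_1|^p+\dots+|t_d|^p)^{1/p}$, and $\langle x,y\rangle=\sum_k x_ky_k$ (bilinear, extended to complex vectors without conjugation). For $Q\subset\mathbb{R}^d$ a convex $d$-polytope or a pointed $d$-dimensional polyhedral cone (with arbitrary apex), the $l^p$-solid angle of $x\in\mathbb{R}^d$ with respect to $Q$ is $$\omega_Q(x)=\omega_{p,Q}(x):=\lim_{\epsilon\to0^+}\frac{1}{\epsilon^{d/p}}\int_Q e^{-\frac{c}{\epsilon}\|t-x\|_p^p}\,dt,\qquad c=\bigl(2\,\Gamma(\tfrac1p+1)\bigr)^p.$$ Equivalently, it is the proportion of a sufficiently small $l^p$-ball centered at $x$ that lies in $Q$. Solid-angle generating function: $$\alpha_Q(s):=\sum_{m\in Q\cap\mathbb{Z}^d}\omega_Q(m)\,e^{2\pi i\langle s,m\rangle}.$$ For a polytope this is a finite sum, defined for all $s\in\mathbb{C}^d$. For a cone $Q=v+K$, with $K$ a pointed cone with apex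 at the origin, the series converges when $-\mathrm{Im}(s)\in K^*$, where $K^*=\{x\in\mathbb{R}^d:\langle x,y\rangle<0\ \text{for all nonzero } y\in K\}$. Elsewhere, $\alpha_Q$ is understood through meromorphic continuation in $s$.
   Formalization: The existence of a meromorphic continuation of each α_{K_v} to C^d is assumed; it fails when a vertex cone has an irrational edge direction (the series has a natural boundary), so for such real polytopes the identity has no meaning and nothing is asserted. *)

(* Defs.v *)
From HB Require Import structures.
From mathcomp Require Import all_boot all_order all_algebra.
From mathcomp Require Import finmap.
From mathcomp Require Import complex.
From mathcomp Require Import all_classical all_reals all_analysis.
From mathcomp.analysis.showcase Require summability.

Set Implicit Arguments.
Unset Strict Implicit.
Unset Printing Implicit Defensive.

Import Order.TTheory GRing.Theory Num.Theory.
Import numFieldNormedType.Exports.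

Local Open Scope classical_set_scope.
Local Open Scope ring_scope.
Local Open Scope complex_scope.

Section lebesgue_tuple.
Variable R : realType.

Definition tuple_of_pair n (z : n.-tuple (measurableTypeR R) * measurableTypeR R) :
  n.+1.-tuple (measurableTypeR R) := [the _.-tuple _ of z.2 :: z.1].

Lemma measurable_tuple_of_pair n : measurable_fun setT (@tuple_of_pair n).
Proof.
exact: (measurable_cons (f := snd) (g := fst) measurable_snd measurable_fst).
Qed.

(* The measurability of tuple_of_pair is what makes the pushforward a measure. *)
Definition lebesgue_cons n
    (mu : {measure set (n.-tuple (measurableTypeR R)) -> \bar R}) :
  {measure set (n.+1.-tuple (measurableTypeR R)) -> \bar R}.
Proof.
refine (pushforward (mu \x lebesgue_measure)%E (@tuple_of_pair n)
  : {measure set _ -> \bar R}).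
exact: measurable_tuple_of_pair.
Defined.

(* The d-fold product of the one-dimensional Lebesgue measure. *)
Fixpoint lebesgue_tuple (n : nat) :
    {measure set (n.-tuple (measurableTypeR R)) -> \bar R} :=
  match n with
  | 0 => dirac [tuple]
  | n'.+1 => lebesgue_cons (lebesgue_tuple n')
  end.

End lebesgue_tuple.

Section polytopes.
Variables (R : realType) (d : nat).
Implicit Types (P : set 'rV[R]_d) (v x y : 'rV[R]_d).

Definition dotr x y : R := \sum_k x 0 k * y 0 k.

(* k half-spaces and l hyperplanes *)
Definition polyhedron P : Prop :=
  exists k l (A : 'M[R]_(k, d)) (b : 'I_k -> R)
             (B : 'M[R]_(l, d)) (c : 'I_l -> R),
    P = [set x | (forall i, dotr (row i A) x <= b i) /\
                 (forall j, dotr (row j B) x = c j)].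

(* The affine hull is R^d: there are d + 1 affinely independent points of P. *)
Definition full_dimensional P : Prop :=
  exists x (B : 'M[R]_d),
    [/\ P x, forall i, P (x + row i B) & \rank B = d].

Definition polytope P : Prop :=
  [/\ polyhedron P, bounded_set P & full_dimensional P].

(* v is a zero-dimensional face: {v} is cut out of P by a valid inequality. *)
Definition vertex P v : Prop :=
  exists u (b : R), (forall y, P y -> dotr u y <= b) /\
    P `&` [set y | dotr u y = b] = [set v].

Definition tangent_cone P v : set 'rV[R]_d :=
  [set z | exists y (l : R), [/\ P y, 0 <= l & z = v + l *: (y - v)]].

(* The set written K^* for a cone K with apex the origin. *)
Definition open_polar (K : set 'rV[R]_d) : set 'rV[R]_d :=
  [set x | forall y, K y -> y != 0 -> dotr x y < 0].

End polytopes.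

Section solid_angle.
Variables (R : realType) (p : R) (d : nat).

Definition Gamma (x : R) : R :=
  \int[lebesgue_measure]_(t in `]0, +oo[) (t `^ (x - 1) * expR (- t)).

Definition lp_norm (t : 'rV[R]_d) : R := (\sum_k `|t 0 k| `^ p) `^ p^-1.

Definition solid_angle_const : R := (2 * Gamma (p^-1 + 1)) `^ p.

Definition rV_of_tuple (t : d.-tuple (measurableTypeR R)) : 'rV[R]_d :=
  \row_k tnth t k.

Definition solid_angle (Q : set 'rV[R]_d) (x : 'rV[R]_d) : R :=
  lim ((fun e : R => (e `^ (d%:R / p))^-1 *
    \int[lebesgue_tuple R d]_(t in rV_of_tuple @^-1` Q)
      expR (- (solid_angle_const / e) * lp_norm (rV_of_tuple t - x) `^ p))
    @ 0^'+).

End solid_angle.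

Section meromorphic.
Variables (C : numFieldType) (d : nat).
Implicit Types (f g h : 'rV[C]_d -> C) (U W : set 'rV[C]_d).

(* Sum of an unconditionally convergent family: the limit of the sums over
   finite subsets. *)
Definition family_sum (I : choiceType) (x : I -> C) : C := summability.sum x.

Definition holomorphic_on U f : Prop :=
  open U /\ forall s, U s -> differentiable f s.

(* f is locally a quotient of holomorphic functions with a denominator that is
   not identically zero on any nonempty open set.  The values of f on the zero
   set of h are irrelevant, whence the equality mero_eq. *)
Definition meromorphic f : Prop :=
  forall a, exists W g h,
    [/\ W a, holomorphic_on W g, holomorphic_on W h,
        forall O, open O -> O `<=` W -> O !=set0 ->
          exists2 s, O s & h s != 0
      & forall s, W s -> h s != 0 -> f s = g s / h s].

Definition mero_eq f g : Prop :=
  exists U, [/\ open U, dense U & forall s, U s -> f s = g s].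

(* f is a meromorphic continuation to C^d of the restriction of g to U.  It is
   a relation and not a function because a continuation need not exist: the
   lattice point series of a cone with irrational edges can have a natural
   boundary. *)
Definition mero_continuation U g f : Prop :=
  meromorphic f /\ forall s, U s -> f s = g s.

End meromorphic.

Section generating_function.
Variables (R : realType) (p : R) (d : nat).

Definition cexp (z : R[i]) : R[i] :=
  (expR (complex.Re z))%:C * (cos (complex.Im z) +i* sin (complex.Im z)).

Definition dotc (x y : 'rV[R[i]]_d) : R[i] := \sum_k x 0 k * y 0 k.

Definition lattice_point (m : 'rV[int]_d) : 'rV[R]_d := map_mx intr m.

(* The defining series; it has its intended meaning where it converges: for
   all s when Q is bounded, for s in convergence_domain v Q when Q is a pointed
   cone with apex v. *)
Definition alpha (Q : set 'rV[R]_d) (s : 'rV[R[i]]_d) : R[i] :=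
  family_sum (fun m : 'rV[int]_d =>
    if lattice_point m \in Q then
      (solid_angle p Q (lattice_point m))%:C *
      cexp ((0 +i* (2 * pi)) *
            dotc s (map_mx (real_complex R) (lattice_point m)))
    else 0).

Definition convergence_domain (v : 'rV[R]_d) (Q : set 'rV[R]_d) :
    set 'rV[R[i]]_d :=
  [set s | open_polar [set z | Q (v + z)] (- map_mx (@complex.Im R) s)].

End generating_function.

(* Main.v *)
(* The only real difficulty is irrationality.  Suppose that a vertex cone K_v has an edge
   direction w whose line contains no nonzero lattice point.  If alpha_(K_v) continued to a
   quotient g / h near a point i y over the wall <Im s, w> = 0 of the domain of convergence, then
   h would have to vanish wherever <s, w> lies in the subgroup <Z^d, w> of the reals: otherwise
   alpha_(K_v) would be bounded on approaching such a point, and a two constants argument along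
   the wall would contradict the growth like 1 / tau of the positive series
   alpha_(K_v)(i (y + tau eta)), which counts the lattice points near the edge.  As w is
   irrational, <Z^d, w> accumulates at 0, so h vanishes identically near i y, which is absurd.
   Hence the mere existence of the continuations makes all the edges of all the K_v rational.

   Now let u range over integer generators of all the K_v, and apply the product of the
   difference operators psi |-> psi - psi (. - u) to 1_P - sum_v 1_(K_v).  The result has bounded
   support.  It is killed by the difference operators along the differences of vertices (Brion's
   theorem modulo functions with periods), which are injective on functions with bounded support,
   so it is 0.  Solid angles are linear in the germ of the indicator function, hence the same
   identity holds for the coefficients of the series.  On the side of the series, the difference
   operators become multiplication by the product of the 1 - exp (2 pi i <s, u>); this gives the
   theorem where the product does not vanish. *)
Require Import Defs.
From HB Require Import structures.
From mathcomp Require Import all_boot all_order all_algebra.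
From mathcomp Require Import finmap.
From mathcomp Require Import complex.
From mathcomp Require Import all_classical all_reals all_analysis.
From mathcomp Require Import measurable_realfun.
From mathcomp.analysis.showcase Require summability.
From mathcomp Require Import ring lra zify.

Set Implicit Arguments.
Unset Strict Implicit.
Unset Printing Implicit Defensive.

Import Order.TTheory GRing.Theory Num.Theory.
Import numFieldNormedType.Exports.
Import ComplexField.Normc.

Local Open Scope classical_set_scope.
Local Open Scope ring_scope.
Local Open Scope complex_scope.

(** * Complex functions of one variable *)

(** Two families of difference operators have to be kept apart. Differences of vertices may be
    irrational, so they cannot act on lattice series; they act on indicator functions only. There
    the key is that, for convex A, the indicators of A and of its sum with the line R u add up to
    those of its sums with the two half-lines, and the line term has period u. A choice of sign for
    every difference of vertices orders the vertices, and only the cone of the least one survives.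
    Cancelling these operators needs bounded support, which the integer generators have to create
    beforehand; this is where rationality of the edges enters.

    The subgroup <Z^d, w> comes from periodicity: the series is unchanged by real translations in
    Z^d. A point with <s, w> in the subgroup is, up to such a translation and a small shift into the
    domain, a point with <s, w> = 0, whose real part can be contracted to 0 without leaving the
    wall. Smallness is propagated along this segment for finite partial sums, which are entire, with
    a majorant that is uniform on a strip around it. *)

HB.instance Definition _ (R : realType) := NormedModule.copy R[i] R[i]^o.

Section complex_norm.
Variable R : realType.
Implicit Types (z w : R[i]).

Lemma normrcE z : `|z| = (normc z)%:C.
Proof. by case: z. Qed.

Lemma normc_ge0 z : 0 <= normc z.
Proof. by rewrite -ler0c -normrcE. Qed.

Lemma normc_eq0 z : (normc z == 0) = (z == 0).
Proof. by apply/eqP/eqP => [/eq0_normc//|->]; rewrite normc0. Qed.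

Lemma normc_gt0 z : (0 < normc z) = (z != 0).
Proof. by rewrite lt_def normc_ge0 andbT normc_eq0. Qed.

Lemma normc_real (x : R) : normc x%:C = `|x|.
Proof. by rewrite /= expr0n addr0 sqrtr_sqr. Qed.

Lemma normcB z w : normc (z - w) = normc (w - z).
Proof. by rewrite -opprB normcN. Qed.

Lemma normc_Re z : `|complex.Re z| <= normc z.
Proof. by rewrite -lecR -normrcE normc_ge_Re. Qed.

Lemma normc_Im z : `|complex.Im z| <= normc z.
Proof.
case: z => a b /=; rewrite -[X in X <= _]sqrtr_sqr.
by apply: ler_wsqrtr; rewrite lerDr sqr_ge0.
Qed.

Lemma normc_le z : normc z <= `|complex.Re z| + `|complex.Im z|.
Proof.
rewrite {1}[z]complexE; apply: le_trans (le_normcD _ _) _.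
by rewrite normcM !normc_real /= expr0n expr1n add0r sqrtr1 mul1r.
Qed.

Lemma normcX z n : normc (z ^+ n) = normc z ^+ n.
Proof. by elim: n => [|n IH]; rewrite ?expr0 ?normc1// !exprS normcM IH. Qed.

Lemma normc_sum I (r : seq I) (P : pred I) (F : I -> R[i]) :
  normc (\sum_(i <- r | P i) F i) <= \sum_(i <- r | P i) normc (F i).
Proof.
elim/big_ind2 : _ => //[|x a y b xa yb]; first by rewrite normc0.
by rewrite (le_trans (le_normcD _ _)) ?lerD.
Qed.

Lemma lerB_normc z w : normc z - normc w <= normc (z - w).
Proof. by rewrite lerBlDr -{1}[z](subrK w) le_normcD. Qed.

End complex_norm.

Section complex_derivative.
Variable R : realType.
Implicit Types (f g : R[i] -> R[i]) (z : R[i]).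

(* The norm of R[i] in the library takes values in R[i]; normc takes values in R. *)
Definition cdiff f z := exists D : R[i], forall e : R, 0 < e ->
  exists2 t : R, 0 < t & forall h : R[i], normc h < t ->
    normc (f (z + h) - f z - D * h) <= e * normc h.

Lemma nbhs_normcP z (A : set R[i]) : nbhs z A <->
  exists2 t : R, 0 < t & forall w, normc (w - z) < t -> A w.
Proof.
split.
- case/nbhs_ballP => -[t t'] /=; rewrite ltcE /= => /andP[/eqP -> t0] tA.
  exists t => // w wt; apply: tA.
  by rewrite -ball_normE /ball_ /= -opprB normrN normrcE ltcR.
- case=> t t0 tA; apply/nbhs_ballP; exists t%:C => /=; first by rewrite ltcR.
  move=> w; rewrite -ball_normE /ball_ /= -opprB normrN normrcE ltcR; exact: tA.
Qed.

Lemma cdiffP f z : differentiable f z <-> cdiff f z.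
Proof.
split.
- move/derivable1_diffP => /cvg_ex [/= D fD]; exists D => e e0.
  have /fD : nbhs D [set w | normc (w - D) < e].
    by apply/nbhs_normcP; exists e.
  rewrite /= nbhs_simpl /= => /nbhs_normcP[t t0 H]; exists t => // h ht.
  have [->|h0] := eqVneq h 0; first by rewrite addr0 subrr mulr0 subrr normc0 mulr0.
  have := H h; rewrite subr0 => /(_ ht h0).
  rewrite /= /GRing.scale /= mulr1 [h + z]addrC => /ltW.
  have -> : f (z + h) - f z - D * h = (h^-1 * (f (z + h) - f z) - D) * h.
    by rewrite mulrBl mulrAC mulVf// mul1r.
  by rewrite normcM => /ler_wpM2r; apply; exact: normc_ge0.
- case=> D HD; apply/derivable1_diffP/cvg_ex; exists D.
  apply/cvgrPdist_le => /= -[e e']; rewrite ltcE /= => /andP[/eqP -> e0].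
  have [t t0 H] := HD _ e0.
  apply/nbhs_normcP; exists t => // h; rewrite subr0 => ht h0.
  rewrite /= /GRing.scale /= mulr1 [h + z]addrC.
  have := H h ht.
  have -> : f (z + h) - f z - D * h = (h^-1 * (f (z + h) - f z) - D) * h.
    by rewrite mulrBl mulrAC mulVf// mul1r.
  rewrite normcM ler_pM2r ?normc_gt0//.
  by rewrite normcB -lecR -normrcE.
Qed.

Lemma cdiff_cont f z : cdiff f z -> forall e : R, 0 < e -> exists2 t : R, 0 < t &
  forall w, normc (w - z) < t -> normc (f w - f z) < e.
Proof.
move/cdiffP/differentiable_continuous => cf e e0.
have : nbhs (f z) [set w | normc (w - f z) < e] by apply/nbhs_normcP; exists e.
by move/cf/nbhs_normcP.
Qed.

Lemma cdiff_cst c z : cdiff (fun=> c) z.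
Proof. exact/cdiffP/differentiable_cst. Qed.

Lemma cdiff_id z : cdiff id z.
Proof. exact/cdiffP. Qed.

Lemma cdiffD f g z : cdiff f z -> cdiff g z -> cdiff (fun w => f w + g w) z.
Proof. by move=> /cdiffP df /cdiffP dg; exact/cdiffP/differentiableD. Qed.

Lemma cdiffB f g z : cdiff f z -> cdiff g z -> cdiff (fun w => f w - g w) z.
Proof. by move=> /cdiffP df /cdiffP dg; exact/cdiffP/differentiableB. Qed.

Lemma cdiffM f g z : cdiff f z -> cdiff g z -> cdiff (fun w => f w * g w) z.
Proof. by move=> /cdiffP df /cdiffP dg; exact/cdiffP/differentiableM. Qed.

Lemma cdiffX f z n : cdiff f z -> cdiff (fun w => f w ^+ n) z.
Proof.
move=> df; elim: n => [|n IH]; first exact: cdiff_cst.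
under [X in cdiff X]eq_fun do rewrite exprS.
exact: cdiffM.
Qed.

Lemma cdiffV f z : f z != 0 -> cdiff f z -> cdiff (fun w => (f w)^-1) z.
Proof.
move=> f0 /cdiffP/derivable1_diffP df; apply/cdiffP/derivable1_diffP.
exact: derivableV.
Qed.

Lemma cdiff_ext f g z : f =1 g -> cdiff f z -> cdiff g z.
Proof. by move=> /funext ->. Qed.

Lemma cdiff_comp f g z : cdiff f z -> cdiff g (f z) -> cdiff (fun w => g (f w)) z.
Proof.
move=> /cdiffP df /cdiffP dg; apply/cdiffP.
exact: (differentiable_comp df dg).
Qed.

Lemma cdiff_sum I (r : seq I) (F : I -> R[i] -> R[i]) z :
  (forall i, cdiff (F i) z) -> cdiff (fun w => \sum_(i <- r) F i w) z.
Proof.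
move=> dF; elim: r => [|i r IH].
  by apply: cdiff_ext (cdiff_cst 0 z) => w; rewrite big_nil.
by apply: cdiff_ext (cdiffD (dF i) IH) => w; rewrite big_cons.
Qed.

End complex_derivative.

Section real_integral.
Variable R : realType.
Implicit Types (f g F : R -> R) (a b c x : R).

Definition rint f a b : R := \int[lebesgue_measure]_(x in `[a, b]) f x.

(** Continuity is two-sided even at the endpoints: the integrands are restrictions to a segment of
    functions that are differentiable in the plane at its points. *)
Definition cont_on f a b := forall x, a <= x <= b -> {for x, continuous f}.

Lemma cont_on_integrable f a b : cont_on f a b ->
  lebesgue_measure.-integrable `[a, b] (EFin \o f).
Proof.
move=> cf; apply: continuous_compact_integrable; first exact: segment_compact.
by apply: continuous_in_subspaceT => x; rewrite inE /= in_itv /= => /cf.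
Qed.

Lemma rint_split f a b c : cont_on f a b -> a <= c -> c <= b ->
  rint f a b = rint f a c + rint f c b.
Proof.
move=> cf ac cb; apply/eqP; rewrite addrC -subr_eq; apply/eqP.
rewrite /rint Rintegral_itvB ?bnd_simp//; last exact: cont_on_integrable.
rewrite Rintegral_itv_obnd_cbnd//.
apply: integrableS (cont_on_integrable cf) => //.
by apply: subset_itvr; rewrite bnd_simp.
Qed.

Lemma rintD f g a b : cont_on f a b -> cont_on g a b ->
  rint (fun x => f x + g x) a b = rint f a b + rint g a b.
Proof. by move=> cf cg; apply: RintegralD => //; exact: cont_on_integrable. Qed.

Lemma rintZ k f a b : cont_on f a b -> rint (fun x => k * f x) a b = k * rint f a b.
Proof. by move=> cf; apply: RintegralZl => //; exact: cont_on_integrable. Qed.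

Lemma rint_cst (k : R) a b : a <= b -> rint (fun=> k) a b = k * (b - a).
Proof.
move=> ab; rewrite /rint Rintegral_cst//.
congr (_ * _); have := @lebesgue_measure_itv R `[a, b].
rewrite /= lte_fin => mab; transitivity (fine (b - a)%:E); last by [].
congr fine; apply: (eq_trans mab).
by case: ltgtP ab => //= -> _; rewrite subrr.
Qed.

Lemma cont_on_cst (k : R) a b : cont_on (fun=> k) a b.
Proof. by move=> x _; exact: cst_continuous. Qed.

Lemma rint_bound f a b (M : R) : a <= b -> cont_on f a b ->
  (forall x, a <= x <= b -> `|f x| <= M) -> `|rint f a b| <= M * (b - a).
Proof.
move=> ab cf fM; rewrite -rint_cst//.
apply: le_trans (le_normr_Rintegral _ (cont_on_integrable cf)) _ => //.
apply: le_Rintegral => //=.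
- by apply: (cont_on_integrable (f := fun x => `|f x|)) => x /cf; exact: cvg_norm.
- exact: (cont_on_integrable (@cont_on_cst M a b)).
Qed.

Lemma rint_ge f a b (m : R) : a <= b -> cont_on f a b ->
  (forall x, a <= x <= b -> m <= f x) -> m * (b - a) <= rint f a b.
Proof.
move=> ab cf fm; rewrite -rint_cst//; apply: le_Rintegral => //=.
- exact: (cont_on_integrable (@cont_on_cst m a b)).
- exact: cont_on_integrable.
Qed.

Lemma rint_pt f a : rint f a a = 0.
Proof. by rewrite /rint set_itv1 Rintegral_set1. Qed.

Lemma eq_rint f g a b : (forall x, a <= x <= b -> f x = g x) -> rint f a b = rint g a b.
Proof. by move=> fg; apply: eq_Rintegral => x; rewrite inE /= in_itv /= => /fg. Qed.

Lemma rint_id a b : a <= b -> rint id a b = (b ^+ 2 - a ^+ 2) / 2.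
Proof.
rewrite le_eqVlt => /predU1P[->|ab]; first by rewrite rint_pt subrr mul0r.
pose F x := x ^+ 2 / 2.
have dF x : is_derive x 1 F x.
  rewrite /F; apply: is_derive_eq.
  by rewrite /GRing.scale /=; field.
rewrite /rint /Rintegral (@continuous_FTC2 _ _ F)//=; first by rewrite /F mulrBl.
- by apply: continuous_subspaceT => x; exact: cvg_id.
- have cF x : {for x, continuous F} by apply: differentiable_continuous; apply/derivable1_diffP; case: (dF x).
  split; first by move=> x _; case: (dF x).
  + by apply: cvg_at_right_filter; exact: cF.
  + by apply: cvg_at_left_filter; exact: cF.
- by move=> x _; rewrite derive1E; apply: derive_val.
Qed.

End real_integral.

(** * Contour integrals along rectangles *)

Section complex_integral.
Variable R : realType.
Implicit Types (f g : R -> R[i]) (F G : R[i] -> R[i]) (a b c d x y : R).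

Definition cint f a b : R[i] :=
  rint (fun x => complex.Re (f x)) a b +i* rint (fun x => complex.Im (f x)) a b.

Definition ccont_on f a b := cont_on (fun x => complex.Re (f x)) a b /\
  cont_on (fun x => complex.Im (f x)) a b.

Lemma eq_cint f g a b : (forall x, a <= x <= b -> f x = g x) -> cint f a b = cint g a b.
Proof. by move=> fg; congr (_ +i* _); apply: eq_rint => x /fg ->. Qed.

Lemma cint_split f a b c : ccont_on f a b -> a <= c -> c <= b ->
  cint f a b = cint f a c + cint f c b.
Proof.
move=> [c1 c2] ac cb.
by rewrite /cint (rint_split c1 ac cb) (rint_split c2 ac cb).
Qed.

Lemma cintD f g a b : ccont_on f a b -> ccont_on g a b ->
  cint (fun x => f x + g x) a b = cint f a b + cint g a b.
Proof.
move=> [f1 f2] [g1 g2]; apply/eqP; rewrite eq_complex /= -!rintD//.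
by apply/andP; split; apply/eqP/eq_rint => x _; case: (f x); case: (g x).
Qed.

Lemma cont_onZ (k : R) (u : R -> R) a b : cont_on u a b -> cont_on (fun x => k * u x) a b.
Proof. by move=> cu x /cu; apply: cvgM; exact: cvg_cst. Qed.

Lemma cintZ k f a b : ccont_on f a b -> cint (fun x => k * f x) a b = k * cint f a b.
Proof.
case: k => k1 k2 [f1 f2]; apply/eqP; rewrite eq_complex /=.
apply/andP; split; apply/eqP.
- rewrite -mulNr -!rintZ// -rintD; [|exact: cont_onZ..].
  by apply: eq_rint => x _; case: (f x) => u v /=; rewrite mulNr.
- rewrite -!rintZ// -rintD; [|exact: cont_onZ..].
  by apply: eq_rint => x _; case: (f x) => u v /=.
Qed.

(** The factor 2 arises because the real and imaginary parts are estimated separately, each by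
    [M]. *)
Lemma cint_bound f a b (M : R) : a <= b -> ccont_on f a b ->
  (forall x, a <= x <= b -> normc (f x) <= M) -> normc (cint f a b) <= 2 * M * (b - a).
Proof.
move=> ab [f1 f2] fM; apply: le_trans (normc_le _) _; rewrite /cint /=.
rewrite -mulrA mulr_natl mulr2n; apply: lerD; apply: rint_bound => // x /fM; apply: le_trans.
- exact: normc_Re.
- exact: normc_Im.
Qed.

Lemma cint_affine (u v : R[i]) a b : a <= b ->
  cint (fun x => u + v * x%:C) a b = u * (b - a)%:C + v * ((b ^+ 2 - a ^+ 2) / 2)%:C.
Proof.
have ci (w : R) : cont_on (fun x => w * x) a b by apply: cont_onZ => x _; exact: cvg_id.
case: u => u1 u2; case: v => v1 v2 ab; rewrite /cint.
have E (w1 w2 : R) : rint (fun x => w1 + w2 * x) a b = w1 * (b - a) + w2 * ((b ^+ 2 - a ^+ 2) / 2).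
  by rewrite rintD ?rintZ ?rint_id ?rint_cst//; [move=> x _; exact: cvg_id|exact: cont_on_cst].
rewrite /real_complex_def /=.
apply/eqP; rewrite eq_complex /= !mulr0 !subr0; apply/andP; split; apply/eqP.
- by rewrite -E; apply: eq_rint => x _; rewrite subr0.
- by rewrite !add0r -E; apply: eq_rint => x _; rewrite add0r.
Qed.

Definition hseg F y a b := forall x, a <= x <= b -> cdiff F (x +i* y).
Definition vseg F x c d := forall y, c <= y <= d -> cdiff F (x +i* y).

Lemma normcBx x x' y : normc ((x +i* y) - (x' +i* y)) = `|x - x'|.
Proof. by rewrite /= subrr expr0n addr0 sqrtr_sqr. Qed.

Lemma normcBy x y y' : normc ((x +i* y) - (x +i* y')) = `|y - y'|.
Proof. by rewrite /= subrr expr0n add0r sqrtr_sqr. Qed.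

Lemma cont_at_normc (f : R -> R[i]) x :
  (forall e : R, 0 < e -> exists2 t : R, 0 < t & forall x', `|x' - x| < t -> normc (f x' - f x) < e) ->
  {for x, continuous (fun x => complex.Re (f x))} /\ {for x, continuous (fun x => complex.Im (f x))}.
Proof.
move=> H; split; apply/cvgrPdist_lt => e /H[t t0 Ht]; near=> x'.
- have : `|x' - x| < t by rewrite distrC; near: x'; exact: cvgr_dist_lt (cvg_id) _ t0.
  move=> /Ht; apply: le_lt_trans; rewrite distrC.
  by have := normc_Re (f x' - f x); case: (f x') => ? ?; case: (f x).
- have : `|x' - x| < t by rewrite distrC; near: x'; exact: cvgr_dist_lt (cvg_id) _ t0.
  move=> /Ht; apply: le_lt_trans; rewrite distrC.
  by have := normc_Im (f x' - f x); case: (f x') => ? ?; case: (f x).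
Unshelve. all: by end_near. Qed.

Lemma hseg_cont F y a b : hseg F y a b -> ccont_on (fun x => F (x +i* y)) a b.
Proof.
move=> H; suff K x : a <= x <= b -> {for x, continuous (fun x => complex.Re (F (x +i* y)))} /\
   {for x, continuous (fun x => complex.Im (F (x +i* y)))} by split => x /K[].
move=> /H /cdiff_cont cF; apply: (cont_at_normc (f := fun x => F (x +i* y))) => e /cF[t t0 Ht].
by exists t => // x' xt; apply: Ht; rewrite normcBx.
Qed.

Lemma vseg_cont F x c d : vseg F x c d -> ccont_on (fun y => F (x +i* y)) c d.
Proof.
move=> H; suff K y : c <= y <= d -> {for y, continuous (fun y => complex.Re (F (x +i* y)))} /\
   {for y, continuous (fun y => complex.Im (F (x +i* y)))} by split => y /K[].
move=> /H /cdiff_cont cF; apply: (cont_at_normc (f := fun y => F (x +i* y))) => e /cF[t t0 Ht].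
by exists t => // y' yt; apply: Ht; rewrite normcBy.
Qed.

(** The integral of F dz along the boundary of [a, b] x [c, d], counterclockwise; on the vertical
    sides dz = i dy. *)
Definition bint F a b c d : R[i] :=
  cint (fun x => F (x +i* c)) a b - cint (fun x => F (x +i* d)) a b +
  'i * (cint (fun y => F (b +i* y)) c d - cint (fun y => F (a +i* y)) c d).

Definition frame F a b c d := [/\ hseg F c a b, hseg F d a b, vseg F a c d & vseg F b c d].

Definition on_rect F a b c d := forall x y, a <= x <= b -> c <= y <= d -> cdiff F (x +i* y).

Lemma on_rect_sub F a b c d a' b' c' d' : on_rect F a b c d ->
  a <= a' -> b' <= b -> c <= c' -> d' <= d -> on_rect F a' b' c' d'.
Proof.
move=> H aa bb cc dd x y /andP[x1 x2] /andP[y1 y2]; apply: H.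
  by rewrite (le_trans aa)// (le_trans x2).
by rewrite (le_trans cc)// (le_trans y2).
Qed.

Lemma on_rect_frame F a b c d : a <= b -> c <= d -> on_rect F a b c d -> frame F a b c d.
Proof. by move=> ab cd H; split=> x xab; apply: H; rewrite ?lexx ?ab ?cd. Qed.

Lemma bint_vsplit F a b c d m : hseg F c a b -> hseg F d a b -> a <= m -> m <= b ->
  bint F a b c d = bint F a m c d + bint F m b c d.
Proof.
move=> /hseg_cont h1 /hseg_cont h2 am mb; rewrite /bint.
by rewrite (cint_split h1 am mb) (cint_split h2 am mb); ring.
Qed.

Lemma bint_hsplit F a b c d m : vseg F a c d -> vseg F b c d -> c <= m -> m <= d ->
  bint F a b c d = bint F a b c m + bint F a b m d.
Proof.
move=> /vseg_cont h1 /vseg_cont h2 am mb; rewrite /bint.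
by rewrite (cint_split h1 am mb) (cint_split h2 am mb); ring.
Qed.

Lemma bintD F G a b c d : frame F a b c d -> frame G a b c d ->
  bint (fun z => F z + G z) a b c d = bint F a b c d + bint G a b c d.
Proof.
move=> [/hseg_cont F1 /hseg_cont F2 /vseg_cont F3 /vseg_cont F4].
move=> [/hseg_cont G1 /hseg_cont G2 /vseg_cont G3 /vseg_cont G4].
by rewrite /bint !cintD//; ring.
Qed.

Lemma bintZ k F a b c d : frame F a b c d ->
  bint (fun z => k * F z) a b c d = k * bint F a b c d.
Proof.
move=> [/hseg_cont F1 /hseg_cont F2 /vseg_cont F3 /vseg_cont F4].
by rewrite /bint !cintZ//; ring.
Qed.

Lemma eq_bint F G a b c d : (forall x, a <= x <= b -> F (x +i* c) = G (x +i* c)) ->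
  (forall x, a <= x <= b -> F (x +i* d) = G (x +i* d)) ->
  (forall y, c <= y <= d -> F (a +i* y) = G (a +i* y)) ->
  (forall y, c <= y <= d -> F (b +i* y) = G (b +i* y)) ->
  bint F a b c d = bint G a b c d.
Proof.
by move=> H1 H2 H3 H4; rewrite /bint (eq_cint H1) (eq_cint H2) (eq_cint H3) (eq_cint H4).
Qed.

Lemma bint_bound F a b c d (M : R) : a <= b -> c <= d -> frame F a b c d ->
  (forall x, a <= x <= b -> normc (F (x +i* c)) <= M) ->
  (forall x, a <= x <= b -> normc (F (x +i* d)) <= M) ->
  (forall y, c <= y <= d -> normc (F (a +i* y)) <= M) ->
  (forall y, c <= y <= d -> normc (F (b +i* y)) <= M) ->
  normc (bint F a b c d) <= 4 * M * ((b - a) + (d - c)).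
Proof.
move=> ab cd [/hseg_cont F1 /hseg_cont F2 /vseg_cont F3 /vseg_cont F4] M1 M2 M3 M4.
have i1 : normc ('i : R[i]) = 1 by rewrite /= expr0n expr1n add0r sqrtr1.
apply: le_trans (le_normcD _ _) _; rewrite normcM i1 mul1r.
have := cint_bound ab F1 M1; have := cint_bound ab F2 M2.
have := cint_bound cd F3 M3; have := cint_bound cd F4 M4.
have nB (z w : R[i]) : normc (z - w) <= normc z + normc w.
  by apply: le_trans (le_normcD _ _) _; rewrite normcN.
move=> h4 h3 h2 h1; apply: le_trans (lerD (nB _ _) (nB _ _)) _.
apply: le_trans (lerD (lerD h1 h2) (lerD h4 h3)) _.
by rewrite le_eqVlt; apply/orP; left; apply/eqP; ring.
Qed.

(** This is what allows the first order Taylor polynomial to be subtracted in [goursat]. *)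
Lemma bint_affine (u v : R[i]) a b c d : a <= b -> c <= d ->
  bint (fun z => u + v * z) a b c d = 0.
Proof.
move=> ab cd; rewrite /bint.
have E1 y : (fun x => u + v * (x +i* y)) = (fun x => (u + v * 'i * y%:C) + v * x%:C).
  apply/funext => x; rewrite -addrA -mulrA -mulrDr; congr (_ + _ * _).
  by rewrite [LHS]complexE addrC.
have E2 x : (fun y => u + v * (x +i* y)) = (fun y => (u + v * x%:C) + (v * 'i) * y%:C).
  apply/funext => y; rewrite -addrA -mulrA -mulrDr; congr (_ + _ * _).
  by rewrite [LHS]complexE.
rewrite !E1 !E2 !cint_affine// !rmorphB /=.
have i2 : 'i * 'i = -1 :> R[i] by rewrite -expr2 sqr_i.
transitivity (v * ((b%:C - a%:C) * (d%:C - c%:C) * ('i - 'i)) : R[i]); last by rewrite subrr !mulr0.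
by ring.
Qed.

End complex_integral.

Section goursat.
Variable R : realType.
Implicit Types (F : R[i] -> R[i]).

Local Arguments normc : simpl never.
Local Arguments bint : simpl never.

Let rect := (R * R * (R * R))%type.
Let J F (r : rect) := bint F r.1.1 r.1.2 r.2.1 r.2.2.
Let mid (a b : R) := (a + b) / 2.
Let q1 (r : rect) : rect := ((r.1.1, mid r.1.1 r.1.2), (r.2.1, mid r.2.1 r.2.2)).
Let q2 (r : rect) : rect := ((mid r.1.1 r.1.2, r.1.2), (r.2.1, mid r.2.1 r.2.2)).
Let q3 (r : rect) : rect := ((r.1.1, mid r.1.1 r.1.2), (mid r.2.1 r.2.2, r.2.2)).
Let q4 (r : rect) : rect := ((mid r.1.1 r.1.2, r.1.2), (mid r.2.1 r.2.2, r.2.2)).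
(** The first quarter that carries at least a fourth of the modulus of the integral. The default
    [q4] qualifies when the other three fail, because the four moduli add up to at least the whole
    ([quarter_ge]). *)
Let quarter F r := if normc (J F r) <= 4 * normc (J F (q1 r)) then q1 r else
  if normc (J F r) <= 4 * normc (J F (q2 r)) then q2 r else
  if normc (J F r) <= 4 * normc (J F (q3 r)) then q3 r else q4 r.

Let quarter_or F r : [\/ quarter F r = q1 r, quarter F r = q2 r, quarter F r = q3 r |
  quarter F r = q4 r].
Proof.
rewrite /quarter; case: ifP => _; first exact: Or41; case: ifP => _; first exact: Or42.
by case: ifP => _; [exact: Or43|exact: Or44].
Qed.

Let J_split F r : r.1.1 <= r.1.2 -> r.2.1 <= r.2.2 ->
  on_rect F r.1.1 r.1.2 r.2.1 r.2.2 -> J F r = J F (q1 r) + J F (q2 r) + (J F (q3 r) + J F (q4 r)).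
Proof.
case: r => [[a b] [c d]] /= ab cd H.
have [am mb] : a <= mid a b /\ mid a b <= b by rewrite /mid; split; lra.
have [cm md] : c <= mid c d /\ mid c d <= d by rewrite /mid; split; lra.
rewrite /J /= (@bint_hsplit _ _ _ _ _ _ (mid c d))//; last first.
- by move=> y y_cd; apply: H; rewrite ?lexx ?ab.
- by move=> y y_cd; apply: H; rewrite ?lexx ?ab.
congr (_ + _); rewrite (@bint_vsplit _ _ _ _ _ _ (mid a b))//.
all: by move=> x x_ab; apply: H; rewrite ?lexx ?cd ?cm ?md.
Qed.

Let quarter_ge F r : r.1.1 <= r.1.2 -> r.2.1 <= r.2.2 ->
  on_rect F r.1.1 r.1.2 r.2.1 r.2.2 -> normc (J F r) <= 4 * normc (J F (quarter F r)).
Proof.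
have aux (s t1 t2 t3 t4 : R) : 4 * t1 < s -> 4 * t2 < s -> 4 * t3 < s ->
  s <= t1 + t2 + (t3 + t4) -> s <= 4 * t4 by lra.
move=> ab cd H; rewrite /quarter; case: ifPn => // n1; case: ifPn => // n2; case: ifPn => // n3.
rewrite -!ltNge in n1 n2 n3; apply: aux n1 n2 n3 _.
have := J_split ab cd H => /(congr1 (@normc R)) E.
by rewrite E; apply: le_trans (le_normcD _ _) _; apply: lerD; exact: le_normcD.
Qed.

(** Bisection: the n-th rectangle still carries a 4^-n part of the integral. At the common point F
    differs from its first order Taylor polynomial by at most e times the distance, so the n-th
    integral is at most 4 e (L / 2^n)^2, and the powers of 4 cancel. *)
Lemma goursat F a b c d : a <= b -> c <= d -> on_rect F a b c d -> bint F a b c d = 0.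
Proof.
move=> ab cd H; apply/eqP; rewrite -normc_eq0; apply/eqP.
pose r n := iter n (quarter F) ((a, b), (c, d)).
have rS n : r n.+1 = quarter F (r n) by [].
have rle n : [/\ (r n).1.1 <= (r n).1.2, (r n).2.1 <= (r n).2.2, a <= (r n).1.1, (r n).1.2 <= b &
    c <= (r n).2.1 /\ (r n).2.2 <= d].
  elim: n => [|n]; first by rewrite /= !lexx ab cd.
  rewrite rS; case: (r n) => -[x1 x2] [y1 y2] /= [h1 h2 h3 h4 [h5 h6]].
  by case: (quarter_or F ((x1, x2), (y1, y2))) => ->; rewrite /= /mid; split; try split; lra.
have rin n : [/\ (r n).1.1 <= (r n.+1).1.1, (r n.+1).1.2 <= (r n).1.2,
    (r n).2.1 <= (r n.+1).2.1 & (r n.+1).2.2 <= (r n).2.2].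
  rewrite rS; have := rle n; case: (r n) => -[x1 x2] [y1 y2] /= [h1 h2 h3 h4 [h5 h6]].
  by case: (quarter_or F ((x1, x2), (y1, y2))) => ->; rewrite /= /mid; split; lra.
have rsz n : (r n).1.2 - (r n).1.1 = (b - a) / 2 ^+ n /\ (r n).2.2 - (r n).2.1 = (d - c) / 2 ^+ n.
  elim: n => [|n]; first by rewrite expr0 !divr1.
  rewrite rS exprS invfM !mulrA; case: (r n) => -[x1 x2] [y1 y2] /= [h1 h2].
  have -> : (b - a) / 2 / 2 ^+ n = (x2 - x1) / 2 by rewrite h1; ring.
  have -> : (d - c) / 2 / 2 ^+ n = (y2 - y1) / 2 by rewrite h2; ring.
  by case: (quarter_or F ((x1, x2), (y1, y2))) => ->; rewrite /= /mid; split; field.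
have rJ n : normc (J F ((a, b), (c, d))) <= 4 ^+ n * normc (J F (r n)).
  elim: n => [|n IH]; first by rewrite expr0 mul1r.
  apply: (le_trans IH); rewrite exprSr -mulrA ler_pM2l ?exprn_gt0//.
  have [h1 h2 h3 h4 [h5 h6]] := rle n.
  by apply: quarter_ge => //; exact: on_rect_sub H h3 h4 h5 h6.
(* the point common to all the rectangles *)
have mono (u v : nat -> R) : (forall n, u n <= u n.+1) -> (forall n, v n.+1 <= v n) ->
    (forall n, u n <= v n) -> exists x, forall n, u n <= x <= v n.
  move=> uS vS uv.
  have um n k : u n <= u (n + k)%N by elim: k => [|k IH]; rewrite ?addn0// addnS (le_trans IH).
  have vm n k : v (n + k)%N <= v n by elim: k => [|k IH]; rewrite ?addn0// addnS (le_trans _ IH).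
  have ub m : ubound (range u) (v m).
    move=> _ [n _ <-]; apply: le_trans (um n m) _; apply: le_trans (uv _) _.
    by rewrite addnC vm.
  exists (sup (range u)) => n; apply/andP; split.
  - by apply: ub_le_sup; [exists (v 0%N); exact: ub|exists n].
  - by apply: ge_sup; [exists (u 0%N), 0%N|exact: ub].
have [x0 Hx0] : exists x, forall n, (r n).1.1 <= x <= (r n).1.2.
  by apply: mono => n; [case: (rin n)|case: (rin n)|case: (rle n)].
have [y0 Hy0] : exists x, forall n, (r n).2.1 <= x <= (r n).2.2.
  by apply: mono => n; [case: (rin n)|case: (rin n)|case: (rle n)].
have [D HD] := H x0 y0 (Hx0 0%N) (Hy0 0%N).
pose L := (b - a) + (d - c).
have L0 : 0 <= L by rewrite /L; lra.
have key (e : R) : 0 < e -> normc (J F ((a, b), (c, d))) <= 4 * e * L ^+ 2.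
  move=> e0; have [t t0 Ht] := HD e e0.
  have [n Ln] : exists n, L / 2 ^+ n < t.
    (* [L + 1] replaces [L] as a divisor, since a degenerate rectangle has [L] = 0. *)
    have [n _ /(_ n (leqnn n)) Hn] := near_infty_natSinv_expn_lt (PosNum (divr_gt0 t0 (ltr_wpDl L0 ltr01))).
    exists n; move: Hn => /= Hn.
    have L1 : 0 < L + 1 by rewrite ltr_wpDl.
    have p2 : 0 < 2^-1 ^+ n :> R by rewrite exprn_gt0// invr_gt0.
    rewrite -exprVn; move: Hn; rewrite div1r -exprVn ltr_pdivlMr// => Hn.
    by apply: le_lt_trans Hn; rewrite mulrC ler_pM2l// lerDl.
  apply: le_trans (rJ n) _.
  have [h1 h2 h3 h4 [h5 h6]] := rle n; have [s1 s2] := rsz n.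
  have Hn : on_rect F (r n).1.1 (r n).1.2 (r n).2.1 (r n).2.2 by exact: on_rect_sub H h3 h4 h5 h6.
  have Hx := Hx0 n; have Hy := Hy0 n; rewrite /J.
  move: h1 h2 s1 s2 Hn Hx Hy; case: (r n) => -[x1 x2] [y1 y2] /= h1 h2 s1 s2 Hn Hx Hy.
  pose z0 := x0 +i* y0.
  (* Minus the Taylor polynomial of F at the common point; adding it does not change the
     integral. *)
  pose A z := (- F z0 + D * z0) + (- D) * z.
  have dA z : cdiff A z by apply: cdiffD; [exact: cdiff_cst|apply: cdiffM; [exact: cdiff_cst|exact: cdiff_id]].
  have frF := on_rect_frame h1 h2 Hn.
  have frA : frame A x1 x2 y1 y2 by split => x _; exact: dA.
  have -> : bint F x1 x2 y1 y2 = bint (fun z => F z + A z) x1 x2 y1 y2.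
    by rewrite bintD// bint_affine// addr0.
  have bnd x y : x1 <= x <= x2 -> y1 <= y <= y2 -> normc (F (x +i* y) + A (x +i* y)) <= e * (L / 2 ^+ n).
    move=> /andP[xx1 xx2] /andP[yy1 yy2]; move: Hx Hy => /andP[a1 a2] /andP[a3 a4].
    have nh : normc (x +i* y - z0) <= L / 2 ^+ n.
      apply: le_trans (normc_le _) _; rewrite /L mulrDl -s1 -s2 /=.
      by apply: lerD; rewrite ler_norml; apply/andP; split; lra.
    have := Ht _ (le_lt_trans nh Ln); rewrite [z0 + _]addrC subrK.
    have -> : F (x +i* y) - F z0 - D * (x +i* y - z0) = F (x +i* y) + A (x +i* y).
      by rewrite /A; ring.
    by move=> /le_trans; apply; rewrite ler_pM2l.
  have B := @bint_bound _ (fun z => F z + A z) x1 x2 y1 y2 (e * (L / 2 ^+ n)) h1 h2.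
  apply: le_trans (ler_wpM2l _ (B _ _ _ _ _)) _; first by rewrite exprn_ge0.
  - by apply: on_rect_frame => // x y hx hy; apply: cdiffD; [exact: Hn|exact: dA].
  - by move=> x hx; apply: bnd; rewrite ?lexx ?h1 ?h2.
  - by move=> x hx; apply: bnd; rewrite ?lexx ?h1 ?h2.
  - by move=> x hx; apply: bnd; rewrite ?lexx ?h1 ?h2.
  - by move=> x hx; apply: bnd; rewrite ?lexx ?h1 ?h2.
  - rewrite s1 s2 -mulrDl -/L.
    have -> : 4 ^+ n = 2 ^+ n * 2 ^+ n :> R by rewrite -exprMn -natrM.
    have p2 : 2 ^+ n != 0 :> R by rewrite expf_neq0.
    by rewrite le_eqVlt; apply/orP; left; apply/eqP; field.
apply/eqP; rewrite eq_le normc_ge0 andbT; apply/ler_addgt0Pl => e e0; rewrite addr0.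
have p : 0 < L ^+ 2 + 1 by rewrite ltr_wpDl// sqr_ge0.
apply: le_trans (key (e / (4 * (L ^+ 2 + 1))) _) _; first by rewrite divr_gt0// mulr_gt0.
have -> : 4 * (e / (4 * (L ^+ 2 + 1))) * L ^+ 2 = e * (L ^+ 2 / (L ^+ 2 + 1)) by field; rewrite gt_eqF.
by rewrite ler_piMr ?(ltW e0)// ler_pdivrMr// mul1r lerDl.
Qed.

End goursat.

(** * Cauchy's formula and Taylor expansion on squares *)

Section cauchy.
Variable R : realType.
Implicit Types (F f : R[i] -> R[i]) (a b c d r : R) (z w : R[i]).
Local Arguments normc : simpl never.
Local Arguments bint : simpl never.

(** The region between the two rectangles is cut into two horizontal bands and two side pieces, on
    which [goursat] applies. Differentiability may fail inside the inner rectangle, which is where a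
    pole will sit. *)
Lemma bint_inner F a b c d a' b' c' d' :
  a <= a' -> a' <= b' -> b' <= b -> c <= c' -> c' <= d' -> d' <= d ->
  (forall x y, a <= x <= b -> c <= y <= d -> ~~ ((a' < x < b') && (c' < y < d')) ->
     cdiff F (x +i* y)) ->
  bint F a b c d = bint F a' b' c' d'.
Proof.
move=> aa ab bb cc cd dd H.
have G x1 x2 y1 y2 : a <= x1 -> x1 <= x2 -> x2 <= b -> c <= y1 -> y1 <= y2 -> y2 <= d ->
    ((x2 <= a') || (b' <= x1)) || ((y2 <= c') || (d' <= y1)) ->
    on_rect F x1 x2 y1 y2.
  move=> h1 h2 h3 h4 h5 h6 h7 x y /andP[l1 l2] /andP[l3 l4]; apply: H.
  - by rewrite (le_trans h1)// (le_trans l2).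
  - by rewrite (le_trans h4)// (le_trans l4).
  - rewrite !negb_and -!leNgt; case/orP: h7 => /orP[] h7.
    + by rewrite (le_trans l2 h7).
    + by rewrite (le_trans h7 l1) orbT.
    + by rewrite (le_trans l4 h7) orbT.
    + by rewrite (le_trans h7 l3) !orbT.
have ab' : a <= b by rewrite (le_trans aa)// (le_trans ab).
have cd' : c <= d by rewrite (le_trans cc)// (le_trans cd).
have ab1 : a <= b' := le_trans aa ab.
have a'b := le_trans ab bb.
have c'd := le_trans cd dd.
have cd1 := le_trans cc cd.
have hs y : c <= y <= d -> (y <= c') || (d' <= y) -> hseg F y a b.
  move=> /andP[y1 y2] h x xab; apply: (G a b y y); rewrite ?lexx//.
  by rewrite h orbT.
have vs x : a <= x <= b -> (x <= a') || (b' <= x) -> vseg F x c d.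
  move=> /andP[x1 x2] h y ycd; apply: (G x x c d); rewrite ?lexx//.
  by rewrite h.
have vs' x y1 y2 : a <= x <= b -> (x <= a') || (b' <= x) -> c <= y1 -> y2 <= d -> vseg F x y1 y2.
  move=> h1 h2 h3 h4 y /andP[l1 l2]; apply: (vs _ h1 h2).
  by rewrite (le_trans h3)// (le_trans l2).
rewrite (@bint_hsplit _ _ _ _ _ _ c')//; [|by apply: vs; rewrite ?lexx ?ab' ?aa ?bb ?orbT..].
rewrite (goursat ab' cc) ?add0r; last by apply: G; rewrite ?lexx// orbT.
rewrite (@bint_hsplit _ _ _ _ _ _ d')//; [|by apply: vs'; rewrite ?lexx ?ab' ?aa ?bb ?orbT..].
rewrite (goursat ab' dd) ?addr0; last by apply: G; rewrite ?lexx// !orbT.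
have hs' y : c <= y <= d -> (y <= c') || (d' <= y) -> hseg F y a' b.
  move=> h1 h2 x /andP[l1 l2]; apply: (hs _ h1 h2).
  by rewrite (le_trans aa)// (le_trans l2).
rewrite (@bint_vsplit _ _ _ _ _ _ a')//; [|by apply: hs; rewrite ?lexx ?cc ?dd ?cd1 ?c'd ?orbT..].
rewrite (goursat aa cd) ?add0r; last by apply: G; rewrite ?lexx.
rewrite (@bint_vsplit _ _ _ _ _ _ b')//; [|by apply: hs'; rewrite ?lexx ?cc ?dd ?cd1 ?c'd ?orbT..].
by rewrite (goursat bb cd) ?addr0//; apply: G; rewrite ?lexx// orbT.
Qed.

(** Squares take the place of circles because the integral is defined along sides parallel to the
    axes. The sides lie in the annulus r <= |z| <= 2 r, whence the hypotheses up to [2 * r]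
    below. *)
Definition sqint F r := bint F (- r) r (- r) r.

Definition on_sq (P : R[i] -> Prop) r := forall t, - r <= t <= r ->
  [/\ P (t +i* (- r)), P (t +i* r), P ((- r) +i* t) & P (r +i* t)].

Lemma on_sq_ge r : 0 < r ->
  on_sq (fun z => r <= normc z) r.
Proof.
move=> r0 t tr; split; have rr : r <= `|r| := ler_norm r.
- by apply: le_trans (normc_Im _); rewrite /= normrN.
- exact: le_trans (normc_Im _).
- by apply: le_trans (normc_Re _); rewrite /= normrN.
- exact: le_trans (normc_Re _).
Qed.

Lemma on_sq_impl (P Q : R[i] -> Prop) r : (forall z, P z -> Q z) -> on_sq P r -> on_sq Q r.
Proof. by move=> PQ H t /H[? ? ? ?]; split; apply: PQ. Qed.

Lemma on_sq_and (P Q : R[i] -> Prop) r : on_sq P r -> on_sq Q r -> on_sq (fun z => P z /\ Q z) r.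
Proof. by move=> H1 H2 t tr; have [? ? ? ?] := H1 t tr; have [? ? ? ?] := H2 t tr. Qed.

Lemma on_sq_frame F r : on_sq (cdiff F) r -> frame F (- r) r (- r) r.
Proof. by move=> H; split=> x /H[]. Qed.

Lemma sqint_bound F r (M : R) : 0 < r -> on_sq (cdiff F) r ->
  on_sq (fun z => normc (F z) <= M) r -> normc (sqint F r) <= 16 * M * r.
Proof.
move=> r0 dF FM; have rr : - r <= r by rewrite (@le_trans _ _ 0)// ?oppr_le0 ltW.
apply: le_trans (@bint_bound _ F (- r) r (- r) r M rr rr _ _ _ _ _) _.
- exact: on_sq_frame.
- by move=> x /FM[].
- by move=> x /FM[].
- by move=> x /FM[].
- by move=> x /FM[].
- by rewrite le_eqVlt; apply/orP; left; apply/eqP; ring.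
Qed.

Lemma sqint_ext F f r : on_sq (fun z => F z = f z) r -> sqint F r = sqint f r.
Proof. by move=> H; apply: eq_bint => x /H[]. Qed.

Lemma sqint_radius F r1 r2 : 0 < r1 -> r1 <= r2 ->
  (forall z, r1 <= normc z -> normc z <= 2 * r2 -> cdiff F z) -> sqint F r2 = sqint F r1.
Proof.
move=> r0 rr H; have r20 := lt_le_trans r0 rr.
apply: bint_inner; rewrite ?lerN2//; [lra|lra|].
move=> x y xr yr h; apply: H.
- have [h1|h1] := leP r1 `|x|; first exact: (le_trans h1 (normc_Re (x +i* y))).
  have [h2|h2] := leP r1 `|y|; first exact: (le_trans h2 (normc_Im (x +i* y))).
  by move: h; rewrite -!ltr_norml h1 h2.
- apply: le_trans (normc_le _) _ => /=; rewrite mulr_natl mulr2n.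
  by apply: lerD; rewrite ler_norml.
Qed.

(* The integral of 1/z around the square; it is 2 pi i, but only the fact that it
   is not close to zero matters. *)
Definition winding : R[i] := sqint (fun z => z^-1) 1.

Lemma sq_nz r z : 0 < r -> r <= normc z -> z != 0.
Proof. by move=> r0 rz; rewrite -normc_gt0 (lt_le_trans r0). Qed.

(** Each side contributes the integral of 1 / (x^2 + 1) over [-1, 1] to the imaginary part, hence at
    least 2 * 1/2 = 1. *)
Lemma winding_ge : 4 <= normc winding.
Proof.
have dI : on_sq (cdiff (fun z => z^-1)) 1.
  apply: on_sq_impl (on_sq_ge ltr01) => z /(sq_nz ltr01) z0.
  by apply: cdiffV => //; exact: cdiff_id.
have [/hseg_cont[_ c1] /hseg_cont[_ c2] /vseg_cont[c3 _] /vseg_cont[c4 _]] := on_sq_frame dI.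
apply: le_trans (normc_Im _); apply: le_trans (ler_norm _).
rewrite /winding /sqint /bint /cint /=.
have m1 : -1 <= 1 :> R by lra.
have h1 (x u : R) : -1 <= x <= 1 -> u = x ^+ 2 + 1 -> 2^-1 <= u^-1.
  by move=> /andP[x1 x2] ->; rewrite lef_pV2 ?posrE ?ltr_wpDl ?sqr_ge0//; nra.
have P (g : R -> R) : cont_on g (-1) 1 -> (forall x, -1 <= x <= 1 -> 2^-1 <= g x) ->
    1 <= rint g (-1) 1.
  move=> cg gm; have := rint_ge m1 cg gm.
  by have -> : 2^-1 * (1 - -1) = 1 :> R by field.
have N (g : R -> R) : cont_on g (-1) 1 -> (forall x, -1 <= x <= 1 -> 2^-1 <= - g x) ->
    1 <= - rint g (-1) 1.
  move=> cg gm; have := P _ (cont_onZ (k := -1) cg); rewrite rintZ// mulN1r; apply.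
  by move=> x /gm; rewrite mulN1r.
have {c1}i1 := P _ c1; have {c2}i2 := N _ c2; have {c3}i3 := N _ c3; have {c4}i4 := P _ c4.
move: i1 i2 i3 i4 => /=.
have e1 (x : R) : - (-1 / (x ^+ 2 + (-1) ^+ 2)) = (x ^+ 2 + 1)^-1.
  by rewrite sqrrN expr1n mulN1r opprK.
have e2 (x : R) : - - (1 / (x ^+ 2 + 1 ^+ 2)) = (x ^+ 2 + 1)^-1.
  by rewrite expr1n mul1r opprK.
have e3 (x : R) : - (-1 / ((-1) ^+ 2 + x ^+ 2)) = (x ^+ 2 + 1)^-1.
  by rewrite sqrrN expr1n mulN1r opprK addrC.
have e4 (x : R) : 1 / (1 ^+ 2 + x ^+ 2) = (x ^+ 2 + 1)^-1.
  by rewrite expr1n mul1r addrC.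
move=> /(_ _) i1 /(_ _) i2 /(_ _) i3 /(_ _) i4.
have {}i1 := i1 (fun x xr => eq_ind_r (fun u => 2^-1 <= u) (h1 x _ xr erefl) (e1 x)).
have {}i2 := i2 (fun x xr => eq_ind_r (fun u => 2^-1 <= u) (h1 x _ xr erefl) (e2 x)).
have {}i3 := i3 (fun x xr => eq_ind_r (fun u => 2^-1 <= u) (h1 x _ xr erefl) (e3 x)).
have {}i4 := i4 (fun x xr => eq_ind_r (fun u => 2^-1 <= u) (h1 x _ xr erefl) (e4 x)).
rewrite mul0r mul1r.
rewrite add0r; apply: le_trans (lerD (lerD i1 i2) (lerD i4 i3)).
by rewrite le_eqVlt; apply/orP; left; apply/eqP; ring.
Qed.

Lemma on_sq_sub P r : (forall z, r <= normc z -> normc z <= 2 * r -> P z) -> 0 < r -> on_sq P r.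
Proof.
move=> H r0 t tr; have [h1 h2 h3 h4] := on_sq_ge r0 tr.
have l1 : `|t| <= r by rewrite ler_norml.
have l2 : `|r| = r by rewrite gtr0_norm.
split; apply: H => //; apply: le_trans (normc_le _) _; rewrite /= ?normrN l2; lra.
Qed.

Lemma sqintZ k F r : on_sq (cdiff F) r -> sqint (fun z => k * F z) r = k * sqint F r.
Proof. by move=> H; apply: bintZ; exact: on_sq_frame. Qed.

Lemma sqintD F f r : on_sq (cdiff F) r -> on_sq (cdiff f) r ->
  sqint (fun z => F z + f z) r = sqint F r + sqint f r.
Proof. by move=> H H'; apply: bintD; exact: on_sq_frame. Qed.

Lemma on_sq_cdiffM F f r : on_sq (cdiff F) r -> on_sq (cdiff f) r -> on_sq (cdiff (fun z => F z * f z)) r.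
Proof.
by move=> h1 h2; apply: on_sq_impl (on_sq_and h1 h2) => z [d1 d2]; exact: cdiffM.
Qed.

Lemma on_sq_cdiffV z0 r : normc z0 < r -> on_sq (cdiff (fun z => (z - z0)^-1)) r.
Proof.
move=> zr; have r0 : 0 < r by rewrite (le_lt_trans _ zr)// normc_ge0.
apply: on_sq_impl (on_sq_ge r0) => z rz; apply: cdiffV.
  by rewrite subr_eq0; apply: contraTneq rz => ->; rewrite -ltNge.
by apply: cdiffB; [exact: cdiff_id|exact: cdiff_cst].
Qed.

Lemma on_sq_cdiffX r n : 0 < r -> on_sq (cdiff (fun z => (z^-1) ^+ n)) r.
Proof.
move=> r0; apply: on_sq_impl (on_sq_ge r0) => z /(sq_nz r0) z0.
by apply: cdiffX; apply: cdiffV => //; exact: cdiff_id.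
Qed.

Lemma sqint_sum k (F : nat -> R[i] -> R[i]) r : (forall n, on_sq (cdiff (F n)) r) ->
  sqint (fun z => \sum_(n < k) F n z) r = \sum_(n < k) sqint (F n) r.
Proof.
move=> H; elim: k => [|k IH].
  rewrite big_ord0; under [X in sqint X]eq_fun do rewrite big_ord0 -[0](mul0r 1).
  rewrite sqintZ ?mul0r//.
  by move=> t _; split; exact: cdiff_cst.
under [X in sqint X]eq_fun do rewrite big_ord_recr /=.
rewrite sqintD ?IH ?big_ord_recr//.
move=> t tr; split; apply: cdiff_sum => n; have := H n; by move=> /(_ _ tr)[].
Qed.

(** The geometric series of the Cauchy kernel is kept finite, with an exact remainder, so that only
    finite sums have to be integrated. *)
Lemma geometric_kernel z z0 k : z != 0 -> z != z0 ->
  (z - z0)^-1 = \sum_(n < k) z0 ^+ n * z^-1 ^+ n.+1 + z0 ^+ k * z^-1 ^+ k * (z - z0)^-1.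
Proof.
move=> zn0 zz0; have d0 : z - z0 != 0 by rewrite subr_eq0.
elim: k => [|k IH]; first by rewrite big_ord0 !expr0 !mul1r add0r.
rewrite {1}IH big_ord_recr /= -addrA; congr (_ + _).
have : (z - z0)^-1 = z^-1 + z0 * z^-1 * (z - z0)^-1 by field; rewrite zn0 d0.
by move=> {1}->; rewrite !exprS; ring.
Qed.

(** On the square |z| >= r and |z - z0| >= r - |z0|, so the remainder of [geometric_kernel] times F
    is at most M (|z0| / r)^k / (r - |z0|); the factor 16 r comes from [sqint_bound]. *)
Lemma sqint_kernel_expansion F z0 r k (M : R) : normc z0 < r -> on_sq (cdiff F) r ->
  on_sq (fun z => normc (F z) <= M) r ->
  normc (sqint (fun z => F z * (z - z0)^-1) r -
         \sum_(n < k) z0 ^+ n * sqint (fun z => F z * z^-1 ^+ n.+1) r)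
    <= 16 * M * r * (normc z0 / r) ^+ k / (r - normc z0).
Proof.
move=> zr dF FM; have r0 : 0 < r by rewrite (le_lt_trans _ zr)// normc_ge0.
have d0 : 0 < r - normc z0 by rewrite subr_gt0.
have h1 : on_sq (fun z => F z * (z - z0)^-1 = \sum_(n < k) z0 ^+ n * (F z * z^-1 ^+ n.+1) +
    z0 ^+ k * (z^-1 ^+ k * (F z * (z - z0)^-1))) r.
  apply: on_sq_impl (on_sq_ge r0) => z rz.
  have z_neq0 := sq_nz r0 rz.
  have zz0 : z != z0 by apply: contraTneq rz => ->; rewrite -ltNge.
  rewrite {1}(@geometric_kernel z z0 k)// mulrDr mulr_sumr; congr (_ + _); last by ring.
  by apply: eq_bigr => n _; ring.
have dn n : on_sq (cdiff (fun z => F z * z^-1 ^+ n.+1)) r.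
  by apply: on_sq_cdiffM => //; exact: on_sq_cdiffX.
have dz n : on_sq (cdiff (fun z => z0 ^+ n * (F z * z^-1 ^+ n.+1))) r.
  by apply: on_sq_cdiffM => // t _; split; exact: cdiff_cst.
have dk : on_sq (cdiff (fun z => z^-1 ^+ k * (F z * (z - z0)^-1))) r.
  apply: on_sq_cdiffM; first exact: on_sq_cdiffX.
  by apply: on_sq_cdiffM => //; exact: on_sq_cdiffV.
rewrite (sqint_ext h1) sqintD; last first.
- by apply: on_sq_cdiffM => // t _; split; exact: cdiff_cst.
- by move=> t tr; split; apply: cdiff_sum => n; have [] := dz n _ tr.
rewrite (sqint_sum k dz).
have -> : \sum_(n < k) sqint (fun z => z0 ^+ n * (F z * z^-1 ^+ n.+1)) r =
    \sum_(n < k) z0 ^+ n * sqint (fun z => F z * z^-1 ^+ n.+1) r.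
  by apply: eq_bigr => n _; rewrite sqintZ.
rewrite addrC addKr sqintZ// normcM normcX.
have bk : on_sq (fun z => normc (z^-1 ^+ k * (F z * (z - z0)^-1)) <= r^-1 ^+ k * (M / (r - normc z0))) r.
  apply: on_sq_impl (on_sq_and (on_sq_ge r0) FM) => z [rz zM].
  rewrite normcM normcX normcV normcM normcV.
  apply: ler_pM; rewrite ?exprn_ge0 ?mulr_ge0 ?invr_ge0 ?normc_ge0//.
    rewrite lerXn2r ?nnegrE ?invr_ge0 ?normc_ge0 ?(ltW r0)//.
    by rewrite lef_pV2// posrE ?(lt_le_trans r0 rz).
  apply: ler_pM; rewrite ?invr_ge0 ?normc_ge0//.
  have h : r - normc z0 <= normc (z - z0) by apply: le_trans (lerB_normc _ _); rewrite lerB.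
  by rewrite lef_pV2// posrE ?(lt_le_trans d0 h).
have := sqint_bound r0 dk bk => /(ler_wpM2l (exprn_ge0 k (normc_ge0 z0)))/le_trans; apply.
rewrite le_eqVlt; apply/orP; left; apply/eqP; rewrite expr_div_n exprVn.
have rk : r ^+ k != 0 by rewrite expf_neq0// gt_eqF.
by field; rewrite rk gt_eqF.
Qed.

Lemma sqint_inv_radius r : 0 < r -> sqint (fun z => z^-1) r = winding.
Proof.
move=> r0; have H (r1 r2 : R) : 0 < r1 -> r1 <= r2 -> sqint (fun z => z^-1) r2 = sqint (fun z => z^-1) r1.
  move=> r10 rr; apply: sqint_radius => // z rz _; apply: cdiffV; last exact: cdiff_id.
  exact: sq_nz rz.
by have [r1|/ltW r1] := leP r 1; [rewrite /winding (H r)|exact: H].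
Qed.

(** The integral does not depend on the radius, while a square of size r1 >= 1 gives the bound 16 /
    r1, which tends to 0 as the square grows. *)
Lemma sqint_invX r n : 0 < r -> sqint (fun z => z^-1 ^+ n.+2) r = 0.
Proof.
move=> r0; apply/eqP; rewrite -normc_eq0 eq_le normc_ge0 andbT.
apply/ler_addgt0Pl => e e0; rewrite addr0.
pose r1 := Num.max (Num.max r 1) (16 / e).
have r10 : 0 < r1 by rewrite !lt_max r0.
have r11 : 1 <= r1 by rewrite !le_max lexx orbT.
rewrite -(@sqint_radius _ r r1)//; last first.
- by move=> z rz _; apply: cdiffX; apply: cdiffV; [exact: sq_nz rz|exact: cdiff_id].
- by rewrite !le_max lexx.
have b : on_sq (fun z => normc (z^-1 ^+ n.+2) <= r1^-1 ^+ 2) r1.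
  apply: on_sq_impl (on_sq_ge r10) => z rz; rewrite normcX normcV.
  apply: (@le_trans _ _ (r1^-1 ^+ n.+2)).
    rewrite lerXn2r ?nnegrE ?invr_ge0 ?normc_ge0 ?(ltW r10)//.
    by rewrite lef_pV2// posrE ?(lt_le_trans r10 rz).
  by apply: ler_wiXn2l => //; [rewrite invr_ge0 ltW|rewrite invf_le1].
apply: le_trans (sqint_bound r10 (on_sq_cdiffX _ r10) b) _.
have -> : 16 * r1^-1 ^+ 2 * r1 = 16 / r1 by field; rewrite gt_eqF.
by rewrite ler_pdivrMr// -ler_pdivrMl// mulrC !le_max lexx !orbT.
Qed.

Lemma geometric_vanish (q C x : R) : 0 <= q -> q < 1 -> (forall k, x <= C * q ^+ k) -> x <= 0.
Proof.
move=> q0 q1 H; apply/ler_addgt0Pl => e e0; rewrite addr0.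
have [C0|C0] := leP C 0.
  by apply: le_trans (H 0%N) _; rewrite expr0 mulr1 (le_trans C0)// ltW.
have qC : (fun k => C * q ^+ k) @ \oo --> C * 0.
  by apply: cvgMr; apply: cvg_expr; rewrite ger0_norm.
move: qC; rewrite mulr0 => /cvgrPdist_lt/(_ e e0)[N _ /(_ N (leqnn N))] /=.
rewrite sub0r normrN => /ltW h; apply: le_trans (H N) _; exact: le_trans (ler_norm _) h.
Qed.

(** In the expansion of the kernel with F = 1 only the term 1 / z has a nonzero integral, and the
    remainder decays geometrically. *)
Lemma sqint_kernel z0 r : normc z0 < r -> sqint (fun z => (z - z0)^-1) r = winding.
Proof.
move=> zr; have r0 : 0 < r by rewrite (le_lt_trans _ zr)// normc_ge0.
apply/eqP; rewrite -subr_eq0 -normc_eq0 eq_le normc_ge0 andbT.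
pose q := normc z0 / r.
apply: (@geometric_vanish q (16 * 1 * r * q / (r - normc z0))).
- by rewrite divr_ge0 ?normc_ge0 ?ltW.
- by rewrite ltr_pdivrMr// mul1r.
move=> k; have d1 : on_sq (cdiff (fun=> 1)) r by move=> t _; split; exact: cdiff_cst.
have M1 : on_sq (fun z => normc ((fun=> 1) z : R[i]) <= 1) r by move=> t _; rewrite normc1.
have := sqint_kernel_expansion k.+1 zr d1 M1.
rewrite big_ord_recl big1 ?addr0; last first.
  move=> n _; suff -> : sqint (fun z => 1 * z^-1 ^+ (lift ord0 n).+1) r = 0 by rewrite mulr0.
  apply: eq_trans (sqint_invX n r0).
  by apply: sqint_ext => t _; split; exact: mul1r.
rewrite -(sqint_inv_radius r0).
have E1 : sqint (fun z => 1 * (z - z0)^-1) r = sqint (fun z => (z - z0)^-1) r.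
  by apply: sqint_ext => t _; split; exact: mul1r.
have E2 : z0 ^+ (@ord0 k) * sqint (fun z => 1 * z^-1 ^+ (@ord0 k).+1) r = sqint (fun z => z^-1) r.
  by rewrite expr0 mul1r; apply: sqint_ext => t _; split; exact: mul1r.
by rewrite E1 E2 -/q exprS => /le_trans; apply; rewrite le_eqVlt; apply/orP; left; apply/eqP; ring.
Qed.

(** The difference quotient is differentiable except at [z0] and bounded near it, so its integral
    can be moved to a small square around [z0], where it is negligible. What is left is f z0 times
    the integral of the kernel. *)
Lemma cauchy_formula f z0 r : normc z0 < r ->
  (forall z, normc z <= 2 * r -> cdiff f z) ->
  sqint (fun z => f z * (z - z0)^-1) r = f z0 * winding.
Proof.
move=> zr df; have r0 : 0 < r by rewrite (le_lt_trans _ zr)// normc_ge0.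
pose F z := (f z - f z0) * (z - z0)^-1.
have dfsq : on_sq (cdiff f) r by apply: on_sq_sub => // z _; exact: df.
have dF z : normc z <= 2 * r -> z != z0 -> cdiff F z.
  move=> zr2 zz0; apply: cdiffM.
    by apply: cdiffB; [exact: df|exact: cdiff_cst].
  apply: cdiffV; first by rewrite subr_eq0.
  by apply: cdiffB; [exact: cdiff_id|exact: cdiff_cst].
have dFsq : on_sq (cdiff F) r.
  apply: on_sq_sub => // z rz zr2; apply: dF => //.
  by apply: contraTneq rz => ->; rewrite -ltNge.
suff F0 : sqint F r = 0.
  have : sqint (fun z => F z + f z0 * (z - z0)^-1) r = sqint (fun z => f z * (z - z0)^-1) r.
    by apply: sqint_ext => t _; rewrite /F; split; rewrite mulrBl subrK.
  move=> <-; rewrite sqintD//; last first.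
    by apply: on_sq_cdiffM; [move=> t _; split; exact: cdiff_cst|exact: on_sq_cdiffV].
  by rewrite F0 add0r sqintZ ?sqint_kernel//; exact: on_sq_cdiffV.
have z0r : normc z0 <= 2 * r by lra.
have [D HD] := df z0 z0r.
have [t t0 Ht] := HD 1 ltr01.
apply/eqP; rewrite -normc_eq0 eq_le normc_ge0 andbT; apply/ler_addgt0Pl => e e0; rewrite addr0.
have D1 : 0 < normc D + 1 by rewrite ltr_wpDl ?normc_ge0.
(* [t / 3] keeps the small square where the difference quotient is bounded by |D| + 1,
   [r - normc z0] keeps it inside the large square, and the last entry makes the bound 16 (|D| + 1)
   del of the integral at most [e]. *)
pose del := Num.min (Num.min (t / 3) (r - normc z0)) (e / (16 * (normc D + 1))).
have del0 : 0 < del by rewrite !lt_min divr_gt0//= subr_gt0 zr divr_gt0// mulr_gt0.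
have delt : del <= t / 3 by rewrite !ge_min lexx.
have delr : del <= r - normc z0 by rewrite !ge_min lexx orbT.
have dele : del <= e / (16 * (normc D + 1)) by rewrite !ge_min lexx !orbT.
have xle := normc_Re z0; have yle := normc_Im z0.
move: xle yle; rewrite !ler_norml => /andP[x1 x2] /andP[y1 y2].
set x0 := complex.Re z0 in x1 x2; set y0 := complex.Im z0 in y1 y2.
have z0E : z0 = x0 +i* y0 by rewrite /x0 /y0; case: (z0).
have -> : sqint F r = bint F (x0 - del) (x0 + del) (y0 - del) (y0 + del).
  apply: bint_inner; [lra|lra|lra|lra|lra|lra|].
  move=> x y xr yr h; apply: dF.
    apply: le_trans (normc_le _) _ => /=; rewrite mulr_natl mulr2n.
    by apply: lerD; rewrite ler_norml.
  apply: contraNneq h; rewrite z0E => -[-> ->].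
  by rewrite !gtrBl !ltrDl del0.
have bnd x y : (`|x - x0| == del) || (`|y - y0| == del) -> `|x - x0| <= del -> `|y - y0| <= del ->
    (x +i* y) != z0 /\ normc (F (x +i* y)) <= normc D + 1.
  move=> hn hx hy; have zz0 : x +i* y != z0.
    rewrite z0E; apply/eqP => -[ex ey]; move: hn; rewrite ex ey !subrr normr0 orbb.
    by rewrite eq_sym gt_eqF.
  split=> //.
  have nh : normc (x +i* y - z0) < t.
    apply: le_lt_trans (normc_le _) _; rewrite z0E /=; lra.
  have := Ht _ nh; rewrite mul1r [z0 + _]addrC subrK => h.
  rewrite /F normcM normcV ler_pdivrMr ?normc_gt0 ?subr_eq0//.
  have -> : f (x +i* y) - f z0 = (f (x +i* y) - f z0 - D * (x +i* y - z0)) + D * (x +i* y - z0) by ring.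
  apply: le_trans (le_normcD _ _) _; rewrite normcM mulrDl mul1r addrC; exact: lerD.
have n1 : `|x0 - del - x0| = del by rewrite addrAC subrr add0r normrN gtr0_norm.
have n2 : `|x0 + del - x0| = del by rewrite addrAC subrr add0r gtr0_norm.
have n3 : `|y0 - del - y0| = del by rewrite addrAC subrr add0r normrN gtr0_norm.
have n4 : `|y0 + del - y0| = del by rewrite addrAC subrr add0r gtr0_norm.
have inx x : x0 - del <= x <= x0 + del -> `|x - x0| <= del by rewrite ler_distl.
have iny x : y0 - del <= x <= y0 + del -> `|x - y0| <= del by rewrite ler_distl.
have inr x y : `|x - x0| <= del -> `|y - y0| <= del -> normc (x +i* y) <= 2 * r.
  rewrite !ler_distl => /andP[h1 h2] /andP[h3 h4].
  apply: le_trans (normc_le _) _ => /=; rewrite mulr_natl mulr2n.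
  by apply: lerD; rewrite ler_norml; apply/andP; split; lra.
have B1 x : x0 - del <= x <= x0 + del -> (x +i* (y0 - del) != z0 /\ normc (F (x +i* (y0 - del))) <= normc D + 1) /\
   (x +i* (y0 + del) != z0 /\ normc (F (x +i* (y0 + del))) <= normc D + 1).
  by move=> /inx h; split; apply: bnd => //; rewrite ?n3 ?n4 ?eqxx ?orbT.
have B2 y : y0 - del <= y <= y0 + del -> ((x0 - del) +i* y != z0 /\ normc (F ((x0 - del) +i* y)) <= normc D + 1) /\
   ((x0 + del) +i* y != z0 /\ normc (F ((x0 + del) +i* y)) <= normc D + 1).
  by move=> /iny h; split; apply: bnd => //; rewrite ?n1 ?n2 ?eqxx ?orbT.
apply: le_trans (@bint_bound _ F _ _ _ _ (normc D + 1) _ _ _ _ _ _ _) _.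
- lra.
- lra.
- split.
  + by move=> x h; apply: dF; [apply: inr; [exact: inx|rewrite n3]|case: (B1 x h) => -[]].
  + by move=> x h; apply: dF; [apply: inr; [exact: inx|rewrite n4]|case: (B1 x h) => _ []].
  + by move=> x h; apply: dF; [apply: inr; [rewrite n1|exact: iny]|case: (B2 x h) => -[]].
  + by move=> x h; apply: dF; [apply: inr; [rewrite n2|exact: iny]|case: (B2 x h) => _ []].
- by move=> x /B1[[]].
- by move=> x /B1[_ []].
- by move=> x /B2[[]].
- by move=> x /B2[_ []].
- move: dele; rewrite ler_pdivlMr ?mulr_gt0// => dele.
  apply: le_trans dele; rewrite le_eqVlt; apply/orP; left; apply/eqP; ring.
Qed.

(** Cauchy's integral for the n-th Taylor coefficient at 0, normalized by [winding] in place of 2 pi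
    i. *)
Definition taylor_coef f r n : R[i] := winding^-1 * sqint (fun z => f z * z^-1 ^+ n.+1) r.

Lemma winding_neq0 : winding != 0.
Proof. by rewrite -normc_gt0 (lt_le_trans _ winding_ge)//; lra. Qed.

Lemma taylor_coef_radius f r1 r2 n : 0 < r1 -> r1 <= r2 ->
  (forall z, normc z <= 2 * r2 -> cdiff f z) -> taylor_coef f r2 n = taylor_coef f r1 n.
Proof.
move=> r10 rr df; rewrite /taylor_coef (@sqint_radius _ r1 r2)// => z rz zr.
apply: cdiffM; first exact: df.
by apply: cdiffX; apply: cdiffV; [exact: sq_nz rz|exact: cdiff_id].
Qed.

Lemma taylor_coef_bound f r n (M : R) : 0 < r -> on_sq (cdiff f) r ->
  on_sq (fun z => normc (f z) <= M) r -> normc (taylor_coef f r n) <= 4 * M / r ^+ n.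
Proof.
move=> r0 df fM; rewrite /taylor_coef normcM normcV.
have M0 : 0 <= M.
  have [|h _ _ _] := fM 0; first by rewrite oppr_le0 ltW.
  exact: le_trans (normc_ge0 _) h.
have d1 : on_sq (cdiff (fun z => f z * z^-1 ^+ n.+1)) r.
  by apply: on_sq_cdiffM => //; exact: on_sq_cdiffX.
have b1 : on_sq (fun z => normc (f z * z^-1 ^+ n.+1) <= M * r^-1 ^+ n.+1) r.
  apply: on_sq_impl (on_sq_and (on_sq_ge r0) fM) => z [rz zM].
  rewrite normcM normcX normcV; apply: ler_pM; rewrite ?exprn_ge0 ?invr_ge0 ?normc_ge0//.
  rewrite lerXn2r ?nnegrE ?invr_ge0 ?normc_ge0 ?(ltW r0)//.
  by rewrite lef_pV2// posrE ?(lt_le_trans r0 rz).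
apply: (@le_trans _ _ (4^-1 * (16 * (M * r^-1 ^+ n.+1) * r))).
  apply: ler_pM; rewrite ?invr_ge0 ?normc_ge0//; last exact: sqint_bound.
  by rewrite lef_pV2 ?winding_ge// posrE ?normc_gt0 ?winding_neq0.
rewrite le_eqVlt; apply/orP; left; apply/eqP; rewrite exprSr exprVn.
have rk : r ^+ n != 0 by rewrite expf_neq0// gt_eqF.
by field; rewrite rk gt_eqF.
Qed.

Lemma taylor_expansion f z0 r k (M : R) : normc z0 < r ->
  (forall z, normc z <= 2 * r -> cdiff f z) -> on_sq (fun z => normc (f z) <= M) r ->
  normc (f z0 - \sum_(n < k) taylor_coef f r n * z0 ^+ n)
    <= 4 * M * r / (r - normc z0) * (normc z0 / r) ^+ k.
Proof.
move=> zr df fM; have r0 : 0 < r by rewrite (le_lt_trans _ zr)// normc_ge0.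
have d0 : 0 < r - normc z0 by rewrite subr_gt0.
have dfsq : on_sq (cdiff f) r by apply: on_sq_sub => // z _; exact: df.
have := sqint_kernel_expansion k zr dfsq fM; rewrite cauchy_formula//.
have -> : f z0 * winding - \sum_(n < k) z0 ^+ n * sqint (fun z => f z * z^-1 ^+ n.+1) r =
    winding * (f z0 - \sum_(n < k) taylor_coef f r n * z0 ^+ n).
  rewrite mulrBr [f z0 * _]mulrC mulr_sumr; congr (_ - _); apply: eq_bigr => n _.
  by rewrite /taylor_coef -mulrA mulVKf ?winding_neq0// mulrC.
rewrite normcM => h; rewrite -(ler_pM2l (_ : 0 < 4))//.
apply: le_trans (le_trans h _); first by rewrite ler_wpM2r ?normc_ge0 ?winding_ge.
by rewrite le_eqVlt; apply/orP; left; apply/eqP; ring.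
Qed.

End cauchy.

(** * Accumulating zeros and propagation of smallness *)

Section identity.
Variable R : realType.
Implicit Types (f : R[i] -> R[i]) (r : R) (z w : R[i]).
Local Arguments normc : simpl never.

Lemma cont_on_bounded (g : R -> R) a b : a <= b -> cont_on g a b ->
  exists M : R, forall x, a <= x <= b -> `|g x| <= M.
Proof.
move=> ab cg; have [c cab H] : exists2 c, c \in `[a, b] & forall t, t \in `[a, b] -> `|g t| <= `|g c|.
  apply: (@EVT_max _ (fun x => `|g x|)) => //; apply: continuous_in_subspaceT => x.
  by rewrite inE /= in_itv /= => /cg; exact: cvg_norm.
by exists `|g c| => x xab; apply: H; rewrite in_itv.
Qed.

Lemma ccont_on_bounded (g : R -> R[i]) a b : a <= b -> ccont_on g a b ->
  exists M : R, forall x, a <= x <= b -> normc (g x) <= M.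
Proof.
move=> ab [/(cont_on_bounded ab)[M1 H1] /(cont_on_bounded ab)[M2 H2]].
by exists (M1 + M2) => x xab; apply: le_trans (normc_le _) _; apply: lerD; [exact: H1|exact: H2].
Qed.

Lemma on_sq_bounded f r : 0 < r -> on_sq (cdiff f) r ->
  exists M : R, on_sq (fun z => normc (f z) <= M) r.
Proof.
move=> r0 df; have rr : - r <= r by rewrite (@le_trans _ _ 0)// ?oppr_le0 ltW.
have [/hseg_cont/(ccont_on_bounded rr)[M1 H1] /hseg_cont/(ccont_on_bounded rr)[M2 H2]
  /vseg_cont/(ccont_on_bounded rr)[M3 H3] /vseg_cont/(ccont_on_bounded rr)[M4 H4]] := on_sq_frame df.
exists (Num.max (Num.max M1 M2) (Num.max M3 M4)) => t tr.
by split; rewrite !le_max ?H1 ?H2 ?H3 ?H4 ?orbT.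
Qed.

(** All Taylor coefficients vanish, by strong induction: if those before the n-th vanish, the
    remainder estimate at a small zero z gives |b_n| |z|^n <= K |z|^(n+1), hence |b_n| <= K |z| for
    arbitrarily small z. *)
Lemma accumulating_zeros f r : 0 < r -> (forall z, normc z <= 2 * r -> cdiff f z) ->
  (forall e : R, 0 < e -> exists z, [/\ z != 0, normc z < e & f z = 0]) ->
  forall z, normc z < r -> f z = 0.
Proof.
move=> r0 df acc; have dfsq : on_sq (cdiff f) r by apply: on_sq_sub => // z _; exact: df.
have [M fM] := on_sq_bounded r0 dfsq.
have M0 : 0 <= M.
  have [|h _ _ _] := fM 0; first by rewrite oppr_le0 ltW.
  exact: le_trans (normc_ge0 _) h.
suff b0 n : taylor_coef f r n = 0.
  move=> z zr; apply/eqP; rewrite -normc_eq0 eq_le normc_ge0 andbT.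
  apply: (@geometric_vanish _ (normc z / r) (4 * M * r / (r - normc z))).
  - by rewrite divr_ge0 ?normc_ge0 ?ltW.
  - by rewrite ltr_pdivrMr// mul1r.
  move=> k; have := taylor_expansion k zr df fM; rewrite big1 ?subr0// => i _.
  by rewrite b0 mul0r.
elim/ltn_ind: n => n IH; apply/eqP; rewrite -normc_eq0 eq_le normc_ge0 andbT.
apply/ler_addgt0Pl => e e0; rewrite addr0.
(* For |z| <= r / 2 the factor r / (r - |z|) is at most 2, which turns the 4 M of [taylor_expansion]
   into 8 M. *)
pose K := 8 * M / r ^+ n.+1.
have K0 : 0 <= K by rewrite divr_ge0 ?mulr_ge0// exprn_ge0// ltW.
have [] := acc (Num.min (r / 2) (e / (K + 1))); first by rewrite lt_min !divr_gt0// ltr_wpDl.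
move=> z [z0]; rewrite lt_min => /andP[zr ze] fz0.
have zr' : normc z < r by lra.
have nz : 0 < normc z by rewrite normc_gt0.
have := taylor_expansion n.+1 zr' df fM; rewrite fz0 big_ord_recr /= big1 ?add0r; last first.
  by move=> i _; rewrite IH ?mul0r.
rewrite normcN normcM normcX => h.
have h2 : normc (taylor_coef f r n) <= K * normc z.
  rewrite -(ler_pM2r (_ : 0 < normc z ^+ n)) ?exprn_gt0//; apply: (le_trans h).
  have -> : K * normc z * normc z ^+ n = 4 * M * 2 * (normc z / r) ^+ n.+1.
    rewrite /K expr_div_n [normc z ^+ n.+1]exprS.
    by have rk : r ^+ n.+1 != 0 by [rewrite expf_neq0// gt_eqF]; field.
  rewrite ler_wpM2r ?exprn_ge0 ?divr_ge0 ?normc_ge0 ?(ltW r0)//.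
  rewrite -mulrA ler_wpM2l ?mulr_ge0// ler_pdivrMr ?subr_gt0//; lra.
apply: (le_trans h2); move: ze; rewrite ltr_pdivlMr ?ltr_wpDl// => ze.
by rewrite mulrC; apply: le_trans (ltW ze); rewrite ler_pM2l// lerDl.
Qed.

(** The small and the large square give the same Taylor coefficients. The large one, with the bound
    [C], fixes a number k of terms beyond which the tail is negligible; the small one makes the
    first k coefficients small. The threshold [e'] depends on the constants only and not on [f]. *)
Lemma two_constants (r1 rho r C e : R) : 0 < r1 -> r1 <= r -> rho < r -> 0 < e -> 0 <= C ->
  exists2 e' : R, 0 < e' & forall f, (forall z, normc z <= 2 * r -> cdiff f z) ->
    (forall z, normc z <= 2 * r -> normc (f z) <= C) ->
    (forall z, normc z <= 2 * r1 -> normc (f z) <= e') ->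
    forall z, normc z <= rho -> normc (f z) <= e.
Proof.
move=> r10 r1r rhor e0 C0; have r0 := lt_le_trans r10 r1r.
have [rho0|rho0] := ltP rho 0.
  by exists 1 => // f _ _ _ z zr; have := le_lt_trans (le_trans (normc_ge0 _) zr) rho0; rewrite ltxx.
have d0 : 0 < r - rho by rewrite subr_gt0.
pose A := 4 * C * r / (r - rho).
have A0 : 0 <= A by rewrite divr_ge0 ?mulr_ge0// ltW.
have [k Ak] : exists k, A * (rho / r) ^+ k <= e / 2.
  apply/not_existsP => H.
  suff : e / 2 <= 0 by rewrite leNgt divr_gt0.
  apply: (@geometric_vanish _ (rho / r) A); first by rewrite divr_ge0// ltW.
    by rewrite ltr_pdivrMr// mul1r.
  by move=> k; rewrite leNgt; apply/negP => /ltW/H.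
pose S := \sum_(n < k) 4 / r1 ^+ n * rho ^+ n.
have S0 : 0 <= S.
  by apply: sumr_ge0 => n _; rewrite mulr_ge0 ?divr_ge0 ?exprn_ge0// ltW.
exists (e / 2 / (S + 1)); first by rewrite !divr_gt0// ltr_wpDl.
move=> f df fC fe z zrho.
have zr : normc z < r by exact: le_lt_trans rhor.
have fCsq : on_sq (fun z => normc (f z) <= C) r by apply: on_sq_sub => // w _; exact: fC.
have fesq : on_sq (fun z => normc (f z) <= e / 2 / (S + 1)) r1.
  by apply: on_sq_sub => // w _; exact: fe.
have df1 : on_sq (cdiff f) r1.
  by apply: on_sq_sub => // w _ h; apply: df; apply: (le_trans h); rewrite ler_pM2l.
rewrite -[f z](subrK (\sum_(n < k) taylor_coef f r n * z ^+ n)).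
apply: le_trans (le_normcD _ _) _; rewrite [leRHS]splitr; apply: lerD.
  apply: le_trans (taylor_expansion k zr df fCsq) _; apply: le_trans Ak.
  apply: ler_pM.
  - by rewrite divr_ge0 ?mulr_ge0 ?subr_ge0 ?(ltW r0)// ltW.
  - by rewrite exprn_ge0// divr_ge0 ?normc_ge0// ltW.
  - by rewrite ler_wpM2l ?mulr_ge0 ?(ltW r0)// lef_pV2 ?posrE ?subr_gt0// lerB.
  - by rewrite lerXn2r ?nnegrE ?divr_ge0 ?normc_ge0 ?(ltW r0)// ler_wpM2r// invr_ge0 ltW.
apply: le_trans (normc_sum _ _ _) _.
apply: (@le_trans _ _ (\sum_(n < k) (e / 2 / (S + 1)) * (4 / r1 ^+ n * rho ^+ n))); last first.
  rewrite -mulr_sumr -/S -mulrA ler_piMr ?divr_ge0 ?(ltW e0)//.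
  by rewrite mulrC ler_pdivrMr ?ltr_wpDl// mul1r lerDl.
apply: ler_sum => n _; rewrite (@taylor_coef_radius _ f r1 r n)// normcM normcX.
have := taylor_coef_bound n r10 df1 fesq => h.
have -> : e / 2 / (S + 1) * (4 / r1 ^+ n * rho ^+ n) = (4 * (e / 2 / (S + 1)) / r1 ^+ n) * rho ^+ n.
  by ring.
apply: ler_pM; rewrite ?exprn_ge0 ?normc_ge0//.
by rewrite lerXn2r ?nnegrE ?normc_ge0.
Qed.

Lemma ImD (c : R) z : complex.Im (c%:C + z) = complex.Im z.
Proof. by case: z => a b /=; rewrite add0r. Qed.

(* The smallness is propagated from 1 to 0 along a chain of discs. *)
Lemma strip_two_constants (s del C e : R) : 0 < s -> 0 < del -> 0 < e -> 0 <= C ->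
  exists2 e' : R, 0 < e' & forall f,
    (forall z, `|complex.Im z| <= s -> cdiff f z /\ normc (f z) <= C) ->
    (forall z, normc (z - 1) <= del -> normc (f z) <= e') -> normc (f 0) <= e.
Proof.
move=> s0 del0 e0 C0.
(* The centres move by 1 / N. This is at most del / 2, so that the first disc, of radius 2 / N, lies
   in the disc about 1, and at most s / 16, so that the discs of radius 3 / N reached in a step fit
   into radius s / 2, while [two_constants] looks no further than 2 (s / 2) = s. *)
have [N N0 HN] : exists2 N : nat, (0 < N)%N & N%:R^-1 <= Num.min (del / 2) (s / 16).
  have m0 : 0 < Num.min (del / 2) (s / 16) by rewrite lt_min !divr_gt0.
  exists (Num.truncn (Num.min (del / 2) (s / 16))^-1).+1 => //.
  rewrite -[leRHS]invrK lef_pV2 ?posrE ?invr_gt0//.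
  by apply/ltW; rewrite truncnS_gt.
move: HN; rewrite le_min => /andP[Nd Ns].
have NR : 0 < N%:R :> R by rewrite ltr0n.
pose r1 := N%:R^-1 : R.
have r10 : 0 < r1 by rewrite invr_gt0.
have step e1 : 0 < e1 -> exists2 e2 : R, 0 < e2 & forall f (c : R),
    (forall z, `|complex.Im z| <= s -> cdiff f z /\ normc (f z) <= C) ->
    (forall z, normc (z - c%:C) <= 2 * r1 -> normc (f z) <= e2) ->
    forall z, normc (z - (c - r1)%:C) <= 2 * r1 -> normc (f z) <= e1.
  move=> e10.
  have rs : r1 <= s / 2 by rewrite /r1; lra.
  have rs3 : 3 * r1 < s / 2 by rewrite /r1; lra.
  have [e2 e20 H] := two_constants r10 rs rs3 e10 C0.
  exists e2 => // f c fC fe z zc.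
  have E : f z = f (c%:C + (z - c%:C)) by rewrite addrC subrK.
  rewrite E; apply: (H (fun w => f (c%:C + w))).
  - move=> w ws; apply: (@cdiff_comp _ (fun w => c%:C + w) f).
      by apply: cdiffD; [exact: cdiff_cst|exact: cdiff_id].
    apply: (fC _ _).1; rewrite ImD; apply: le_trans (normc_Im _) _.
    by apply: (le_trans ws); lra.
  - move=> w ws; apply: (fC _ _).2; rewrite ImD; apply: le_trans (normc_Im _) _.
    by apply: (le_trans ws); lra.
  - by move=> w ws; apply: fe; rewrite addrC addKr.
  - have -> : z - c%:C = (z - (c - r1)%:C) - r1%:C by rewrite rmorphB /=; ring.
    apply: le_trans (le_normcD _ _) _; rewrite normcN normc_real gtr0_norm//.
    have -> : 3 * r1 = 2 * r1 + r1 by ring.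
    by rewrite lerD2r.
have chain k e1 : 0 < e1 -> exists2 e2 : R, 0 < e2 & forall f,
    (forall z, `|complex.Im z| <= s -> cdiff f z /\ normc (f z) <= C) ->
    (forall z, normc (z - 1) <= 2 * r1 -> normc (f z) <= e2) ->
    forall z, normc (z - (1 - k%:R * r1)%:C) <= 2 * r1 -> normc (f z) <= e1.
  elim: k e1 => [|k IH] e1 e10; first by exists e1 => // f _ h z; rewrite mul0r subr0; exact: h.
  have [e2 e20 H2] := step e1 e10; have [e3 e30 H3] := IH e2 e20.
  exists e3 => // f fC fe z; rewrite -natr1 mulrDl mul1r opprD addrA.
  exact: H2 fC (H3 f fC fe) z.
have [e2 e20 H] := chain N e e0; exists e2 => // f fC fe.
apply: (H f fC); last by rewrite /r1 mulfV ?gt_eqF// subrr subr0 normc0 mulr_ge0// ltW.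
by move=> z zr; apply: fe; apply: (le_trans zr); rewrite /r1; lra.
Qed.

End identity.

Section complex_exponential.
Variable R : realType.
Implicit Types (z w : R[i]).

Lemma cexpD z w : cexp (z + w) = cexp z * cexp w.
Proof.
case: z => a b; case: w => c d; rewrite /cexp /= expRD cosD sinD.
apply/eqP; rewrite eq_complex /=; apply/andP; split; apply/eqP; ring.
Qed.

Lemma cexp0 : cexp 0 = 1 :> R[i].
Proof.
rewrite /cexp /= expR0 cos0 sin0.
by apply/eqP; rewrite eq_complex /=; apply/andP; split; apply/eqP; ring.
Qed.

Lemma normc_cexp z : normc (cexp z) = expR (complex.Re z).
Proof.
case: z => a b; rewrite /cexp normcM normc_real ger0_norm ?expR_ge0//.
by rewrite /normc cos2Dsin2 sqrtr1 mulr1.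
Qed.

Lemma cexp_neq0 z : cexp z != 0.
Proof. by rewrite -normc_gt0 normc_cexp expR_gt0. Qed.

Lemma cos_sin_2pin (n : nat) : cos (n%:R * (2 * pi)) = 1 :> R /\ sin (n%:R * (2 * pi)) = 0 :> R.
Proof.
elim: n => [|n [IH1 IH2]]; first by rewrite mul0r cos0 sin0.
have -> : n.+1%:R * (2 * pi) = n%:R * (2 * pi) + pi *+ 2 :> R.
  by rewrite -natr1 -[pi *+ 2]mulr_natl; ring.
by rewrite cosD2pi sinD2pi.
Qed.

Lemma cexp_2pii (k : int) : cexp ((0 +i* (2 * pi)) * (k%:~R)%:C) = 1 :> R[i].
Proof.
have E (x : R) : (0 +i* (2 * pi)) * x%:C = 0 +i* (x * (2 * pi)).
  by apply/eqP; rewrite eq_complex /=; apply/andP; split; apply/eqP; ring.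
have H (n : nat) : cexp (0 +i* (n%:R * (2 * pi))) = 1 :> R[i].
  have [c s] := cos_sin_2pin n; rewrite /cexp /= expR0 c s.
  by apply/eqP; rewrite eq_complex /=; apply/andP; split; apply/eqP; ring.
rewrite E; case: k => n; first by rewrite -pmulrn; exact: H.
rewrite NegzE mulrNz mulNr -pmulrn; set y := _ * _.
have : cexp ((0 +i* (- y)) + (0 +i* y)) = 1 :> R[i].
  by rewrite -[RHS]cexp0; congr cexp; apply/eqP; rewrite eq_complex /= addr0 addNr !eqxx.
by rewrite cexpD H mulr1.
Qed.

Lemma is_derive_bound (f : R -> R) (D e : R) : is_derive (0 : R) (1 : R) f D -> 0 < e ->
  exists2 t : R, 0 < t & forall h, `|h| < t -> `|f h - f 0 - D * h| <= e * `|h|.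
Proof.
move=> df e0; have dv := @ex_derive _ _ _ _ _ _ _ df; have E := @derive_val _ _ _ _ _ _ _ df.
move: dv => /cvg_ex [l fl]; have lD : l = D by rewrite -E; apply/esym/cvg_lim.
rewrite {l}lD in fl.
move/cvgrPdist_le : fl => /(_ e e0) /nbhs_ballP[t t0 H].
exists t => // h ht; have [->|h0] := eqVneq h 0; first by rewrite subrr mulr0 subrr !normr0 mulr0.
have := H h; rewrite /ball /= sub0r normrN => /(_ ht h0).
rewrite /GRing.scale /= mulr1 addr0 => h1.
have -> : f h - f 0 - D * h = - ((D - h^-1 * (f h - f 0)) * h).
  by rewrite mulrBl mulrAC mulVf// mul1r opprB.
by rewrite normrN normrM ler_wpM2r.
Qed.

(** Multiplicativity reduces the estimate to the point 0, where the first order expansions of exp,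
    cos and sin are combined. *)
Lemma cdiff_cexp z : cdiff (@cexp R) z.
Proof.
exists (cexp z) => e e0.
pose e1 := Num.min (e / (8 * normc (cexp z))) (1 / 4).
have n0 : 0 < normc (cexp z) by rewrite normc_gt0 cexp_neq0.
have e10 : 0 < e1 by rewrite lt_min !divr_gt0// mulr_gt0.
have e1e : e1 <= e / (8 * normc (cexp z)) by rewrite ge_min lexx.
have e14 : e1 <= 1 / 4 by rewrite ge_min lexx orbT.
have [t1 t10 H1] : exists2 t : R, 0 < t & forall h : R, `|h| < t -> `|expR h - expR 0 - 1 * h| <= e1 * `|h|.
  apply: is_derive_bound => //; apply: is_derive_eq; exact: expR0.
have [t2 t20 H2] : exists2 t : R, 0 < t & forall h : R, `|h| < t -> `|cos h - cos 0 - 0 * h| <= e1 * `|h|.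
  apply: is_derive_bound => //; apply: is_derive_eq; by rewrite sin0 oppr0.
have [t3 t30 H3] : exists2 t : R, 0 < t & forall h : R, `|h| < t -> `|sin h - sin 0 - 1 * h| <= e1 * `|h|.
  apply: is_derive_bound => //; apply: is_derive_eq; exact: cos0.
(* [e1] serves as a radius too, which makes the cross term (expR x - 1) * y at most 2 e1 times the
   modulus. *)
clearbody e1; exists (Num.min (Num.min t1 t2) (Num.min t3 e1)); first by rewrite !lt_min t10 t20 t30 e10.
move=> h; rewrite !lt_min => /andP[/andP[h1 h2] /andP[h3 h4]].
have -> : cexp (z + h) - cexp z - cexp z * h = cexp z * (cexp h - 1 - h) by rewrite cexpD; ring.
rewrite normcM; suff : normc (cexp h - 1 - h) <= 8 * e1 * normc h.
  move=> /(ler_wpM2l (ltW n0))/le_trans; apply; rewrite mulrA; apply: ler_wpM2r; first exact: normc_ge0.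
  by move: e1e; rewrite ler_pdivlMr ?mulr_gt0// => e1e; apply: le_trans e1e; rewrite le_eqVlt; apply/orP; left; apply/eqP; ring.
case: h h1 h2 h3 h4 => x y h1 h2 h3 h4.
have x_h := normc_Re (x +i* y); have y_h := normc_Im (x +i* y); rewrite /= -/(normc (x +i* y)) in x_h y_h.
have := H1 x (le_lt_trans x_h h1); rewrite expR0 mul1r => B1.
have := H2 y (le_lt_trans y_h h2); rewrite cos0 mul0r subr0 => B2.
have := H3 y (le_lt_trans y_h h3); rewrite sin0 mul1r subr0 => B3.
have x4 : `|x| <= e1 := ltW (le_lt_trans x_h h4).
have ex : expR x <= 2 /\ `|expR x - 1| <= 2 * `|x|.
  have : `|expR x - 1| <= 2 * `|x|.
    have -> : expR x - 1 = (expR x - 1 - x) + x by ring.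
    apply: le_trans (ler_normD _ _) _; rewrite [leRHS]mulr_natl mulr2n lerD2r.
    by apply: (le_trans B1); rewrite ler_piMl//; lra.
  by move=> b; split=> //; move: b; rewrite ler_norml => /andP[_ b]; lra.
have [ex2 ex1] := ex; have ex0 := expR_ge0 x.
apply: le_trans (normc_le _) _; rewrite /cexp /= !mul0r !subr0 !addr0.
have -> : 8 * e1 * normc (x +i* y) = 4 * e1 * normc (x +i* y) + 4 * e1 * normc (x +i* y) by ring.
set N := normc _ in x_h y_h *; have N0 : 0 <= N := normc_ge0 _.
have ax := normr_ge0 x; have ay := normr_ge0 y.
apply: lerD.
- have -> : expR x * cos y - 1 - x = (expR x - 1 - x) + expR x * (cos y - 1) by ring.
  apply: le_trans (ler_normD _ _) _; rewrite normrM (ger0_norm ex0).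
  have B4 : expR x * `|cos y - 1| <= 2 * (e1 * `|y|) by apply: ler_pM.
  apply: le_trans (lerD B1 B4) _.
  have : e1 * `|x| <= e1 * N by rewrite ler_pM2l.
  have : e1 * `|y| <= e1 * N by rewrite ler_pM2l.
  have : 0 <= e1 * N by rewrite mulr_ge0// ltW.
  lra.
- have -> : expR x * sin y - y = expR x * (sin y - y) + (expR x - 1) * y by ring.
  apply: le_trans (ler_normD _ _) _; rewrite !normrM (ger0_norm ex0).
  have B4 : expR x * `|sin y - y| <= 2 * (e1 * `|y|) by apply: ler_pM.
  have B5 : `|expR x - 1| * `|y| <= 2 * e1 * N.
    apply: ler_pM => //; apply: (le_trans ex1); by rewrite ler_pM2l.
  apply: le_trans (lerD B4 B5) _.
  have : e1 * `|y| <= e1 * N by rewrite ler_pM2l.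
  lra.
Qed.

End complex_exponential.

(** * Cones and polyhedra *)

Section differences.
Variables (R : realType) (V : lmodType R).
Implicit Types (u v x y : V) (psi phi : V -> R) (us vs : seq V) (A B : set V).

Definition ind A x : R := (x \in A)%:R.

Definition diff u psi x : R := psi x - psi (x - u).

Definition diffs us psi : V -> R := foldr diff psi us.

Lemma diffC u v psi : diff u (diff v psi) = diff v (diff u psi).
Proof. by apply/funext => x; rewrite /diff [x - u - v]addrAC; ring. Qed.

Lemma diffs_diff us u psi : diffs us (diff u psi) = diff u (diffs us psi).
Proof. by elim: us => //= v us ->; rewrite diffC. Qed.

Lemma diffs_cat us vs psi : diffs (us ++ vs) psi = diffs us (diffs vs psi).
Proof. exact: foldr_cat. Qed.

Lemma diffs_comm us vs psi : diffs us (diffs vs psi) = diffs vs (diffs us psi).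
Proof. by elim: us => //= u us ->; rewrite diffs_diff. Qed.

Lemma diffsD us psi phi x : diffs us (fun y => psi y + phi y) x = diffs us psi x + diffs us phi x.
Proof. by elim: us x => //= u us IH x; rewrite /diff !IH; ring. Qed.

Lemma diffsZ us (k : R) psi x : diffs us (fun y => k * psi y) x = k * diffs us psi x.
Proof. by elim: us x => //= u us IH x; rewrite /diff !IH; ring. Qed.

Lemma diffsB us psi phi x : diffs us (fun y => psi y - phi y) x = diffs us psi x - diffs us phi x.
Proof.
rewrite -[RHS]/(_ + _) -mulN1r -diffsZ -diffsD; congr diffs.
by apply/funext => y; rewrite mulN1r.
Qed.

Lemma diffs0 us x : diffs us (fun=> 0) x = 0.
Proof. by elim: us x => //= u us IH x; rewrite /diff !IH subrr. Qed.

Lemma diffs_sum us I (r : seq I) (F : I -> V -> R) x :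
  diffs us (fun y => \sum_(i <- r) F i y) x = \sum_(i <- r) diffs us (F i) x.
Proof.
elim: r => [|i r IH].
  by rewrite big_nil -[RHS](diffs0 us x); congr diffs; apply/funext => y; rewrite big_nil.
rewrite big_cons -IH -diffsD; congr diffs.
by apply/funext => y; rewrite big_cons.
Qed.

Lemma diffs_shift us psi u x : diffs us (fun y => psi (y - u)) x = diffs us psi (x - u).
Proof. by elim: us x => //= v us IH x; rewrite /diff !IH [x - v - u]addrAC. Qed.

Lemma diffs_periodic us u psi : u \in us -> (forall x, psi (x - u) = psi x) ->
  forall x, diffs us psi x = 0.
Proof.
move=> + H; elim: us => //= v us IH; rewrite inE => /predU1P[<-|/IH E] x.
  by rewrite -diffs_diff -[RHS](diffs0 us x); congr diffs; apply/funext => y; rewrite /diff H subrr.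
by rewrite /diff !E subrr.
Qed.

Lemma diffs_local us psi phi x : (forall y, psi y = phi y) -> diffs us psi x = diffs us phi x.
Proof. by move=> /funext ->. Qed.

End differences.

Section rays.
Variables (R : realType) (V : lmodType R).
Implicit Types (u v x y : V) (us vs : seq V) (A B : set V).

Definition convex A := forall x y (t : R), A x -> A y -> 0 <= t <= 1 -> A (t *: x + (1 - t) *: y).

Definition ray A u : set V := [set x | exists2 t : R, 0 <= t & A (x - t *: u)].
Definition line A u : set V := [set x | exists t : R, A (x - t *: u)].
Definition seg A u : set V := [set x | exists2 t : R, 0 <= t <= 1 & A (x - t *: u)].
(* The Minkowski sum of A and the convex cone spanned by us. *)
Definition rays us A : set V := foldr (fun u B => ray B u) A us.

Lemma convex_between A x u (s t r : R) : convex A -> A (x - s *: u) -> A (x - t *: u) ->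
  s <= r <= t -> A (x - r *: u).
Proof.
move=> cA As At /andP[sr rt]; have [st|ts] := ltP s t; last first.
  suff -> : r = s by []. by apply/eqP; rewrite eq_le sr (le_trans rt).
have ts0 : t - s != 0 by rewrite subr_eq0 gt_eqF.
have := cA _ _ ((t - r) / (t - s)) As At.
have -> : 1 - (t - r) / (t - s) = (r - s) / (t - s) by field.
have -> : (t - r) / (t - s) *: (x - s *: u) + (r - s) / (t - s) *: (x - t *: u) = x - r *: u.
  have ab : (t - r) / (t - s) + (r - s) / (t - s) = 1 by field.
  have abr : (t - r) / (t - s) * s + (r - s) / (t - s) * t = r by field.
  move: ab abr; set k1 := _ / _; set k2 := _ / _ => ab abr.
  by rewrite !scalerBr addrACA -scalerDl ab scale1r -opprD !scalerA -scalerDl abr.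
apply; rewrite divr_ge0 ?subr_ge0// ?(ltW st)//=.
by rewrite ler_pdivrMr ?subr_gt0// mul1r lerB.
Qed.

Lemma convex_shift_set (T : set R) A u :
  (forall s t (l : R), T s -> T t -> 0 <= l <= 1 -> T (l * s + (1 - l) * t)) -> convex A ->
  convex [set x | exists2 t : R, T t & A (x - t *: u)].
Proof.
move=> cT cA x y l [s Ts As] [t Tt At] l01; exists (l * s + (1 - l) * t); first exact: cT.
have := cA _ _ l As At l01.
by rewrite !scalerBr !scalerA (scalerDl u (l * s)) opprD [in X in _ -> X]addrACA.
Qed.

Lemma convex_ray A u : convex A -> convex (ray A u).
Proof.
apply: (@convex_shift_set [set t | 0 <= t]) => s t l /= s0 t0 /andP[l0 l1].
by rewrite addr_ge0// mulr_ge0// subr_ge0.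
Qed.

Lemma convex_seg A u : convex A -> convex (seg A u).
Proof.
apply: (@convex_shift_set [set t | 0 <= t <= 1]) => s t l /= /andP[s0 s1] /andP[t0 t1] /andP[l0 l1].
apply/andP; split; nra.
Qed.

Lemma convex_rays us A : convex A -> convex (rays us A).
Proof. by elim: us => //= u us IH cA; apply: convex_ray; exact: IH. Qed.

Lemma seg_ray A u v : seg (ray A u) v = ray (seg A v) u.
Proof.
apply/seteqP; split=> x.
- by move=> [s s01 [t t0 h]]; exists t => //; exists s => //; rewrite addrAC.
- by move=> [s s01 [t t0 h]]; exists t => //; exists s => //; rewrite addrAC.
Qed.

Lemma ray_ray A u v : ray (ray A u) v = ray (ray A v) u.
Proof.
apply/seteqP; split=> x.
- by move=> [s s01 [t t0 h]]; exists t => //; exists s => //; rewrite addrAC.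
- by move=> [s s01 [t t0 h]]; exists t => //; exists s => //; rewrite addrAC.
Qed.

Lemma seg_rays us A v : seg (rays us A) v = rays us (seg A v).
Proof. by elim: us => //= u us IH; rewrite seg_ray IH. Qed.

Lemma ray_rays us A v : ray (rays us A) v = rays us (ray A v).
Proof. by elim: us => //= u us IH; rewrite ray_ray IH. Qed.

Lemma rays_comm us vs A : rays us (rays vs A) = rays vs (rays us A).
Proof. by elim: us => //= u us ->; rewrite ray_rays. Qed.

Lemma rays_sub us A B : A `<=` B -> rays us A `<=` rays us B.
Proof.
move=> AB; elim: us => //= u us IH x [t t0 /IH h]; by exists t.
Qed.

Lemma sub_rays us A : A `<=` rays us A.
Proof.
elim: us => //= u us IH x /IH Ax; by exists 0 => //; rewrite scale0r subr0.
Qed.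

Lemma rays_add us A u x (t : R) : u \in us -> 0 <= t -> rays us A x -> rays us A (x + t *: u).
Proof.
elim: us x => //= v us IH x; rewrite inE => /predU1P[<-|uus] t0 [s s0 h].
- by exists (s + t); rewrite ?addr_ge0// scalerDl opprD addrACA subrr addr0.
- by exists s => //; rewrite addrAC; exact: IH.
Qed.

Lemma rays_addcone us A x y : rays us A x -> rays us [set 0] y -> rays us A (x + y).
Proof.
elim: us A x y => [|u us IH] A x y /=; first by move=> ? ->; rewrite addr0.
move=> [s s0 hs] [t t0 ht]; exists (s + t); first by rewrite addr_ge0.
by rewrite scalerDl opprD addrACA; exact: IH.
Qed.

Lemma rays_scale us x (t : R) : 0 <= t -> rays us [set 0] x -> rays us [set 0] (t *: x).
Proof.
elim: us x => [|u us IH] x t0 /=; first by move=> ->; rewrite scaler0.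
by move=> [s s0 hs]; exists (t * s); [rewrite mulr_ge0|rewrite -scalerA -scalerBr; exact: IH].
Qed.

Lemma rays_set1 us v x : rays us [set v] x <-> rays us [set 0] (x - v).
Proof.
elim: us x => [|u us IH] x /=; first by split=> [->|/eqP]; rewrite ?subrr// subr_eq0 => /eqP.
by split=> -[s s0 h]; exists s => //; [move/IH: h; rewrite addrAC|apply/IH; rewrite addrAC].
Qed.

(* By convexity the line through x in direction u meets A in an interval. *)
Lemma ind_ray_ray A u x : convex A ->
  ind A x + ind (line A u) x = ind (ray A u) x + ind (ray A (- u)) x.
Proof.
move=> cA; rewrite /ind.
have neg t : x - t *: - u = x - (- t) *: u by rewrite scaleNr scalerN.
have [xr|xr] := boolP (x \in ray A u); have [xr'|xr'] := boolP (x \in ray A (- u)).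
- move: xr xr'; rewrite !inE => -[t t0 h] [s s0]; rewrite neg => h'.
  have -> : x \in A by rewrite inE -[x]subr0 -(scale0r u); apply: convex_between h' h _; rewrite ?oppr_le0 ?s0.
  have -> : x \in line A u by rewrite inE; exists t.
  by [].
- have -> : x \in A = false.
    apply/negbTE; apply: contra xr'; rewrite !inE => Ax; by exists 0; rewrite ?scale0r ?subr0.
  suff -> : x \in line A u by rewrite addrC.
  by move: xr; rewrite !inE => -[t t0 h]; exists t.
- have -> : x \in A = false.
    apply/negbTE; apply: contra xr; rewrite !inE => Ax; by exists 0; rewrite ?scale0r ?subr0.
  suff -> : x \in line A u by [].
  by move: xr'; rewrite !inE => -[t t0]; rewrite neg => h; exists (- t).
- have -> : x \in A = false.
    apply/negbTE; apply: contra xr; rewrite !inE => Ax; by exists 0; rewrite ?scale0r ?subr0.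
  suff -> : x \in line A u = false by [].
  apply/negbTE/negP; rewrite inE => -[t h].
  have [t0|t0] := leP 0 t; first by move: xr => /negP; apply; rewrite inE; exists t.
  move: xr' => /negP; apply; rewrite inE; exists (- t); first by rewrite oppr_ge0 ltW.
  by rewrite neg opprK.
Qed.

(** Subtracting the translate by u leaves only initial segments. The result is expressed by two
    convex sets, [seg A u] and the translate of A, rather than by their set difference, so that the
    induction in [bsupp_diffs_rays] can go on. *)
Lemma diff_ind_ray A u x : convex A ->
  diff u (ind (ray A u)) x = ind (seg A u) x - ind A (x - u).
Proof.
move=> cA; rewrite /diff /ind.
have shift t : x - u - t *: u = x - (t + 1) *: u by rewrite scalerDl scale1r [_ + u]addrC opprD addrA.
have [xr|xr] := boolP (x - u \in ray A u).
- move: xr; rewrite inE => -[t t0]; rewrite shift => ht.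
  have -> : x \in ray A u by rewrite inE; exists (t + 1) => //; rewrite addr_ge0.
  rewrite subrr; have [xs|xs] := boolP (x \in seg A u).
  + move: xs; rewrite inE => -[s /andP[s0 s1] hs].
    suff -> : x - u \in A by rewrite subrr.
    by rewrite inE -[u]scale1r; apply: convex_between hs ht _; rewrite // s1 lerDr.
  + suff -> : x - u \in A = false by rewrite subrr.
    apply/negbTE; apply: contra xs.
    by rewrite !inE => h; exists 1; rewrite ?scale1r ?lexx ?ler01.
- have -> : x - u \in A = false.
    by apply/negbTE; apply: contra xr; rewrite !inE => h; exists 0; rewrite ?scale0r ?subr0.
  rewrite !subr0; congr (_%:R); congr nat_of_bool; apply/idP/idP; rewrite !inE => -[t].
  + move=> t0 h; exists t => //; rewrite t0 /= leNgt; apply: contra xr => /ltW t1.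
    by rewrite inE; exists (t - 1); rewrite ?subr_ge0// shift subrK.
  + by move=> /andP[t0 _] h; exists t.
Qed.

End rays.

(** * Brion's theorem modulo difference operators *)

Section brion.
Variables (R : realType) (V : lmodType R).
Implicit Types (u v x y : V) (us vs U Vs : seq V) (A B P : set V).

Fixpoint signs U : seq (seq V) := if U is u :: U' then
  [seq u :: s | s <- signs U'] ++ [seq - u :: s | s <- signs U'] else [:: [::]].

Lemma signs_mem U s u : s \in signs U -> u \in U -> (u \in s) || (- u \in s).
Proof.
elim: U s => //= w U IH s; rewrite mem_cat => /orP[] /mapP[s' s'U ->]; rewrite !inE.
- by case/predU1P => [->|/(IH _ s'U)/orP[] ->]; rewrite ?eqxx ?orbT.
- by case/predU1P => [->|/(IH _ s'U)/orP[] ->]; rewrite ?eqxx ?orbT.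
Qed.

Lemma diff_ind_line A u x : diff u (ind (line A u)) x = 0.
Proof.
rewrite /diff /ind; apply/eqP; rewrite subr_eq0; apply/eqP; congr (_%:R); congr nat_of_bool.
apply/idP/idP; rewrite !inE => -[t h].
- by exists (t - 1); rewrite scalerBl scale1r opprB addrA subrK.
- by exists (t + 1); rewrite scalerDl scale1r [_ + u]addrC opprD addrA.
Qed.

(* Modulo functions invariant under one of the translations in U, the indicator of
   a convex set is the sum of the indicators of its sums with the cones spanned by
   all choices of signs of U. *)
Lemma diffs_ind_signs U A x : convex A ->
  diffs U (ind A) x = \sum_(s <- signs U) diffs U (ind (rays s A)) x.
Proof.
elim: U A x => [|u U IH] A x cA /=; first by rewrite big_seq1.
rewrite big_cat !big_map /=.
(* The indicator of the lines in [ind_ray_ray] has period u, so [diff u] removes it. *)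
have split_ray : diff u (ind A) = fun y => diff u (ind (ray A u)) y + diff u (ind (ray A (- u))) y.
  apply/funext => y; have h1 := ind_ray_ray u y cA; have h2 := ind_ray_ray u (y - u) cA.
  have := diff_ind_line A u y; rewrite /diff => h3; lra.
have term w : convex (ray A w) -> diffs U (diff u (ind (ray A w))) x =
    \sum_(s <- signs U) diff u (diffs U (ind (ray (rays s A) w))) x.
  move=> cAw; rewrite diffs_diff /diff !IH// -sumrB; apply: eq_bigr => s _.
  by rewrite ray_rays.
by rewrite -diffs_diff split_ray diffsD !term//; exact: convex_ray.
Qed.

Lemma rays_absorb us s A : (forall u, u \in us -> rays s [set 0] u) ->
  rays us (rays s A) `<=` rays s A.
Proof.
elim: us => [|u us IH] H x; [by []|move=> [t t0 h]].
have := IH (fun u h => H u (mem_behead (s := _ :: _) h)) _ h.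
have := rays_scale t0 (H u (mem_head _ _)) => h1 h2.
by have := rays_addcone h2 h1; rewrite subrK.
Qed.

Lemma rays_self s u : u \in s -> rays s [set 0] u.
Proof.
move=> us; have := rays_add us ler01 (@sub_rays _ _ s [set 0] 0 erefl).
by rewrite scale1r add0r.
Qed.

Lemma total_preorder_min (T : eqType) (le : T -> T -> Prop) (l : seq T) :
  (forall a, le a a) -> (forall b a c, le a b -> le b c -> le a c) ->
  {in l &, forall a b, le a b \/ le b a} -> l != [::] ->
  exists2 m, m \in l & forall a, a \in l -> le m a.
Proof.
move=> refl trans; elim: l => // a l IH tot _.
have [->|l0] := eqVneq l [::].
  by exists a; rewrite ?mem_head// => b; rewrite inE => /eqP ->.
have [|m ml Hm] := IH _ l0; first by move=> x y xl yl; apply: tot; rewrite inE ?xl ?yl orbT.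
have [||am|ma] := tot a m _ _; rewrite ?inE ?eqxx ?ml ?orbT//.
- exists a; first exact: mem_head.
  by move=> b; rewrite inE => /predU1P[->//|/Hm]; exact: trans.
- exists m; first by rewrite inE ml orbT.
  by move=> b; rewrite inE => /predU1P[->//|/Hm].
Qed.

(** All ordered pairs of distinct points are taken, whether or not they span an edge: under every
    choice of signs any two vertices have to become comparable. *)
Definition edge_differences Vs := [seq a - b | a <- Vs, b <- [seq c <- Vs | a != c]].

Lemma mem_edge_differences Vs a b : a \in Vs -> b \in Vs -> a != b ->
  a - b \in edge_differences Vs.
Proof.
move=> aV bV ab; apply/allpairsPdep; exists a, b; split=> //.
by rewrite mem_filter ab.
Qed.

Lemma edge_differences_neq0 Vs u : u \in edge_differences Vs -> u != 0.
Proof.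
case/allpairsPdep => a [b [_ + ->]]; rewrite mem_filter subr_eq0 => /andP[ab _].
exact: ab.
Qed.

(** Fix signs s and let C be the cone that they span. The condition b - a in C defines a total
    preorder on the vertices; let v0 be least. All vertices lie in v0 + C, so P + C and K v0 + C
    both equal v0 + C, and the terms of P and of v0 agree. The terms of the other vertices
    vanish. *)
Lemma brion_mod_differences P Vs (K : V -> set V) x : uniq Vs -> Vs != [::] -> convex P ->
  (forall v, v \in Vs -> P v) ->
  (forall C, convex C -> (forall v, v \in Vs -> C v) -> P `<=` C) ->
  (forall v, v \in Vs -> K v = rays [seq w - v | w <- Vs] [set v]) ->
  diffs (edge_differences Vs) (ind P) x =
    \sum_(v <- Vs) diffs (edge_differences Vs) (ind (K v)) x.
Proof.
move=> uV V0 cP VP hullP KE; set U := edge_differences Vs.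
have c1 v : convex [set v : V].
  by move=> y z t -> -> _ /=; rewrite -scalerDl addrC subrK scale1r.
have cK v : v \in Vs -> convex (K v) by move=> /KE ->; exact: convex_rays.
rewrite diffs_ind_signs//.
have -> : \sum_(v <- Vs) diffs U (ind (K v)) x =
    \sum_(v <- Vs) \sum_(s <- signs U) diffs U (ind (rays s (K v))) x.
  by apply: eq_big_seq => v vV; rewrite diffs_ind_signs//; exact: cK.
rewrite exchange_big /=; apply: eq_big_seq => s sU.
pose C := rays s [set 0].
have tot a b : a \in Vs -> b \in Vs -> C (b - a) \/ C (a - b).
  move=> aV bV; have [<-|ab] := eqVneq a b.
    by left; rewrite subrr; exact: sub_rays.
  have := signs_mem sU (mem_edge_differences aV bV ab).
  by case/orP => h; [right|left; rewrite -opprB]; exact: rays_self.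
have [v0 v0V Hv0] : exists2 m, m \in Vs & forall a, a \in Vs -> C (a - m).
  apply: (@total_preorder_min _ (fun a b => C (b - a))) => //.
  - by move=> a; rewrite subrr; exact: sub_rays.
  - by move=> b a c ab bc; have := rays_addcone bc ab; rewrite addrA subrK.
have idem A : rays s (rays s A) `<=` rays s A by apply: rays_absorb => u; exact: rays_self.
have PE : rays s P = rays s [set v0].
  apply/seteqP; split; last by apply: rays_sub => _ ->; exact: VP.
  apply: subset_trans (idem _); apply: rays_sub; apply: hullP; first exact: convex_rays.
  by move=> v /Hv0 h; apply/rays_set1.
have KE0 : rays s (K v0) = rays s [set v0].
  apply/seteqP; split; last by apply: rays_sub => _ ->; rewrite KE//; exact: sub_rays.
  rewrite KE// rays_comm; apply: rays_absorb => _ /mapP[w wV ->]; exact: Hv0.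
rewrite (bigD1_seq v0)//= KE0 PE big_seq_cond big1 ?addr0// => v /andP[vV vv0].
(* [K v] contains the direction v0 - v and C contains v - v0, so K v + C has period v - v0. *)
apply: (diffs_periodic (mem_edge_differences vV v0V vv0)) => y.
rewrite /ind; congr (_%:R); congr nat_of_bool; apply/idP/idP; rewrite !inE => h.
- by have := rays_addcone h (Hv0 _ vV); rewrite subrK.
- move: h; rewrite KE// rays_comm => h.
  have v0v : v0 - v \in [seq w - v | w <- Vs] by apply/mapP; exists v0.
  by have := rays_add v0v ler01 h; rewrite scale1r opprB.
Qed.

End brion.

Section bounded_support.
Variables (R : realType) (V : normedModType R).
Implicit Types (u v x y : V) (us vs U Vs : seq V) (A B P : set V) (psi phi : V -> R).

Definition bsupp psi := exists M : R, forall x, M < `|x| -> psi x = 0.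

Definition bdd A := exists M : R, forall x, A x -> `|x| <= M.

Lemma bsupp_ind A : bdd A -> bsupp (ind A).
Proof.
move=> [M AM]; exists M => x Mx; rewrite /ind (_ : x \in A = false)//.
by apply: contraTF Mx; rewrite inE -leNgt => /AM.
Qed.

Lemma bsuppB psi phi : bsupp psi -> bsupp phi -> bsupp (fun x => psi x - phi x).
Proof.
move=> [M1 H1] [M2 H2]; exists (Num.max M1 M2) => x; rewrite gt_max => /andP[h1 h2].
by rewrite H1// H2// subrr.
Qed.

Lemma bsupp_shift psi u : bsupp psi -> bsupp (fun x => psi (x - u)).
Proof.
move=> [M H]; exists (M + `|u|) => x h; apply: H.
by rewrite -(ltrD2r `|u|); apply: lt_le_trans h _; rewrite -lerBlDr lerB_dist.
Qed.

Lemma bsupp_diff psi u : bsupp psi -> bsupp (diff u psi).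
Proof. by move=> h; apply: bsuppB => //; exact: bsupp_shift. Qed.

Lemma bsupp_diffs psi us : bsupp psi -> bsupp (diffs us psi).
Proof. by move=> h; elim: us => //= u us; exact: bsupp_diff. Qed.

Lemma bdd_seg A u : bdd A -> bdd (seg A u).
Proof.
move=> [M AM]; exists (M + `|u|) => x [t /andP[t0 t1] /AM h].
rewrite -[x](subrK (t *: u)); apply: le_trans (ler_normD _ _) _; apply: lerD => //.
by rewrite normrZ ger0_norm// ler_piMl.
Qed.

(** Each operator trades the half-line in its direction for a bounded segment, by [diff_ind_ray];
    the induction therefore runs over all bounded convex [A]. *)
Lemma bsupp_diffs_rays us A : convex A -> bdd A -> bsupp (diffs us (ind (rays us A))).
Proof.
elim: us A => [|u us IH] A cA bA /=; first exact: bsupp_ind.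
rewrite -diffs_diff.
have -> : diff u (ind (ray (rays us A) u)) =
    (fun x => ind (rays us (seg A u)) x - ind (rays us A) (x - u)).
  by apply/funext => x; rewrite diff_ind_ray ?seg_rays//; exact: convex_rays.
have -> : diffs us (fun x => ind (rays us (seg A u)) x - ind (rays us A) (x - u)) =
    (fun x => diffs us (ind (rays us (seg A u))) x - diffs us (ind (rays us A)) (x - u)).
  by apply/funext => x; rewrite diffsB (diffs_shift us (ind (rays us A))).
apply: bsuppB; first by apply: IH; [exact: convex_seg|exact: bdd_seg].
by apply: bsupp_shift; exact: IH.
Qed.

(** If the difference along a nonzero u vanishes, the function has period u, and large multiples of
    u lead out of its bounded support. *)
Lemma bsupp_diffs_inj us psi : bsupp psi -> (forall u, u \in us -> u != 0) ->
  (forall x, diffs us psi x = 0) -> forall x, psi x = 0.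
Proof.
elim: us => //= u us IH bpsi us0 H; apply: IH => //.
  by move=> w wus; apply: us0; rewrite inE wus orbT.
have [M HM] := bsupp_diffs us bpsi.
have u0 : 0 < `|u| by rewrite normr_gt0 us0// mem_head.
have per x n : diffs us psi x = diffs us psi (x - n%:R *: u).
  elim: n => [|n ->]; first by rewrite scale0r subr0.
  have /eqP := H (x - n%:R *: u); rewrite /diff subr_eq0 => /eqP ->.
  by rewrite -natr1 scalerDl scale1r opprD addrA.
move=> x; pose n := (Num.truncn ((M + `|x|) / `|u|)).+1.
rewrite (per x n); apply: HM.
have h : (M + `|x|) / `|u| < n%:R by exact: truncnS_gt.
rewrite ltr_pdivrMr// in h; rewrite -(ltrD2r `|x|); apply: (lt_le_trans h).
rewrite distrC -[leLHS](_ : `|n%:R *: u| = _); last by rewrite normrZ ger0_norm.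
by rewrite -lerBlDr lerB_dist.
Qed.

End bounded_support.

Lemma finite_seq_of_injection (T U : eqType) (Q : T -> Prop) (f : T -> U) (s : seq U) :
  (forall x y, Q x -> Q y -> f x = f y -> x = y) -> (forall x, Q x -> f x \in s) ->
  exists r : seq T, uniq r /\ forall x, x \in r <-> Q x.
Proof.
elim: s Q => [|u s IH] Q inj Qs.
  by exists [::]; split=> // x; split=> // /Qs.
have [[x0 [Qx0 fx0]]|nex] := pselect (exists x, Q x /\ f x = u).
- have [||r [ur rP]] := IH (fun x => Q x /\ x != x0).
  + by move=> x y [Qx _] [Qy _]; exact: inj.
  + move=> x [Qx /eqP xx0]; have := Qs x Qx; rewrite inE => /predU1P[fx|//].
    by case: xx0; apply: inj; rewrite // fx.
  exists (x0 :: r); split; first by rewrite /= ur andbT; apply/negP => /rP[_]; rewrite eqxx.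
  move=> x; rewrite inE; split=> [/predU1P[->//|/rP[]//]|Qx].
  by have [//|xx0] := eqVneq x x0; apply/rP.
- apply: IH => // x Qx; have := Qs x Qx; rewrite inE => /predU1P[fx|//].
  by case: nex; exists x.
Qed.

Lemma count_lt (T : eqType) (a b : pred T) (s : seq T) y : {in s, forall z, a z -> b z} ->
  y \in s -> b y -> ~~ a y -> (count a s < count b s)%N.
Proof.
move=> ab ys bY aY; rewrite -[X in (_ < X)%N]size_filter -(count_predC (pred1 y)) !count_filter.
rewrite -add1n; apply: leq_add.
  by rewrite -has_count; apply/hasP; exists y; rewrite //= eqxx.
rewrite (@eq_in_count _ a (predI a (predI (predC (pred1 y)) b))); last first.
  move=> z zs /=; have := ab z zs; case: (boolP (a z)) => //= az ->//.
  by rewrite andbT; apply/esym; apply: contraNN aY => /eqP <-.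
by apply: sub_count => z /= /andP[].
Qed.

(** * Polyhedra as lists of inequalities *)

Section polyhedra.
Variables (R : realType) (d : nat).
Local Notation V := 'rV[R]_d.
Implicit Types (x y z t u v : V) (c : V * R) (l : seq (V * R)).

Lemma dotrC x y : dotr x y = dotr y x.
Proof. by apply: eq_bigr => k _; rewrite mulrC. Qed.

Lemma dotrDr x y z : dotr x (y + z) = dotr x y + dotr x z.
Proof. by rewrite /dotr -big_split; apply: eq_bigr => k _; rewrite mxE mulrDr. Qed.

Lemma dotrZr (a : R) x y : dotr x (a *: y) = a * dotr x y.
Proof. by rewrite /dotr mulr_sumr; apply: eq_bigr => k _; rewrite mxE mulrCA. Qed.

Lemma dotrNr x y : dotr x (- y) = - dotr x y.
Proof. by rewrite -scaleN1r dotrZr mulN1r. Qed.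

Lemma dotrBr x y z : dotr x (y - z) = dotr x y - dotr x z.
Proof. by rewrite dotrDr dotrNr. Qed.

Lemma dotr0r x : dotr x 0 = 0.
Proof. by rewrite -(scale0r 0) dotrZr mul0r. Qed.

Lemma dotrDl x y z : dotr (x + y) z = dotr x z + dotr y z.
Proof. by rewrite ![dotr _ z]dotrC dotrDr. Qed.

Lemma dotrZl (a : R) x y : dotr (a *: x) y = a * dotr x y.
Proof. by rewrite ![dotr _ y]dotrC dotrZr. Qed.

Lemma dotrNl x y : dotr (- x) y = - dotr x y.
Proof. by rewrite ![dotr _ y]dotrC dotrNr. Qed.

Lemma dotrBl x y z : dotr (x - y) z = dotr x z - dotr y z.
Proof. by rewrite dotrDl dotrNl. Qed.

Lemma dotr_suml I (r : seq I) (F : I -> V) y :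
  dotr (\sum_(i <- r) F i) y = \sum_(i <- r) dotr (F i) y.
Proof.
elim: r => [|i r IH]; last by rewrite !big_cons dotrDl IH.
by rewrite !big_nil dotrC dotr0r.
Qed.

(** A hyperplane is entered as two opposite inequalities; the constraints active at a point then
    form a sublist, whose length drives the induction of [bounded_hpoly_hull]. *)
Definition hpoly l : set V := [set x | forall c, c \in l -> dotr c.1 x <= c.2].

Definition active l x := [seq c <- l | dotr c.1 x == c.2].

Lemma polyhedron_hpoly (P : set V) : polyhedron P -> exists l, P = hpoly l.
Proof.
move=> [k [m [A [b [B [e PE]]]]]].
exists ([seq (row i A, b i) | i <- enum 'I_k] ++ ([seq (row j B, e j) | j <- enum 'I_m] ++
  [seq (- row j B, - e j) | j <- enum 'I_m])).
rewrite PE; apply/seteqP; split=> x.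
- move=> [h1 h2] c; rewrite !mem_cat => /or3P[] /mapP[i _ ->] //=; first by rewrite h2.
  by rewrite dotrNl h2.
- move=> h; split=> [i|j].
  + by apply: (h (row i A, b i)); rewrite mem_cat map_f// mem_enum.
  + apply/eqP; rewrite eq_le; apply/andP; split.
      by apply: (h (row j B, e j)); rewrite !mem_cat (map_f _ (mem_enum _ j)) orbT.
    rewrite -lerN2 -dotrNl.
    by apply: (h (- row j B, - e j)); rewrite !mem_cat (map_f _ (mem_enum _ j)) !orbT.
Qed.

Lemma hpoly_convex l : convex (hpoly l).
Proof.
move=> x y a hx hy /andP[a0 a1] c cl; rewrite dotrDr !dotrZr.
have := hx c cl; have := hy c cl; nra.
Qed.

Lemma feasible_direction l x t : hpoly l x ->
  (forall c, c \in active l x -> dotr c.1 t <= 0) ->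
  exists2 e : R, 0 < e & forall s : R, 0 <= s <= e -> hpoly l (x + s *: t).
Proof.
elim: l => [|c l IH] hx ht; first by exists 1.
have [||e e0 He] := IH.
- by move=> c' c'l; apply: hx; rewrite inE c'l orbT.
- by move=> c' c'l; apply: ht; rewrite /active /=; case: ifP => _ //; rewrite inE c'l orbT.
have [e1 e10 He1] : exists2 e1 : R, 0 < e1 & forall s : R, 0 <= s <= e1 -> dotr c.1 (x + s *: t) <= c.2.
  have [/eqP E|] := boolP (dotr c.1 x == c.2).
    exists 1 => // s /andP[s0 _]; rewrite dotrDr dotrZr E gerDl.
    by rewrite mulr_ge0_le0// ht// /active /= E eqxx mem_head.
  move=> nc; have hc' : dotr c.1 x < c.2 by rewrite lt_neqAle nc hx// mem_head.
  have p : 0 < `|dotr c.1 t| + 1 by rewrite ltr_wpDl.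
  exists ((c.2 - dotr c.1 x) / (`|dotr c.1 t| + 1)); first by rewrite divr_gt0// subr_gt0.
  move=> s /andP[s0]; rewrite ler_pdivlMr// => s1; rewrite dotrDr dotrZr -lerBrDl.
  apply: le_trans s1; rewrite ler_wpM2l//; apply: le_trans (ler_norm _) _; by rewrite lerDl.
exists (Num.min e e1); first by rewrite lt_min e0.
move=> s /andP[s0]; rewrite le_min => /andP[se se1] c'; rewrite inE => /predU1P[->|c'l].
- by apply: He1; rewrite s0.
- by apply: He => //; rewrite s0.
Qed.

(** The normals of the active constraints span the space: the algebraic form of being a vertex. *)
Definition tight l x := forall t, (forall c, c \in active l x -> dotr c.1 t = 0) -> t = 0.

Lemma vertex_in (X : set V) v : vertex X v -> X v.
Proof. by move=> [u [b [_ h]]]; have : [set v] v by []; rewrite -h => -[]. Qed.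

(** Along a direction orthogonal to all active normals one can move both ways, so an exposing
    functional is constant along it and the direction is 0. Conversely, the sum of the active
    constraints exposes a tight point. *)
Lemma vertexP l x : hpoly l x -> (vertex (hpoly l) x <-> tight l x).
Proof.
move=> hx; split.
- move=> [u [b [ub uE]]] t ht.
  have [e e0 He] := feasible_direction hx (fun c h => eq_ind_r (fun r => r <= 0) (lexx 0) (ht c h)).
  have hN c : c \in active l x -> dotr c.1 (- t) <= 0 by move=> /ht; rewrite dotrNr => ->; rewrite oppr0.
  have [e' e'0 He'] := feasible_direction hx hN.
  have xb : dotr u x = b by have : [set x] x by []; rewrite -uE => -[].
  have ut : dotr u t = 0.
    apply/eqP; rewrite eq_le; apply/andP; split.
    + have := ub _ (He e _); rewrite lexx ltW// => /(_ isT).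
      by rewrite dotrDr dotrZr xb gerDl pmulr_rle0.
    + have := ub _ (He' e' _); rewrite lexx ltW// => /(_ isT).
      by rewrite dotrDr dotrZr dotrNr xb gerDl pmulr_rle0// oppr_le0.
  have : [set x] (x + e *: t).
    rewrite -uE; split; first by apply: He; rewrite lexx ltW.
    by rewrite /= dotrDr dotrZr ut mulr0 addr0.
  move=> /= /eqP; rewrite -subr_eq0 addrAC subrr add0r scaler_eq0 gt_eqF//=.
  by move/eqP.
- move=> tx; exists (\sum_(c <- active l x) c.1), (\sum_(c <- active l x) c.2).
  have le_c y c : hpoly l y -> c \in active l x -> dotr c.1 y <= c.2.
    by move=> hy; rewrite mem_filter => /andP[_]; exact: hy.
  split.
  + by move=> y hy; rewrite dotr_suml big_seq [leRHS]big_seq; apply: ler_sum => c; exact: le_c.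
  + apply/seteqP; split=> [y [hy /= E]|y ->]; last first.
      split=> //=; rewrite dotr_suml; apply: eq_big_seq => c.
      by rewrite mem_filter => /andP[/eqP].
    apply/eqP; rewrite -subr_eq0; apply/eqP; apply: tx => c ca; rewrite dotrBr.
    have cx : dotr c.1 x = c.2 by move: ca; rewrite mem_filter => /andP[/eqP].
    rewrite cx; apply/eqP; rewrite eq_le subr_le0 le_c//= subr_ge0.
    move: E; rewrite dotr_suml !(big_rem c ca) /= => E.
    have : \sum_(c <- rem c (active l x)) dotr c.1 y <= \sum_(c <- rem c (active l x)) c.2.
      rewrite big_seq [leRHS]big_seq; apply: ler_sum => c' /mem_rem; exact: le_c.
    by move=> h; rewrite -(lerD2r (\sum_(c <- rem c (active l x)) dotr c.1 y)) E lerD2l.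
Qed.

(** Boundedness provides constraints that increase along t; the one with the least ratio [q] is hit
    first. The constraints already active are constant along t, so the number of active ones grows
    strictly. *)
Lemma ray_exit l x t : bdd (hpoly l) -> hpoly l x -> t != 0 ->
  (forall c, c \in active l x -> dotr c.1 t = 0) ->
  exists e : R, [/\ 0 <= e, hpoly l (x + e *: t) &
    (size (active l x) < size (active l (x + e *: t)))%N].
Proof.
move=> [M HM] hx t0 ht.
pose L := [seq c <- l | 0 < dotr c.1 t].
pose q c := (c.2 - dotr c.1 x) / dotr c.1 t.
have L0 : L != [::].
  apply/eqP => L0.
  have H e : 0 <= e -> hpoly l (x + e *: t).
    move=> e0 c cl; rewrite dotrDr dotrZr; apply: le_trans (hx c cl); rewrite gerDl.
    rewrite mulr_ge0_le0// leNgt; apply/negP => h.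
    by have : c \in L; [rewrite mem_filter h|rewrite L0].
  have nt : 0 < `|t| by rewrite normr_gt0.
  pose e := (`|M| + `|x| + 1) / `|t|.
  have e0 : 0 <= e by rewrite divr_ge0// !addr_ge0.
  have := HM _ (H e e0); rewrite leNgt => /negP; apply.
  have : `|e *: t| - `|x| <= `|x + e *: t|.
    by rewrite [x + _]addrC -[x in X in _ <= X]opprK -{1}[ `|x|]normrN lerB_dist.
  apply: lt_le_trans; rewrite normrZ ger0_norm// divfK ?gt_eqF//.
  have := ler_norm M; lra.
have [c0 c0L Hc0] : exists2 m, m \in L & forall a, a \in L -> q m <= q a.
  apply: (@total_preorder_min _ (fun a b => q a <= q b)) => //.
  - by move=> a b c; exact: le_trans.
  - by move=> a b _ _; apply/orP; exact: le_total.
move: (c0L); rewrite mem_filter => /andP[c0t c0l].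
have q0 : 0 <= q c0 by rewrite divr_ge0 ?(ltW c0t)// subr_ge0 hx.
have hq : hpoly l (x + q c0 *: t).
  move=> c cl; rewrite dotrDr dotrZr; have [ct|ct] := ltP 0 (dotr c.1 t).
  - have : q c0 <= q c by apply: Hc0; rewrite mem_filter ct.
    by rewrite /q ler_pdivlMr// -lerBrDl.
  - by apply: le_trans (hx c cl); rewrite gerDl mulr_ge0_le0.
exists (q c0); split=> //; rewrite /active !size_filter.
have sub c : c \in l -> dotr c.1 x == c.2 -> dotr c.1 (x + q c0 *: t) == c.2.
  by move=> cl cx; rewrite dotrDr dotrZr (ht c) ?mulr0 ?addr0// mem_filter cx.
have c0new : dotr c0.1 (x + q c0 *: t) == c0.2.
  by apply/eqP; rewrite dotrDr dotrZr /q; field; rewrite gt_eqF.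
have c0old : dotr c0.1 x != c0.2.
  by apply: contraTneq c0t => E; rewrite ht ?ltxx// mem_filter E eqxx.
exact: (count_lt (a := fun c => dotr c.1 x == c.2) sub c0l c0new c0old).
Qed.

(** Minkowski's theorem, stated against every convex [C] in place of a convex hull. A point that is
    not a vertex lies between two exit points in opposite directions, at which fewer constraints are
    inactive. *)
Lemma bounded_hpoly_hull l (C : set V) : bdd (hpoly l) -> convex C ->
  (forall v, vertex (hpoly l) v -> C v) -> hpoly l `<=` C.
Proof.
move=> bX cC VC x.
have [n] := ubnP (size l - size (active l x))%N.
elim: n => // n IH in x *; rewrite ltnS => sn hx.
have [tx|] := pselect (tight l x); first by apply: VC; apply/vertexP.
move=> /existsNP[t /not_implyP[ht /eqP t0]].
have htN c : c \in active l x -> dotr c.1 (- t) = 0 by move=> /ht; rewrite dotrNr => ->; rewrite oppr0.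
have [e1 [e10 he1 s1]] := ray_exit bX hx t0 ht.
have [|e2 [e20 he2 s2]] := ray_exit bX hx _ htN; first by rewrite oppr_eq0.
have step y : hpoly l y -> (size (active l x) < size (active l y))%N -> C y.
  move=> hy sy; apply: IH => //; apply: leq_trans sn.
  by rewrite ltn_sub2l// (leq_trans sy)// size_filter count_size.
rewrite -[x]subr0 -(scale0r t); apply: (@convex_between _ _ _ _ _ (- e1) e2) => //.
- by rewrite scaleNr opprK; exact: step.
- by rewrite -scalerN; exact: step.
- by rewrite oppr_le0 e10.
Qed.

(** A vertex is determined by its active constraints, hence by a Boolean word of the length of
    [l]. *)
Lemma vertex_seq l : exists r : seq V, uniq r /\ forall v, v \in r <-> vertex (hpoly l) v.
Proof.
pose f v : seq bool := [seq dotr c.1 v == c.2 | c <- l].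
apply: (@finite_seq_of_injection _ _ _ f [seq val b | b <- enum {: (size l).-tuple bool}]).
- move=> x y vx vy fxy; have hx := vertex_in vx; have hy := vertex_in vy.
  have E c : c \in l -> (dotr c.1 x == c.2) = (dotr c.1 y == c.2).
    by move: c; apply/eq_in_map.
  have tx := (vertexP hx).1 vx.
  apply/eqP; rewrite -subr_eq0; apply/eqP; apply: tx => c; rewrite mem_filter => /andP[/eqP cx cl].
  by have := E c cl; rewrite cx eqxx => /esym/eqP cy; rewrite dotrBr cx cy subrr.
- move=> x _; have sz : size (f x) == size l by rewrite size_map.
  by apply/mapP; exists (Tuple sz) => //; rewrite mem_enum.
Qed.

Lemma bounded_set_bdd (X : set V) : bounded_set X -> bdd X.
Proof. by move=> [M [_ H]]; exists (M + 1) => x Xx; apply: (H (M + 1)) => //; rewrite ltrDl. Qed.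

Lemma tangent_cone_hpoly l v : hpoly l v -> tangent_cone (hpoly l) v = hpoly (active l v).
Proof.
move=> hv; apply/seteqP; split=> z.
- move=> [y [s [hy s0 ->]]] c; rewrite mem_filter => /andP[/eqP cv cl].
  rewrite dotrDr dotrZr dotrBr cv gerDl mulr_ge0_le0// subr_le0; exact: hy.
- move=> hz; have [|e e0 He] := @feasible_direction l v (z - v) hv.
    by move=> c ca; rewrite dotrBr subr_le0; move: (ca); rewrite mem_filter => /andP[/eqP -> _]; exact: hz.
  exists (v + e *: (z - v)), e^-1; split; first by apply: He; rewrite lexx ltW.
    by rewrite invr_ge0 ltW.
  by rewrite [v + _ - v]addrAC subrr add0r scalerA mulVf ?gt_eqF// scale1r addrC subrK.
Qed.

Lemma tangent_cone_scale (P : set V) v x (s : R) : 0 <= s ->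
  tangent_cone P v (v + x) -> tangent_cone P v (v + s *: x).
Proof.
move=> s0 [y [e [Py e0 E]]]; exists y, (s * e); split=> //; first by rewrite mulr_ge0.
by congr (_ + _); rewrite -scalerA; congr (_ *: _); apply: (addrI v).
Qed.

Lemma tangent_cone_add (P : set V) v x y : convex P -> P v ->
  tangent_cone P v (v + x) -> tangent_cone P v (v + y) -> tangent_cone P v (v + (x + y)).
Proof.
move=> cP Pv [y1 [e1 [Py1 e10 /addrI E1]]] [y2 [e2 [Py2 e20 /addrI E2]]].
have [e0|e0] := leP (e1 + e2) 0.
  have e1E : e1 = 0 by lra.
  have e2E : e2 = 0 by lra.
  exists v, 0; split=> //; by rewrite E1 E2 e1E e2E !scale0r addr0.
exists ((e1 / (e1 + e2)) *: y1 + (1 - e1 / (e1 + e2)) *: y2), (e1 + e2); split; [|exact: ltW|].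
  by apply: cP => //; rewrite divr_ge0 ?(ltW e0)//= ler_pdivrMr// mul1r lerDl.
congr (_ + _); rewrite E1 E2.
by apply/matrixP => i j; rewrite !mxE; field; rewrite gt_eqF.
Qed.

End polyhedra.

(** * Edges and interior of vertex cones *)

Section vertex_cones.
Variables (R : realType) (d : nat).
Local Notation V := 'rV[R]_d.
Implicit Types (x y z t u v w : V) (l : seq (V * R)) (P : set V) (us ws : seq V).

(** Kept general in the sublinear [nu]: besides the norm, it serves for the seminorm adapted to an
    edge in [near_wall_bound]. *)
Lemma rays_bound (nu : V -> R) us y (C : R) : (forall x z, nu (x + z) <= nu x + nu z) ->
  (forall (s : R) x, 0 <= s -> nu (s *: x) <= s * nu x) ->
  (forall u, u \in us -> nu u <= C * dotr y u) ->
  forall x, rays us [set 0] x -> nu x <= C * dotr y x.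
Proof.
move=> nuD nuZ; elim: us => [|u us IH] H x /=.
  by move=> ->; rewrite dotr0r mulr0 -(scale0r 0); apply: le_trans (nuZ _ _ _) _; rewrite // mul0r.
move=> [s s0 /IH h]; have {}h := h (fun w hw => H w (mem_behead (s := _ :: _) hw)).
rewrite -[x](subrK (s *: u)) dotrDr mulrDr; apply: le_trans (nuD _ _) _; apply: lerD => //.
apply: le_trans (nuZ _ _ s0) _; rewrite dotrZr mulrCA; apply: ler_wpM2l => //.
by apply: H; exact: mem_head.
Qed.

Lemma norm_rays_bound us y (C : R) : (forall u, u \in us -> `|u| <= C * dotr y u) ->
  forall x, rays us [set 0] x -> `|x| <= C * dotr y x.
Proof.
apply: (@rays_bound (fun x => `|x|)); first exact: ler_normD.
by move=> s x s0; rewrite normrZ ger0_norm.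
Qed.

Lemma seq_bound (T : eqType) (s : seq T) (f : T -> R) :
  exists C : R, 0 < C /\ forall u : T, u \in s -> f u <= C.
Proof.
elim: s => [|a s [C [C0 IH]]]; first by exists 1.
exists (Num.max C (f a)); split; first by rewrite lt_max C0.
by move=> u; rewrite inE le_max => /predU1P[->|/IH ->]; rewrite ?lexx ?orbT.
Qed.

Lemma norm_bound_exists us y : (forall u, u \in us -> u != 0 -> 0 < dotr y u) ->
  exists2 C : R, 0 < C & forall u, u \in us -> `|u| <= C * dotr y u.
Proof.
move=> H; have [C [C0 HC]] := @seq_bound _ us (fun u => `|u| / dotr y u).
exists C => // u uus; have [->|u0] := eqVneq u 0; first by rewrite normr0 dotr0r mulr0.
by have := HC u uus; rewrite ler_pdivrMr// H.
Qed.

Lemma tangent_cone_rays l v (Vs : seq V) : bdd (hpoly l) -> hpoly l v ->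
  (forall w, w \in Vs <-> vertex (hpoly l) w) ->
  tangent_cone (hpoly l) v = rays [seq w - v | w <- Vs] [set v].
Proof.
move=> bP hv VsP; have cP := @hpoly_convex _ _ l.
have c0 : convex [set v : V].
  by move=> y z t -> -> _ /=; rewrite -scalerDl addrC subrK scale1r.
apply/seteqP; split=> z.
- move=> [y [s [Py s0 ->]]]; apply/rays_set1; rewrite addrAC subrr add0r.
  apply: rays_scale => //; apply: (rays_set1 _ v _).1; move: y Py.
  apply: bounded_hpoly_hull => //; first exact: convex_rays.
  move=> w /VsP wV; apply/rays_set1; apply: rays_self; exact: map_f.
- have H us : (forall u, u \in us -> tangent_cone (hpoly l) v (v + u)) ->
     rays us [set v] `<=` tangent_cone (hpoly l) v.
    elim: us => [|u us IH] Hus x /=.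
      by move=> ->; exists v, 0; split; rewrite // scale0r addr0.
    move=> [s s0 /IH h]; have := h (fun w hw => Hus w (mem_behead (s := _ :: _) hw)).
    have := tangent_cone_scale s0 (Hus u (mem_head _ _)).
    rewrite -[x - s *: u](subrK v) [_ - _ + v]addrC => h2 h1.
    have := tangent_cone_add cP hv h1 h2.
    by rewrite addrA [v + _]addrC !subrK.
  apply: H => u /mapP[w /VsP/vertex_in wV ->]; exists w, 1; split=> //.
  by rewrite scale1r.
Qed.

(** The generators are the vertices of the section of the cone by the hyperplane eta = 1. Taking
    these instead of all differences w - v makes each of them an edge direction: the functional
    exposing w in the section gives the [y] of the last clause, a point of the wall where w is the
    only generator orthogonal to it. *)
Lemma vertex_cone_generators l v : bdd (hpoly l) -> vertex (hpoly l) v ->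
  exists ws eta, [/\ tangent_cone (hpoly l) v = rays ws [set v],
    forall w, w \in ws -> 0 < dotr eta w &
    forall w, w \in ws -> exists y, dotr y w = 0 /\
      forall w', w' \in ws -> w' != w -> 0 < dotr y w'].
Proof.
move=> bP vv; have hv := vertex_in vv; have [Vs [uVs VsP]] := vertex_seq l.
have TC := tangent_cone_rays bP hv VsP; have TCh := tangent_cone_hpoly hv.
have [u [b [ub uE]]] := vv; pose eta := - u.
have uv : dotr u v = b by have : [set v] v by []; rewrite -uE => -[].
set gens := [seq w - v | w <- Vs] in TC.
have eta_gen g : g \in gens -> g != 0 -> 0 < dotr eta g.
  move=> /mapP[w /VsP/vertex_in hw ->]; rewrite subr_eq0 => wv.
  rewrite /eta dotrNl dotrBr uv oppr_gt0 subr_lt0 lt_neqAle ub// andbT.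
  by apply: contra wv => /eqP E; apply/eqP; have : [set v] w by rewrite -uE.
have [C C0 HC] := norm_bound_exists eta_gen.
have cone_bd x : rays gens [set 0] x -> `|x| <= C * dotr eta x by exact: norm_rays_bound.
pose l0 := [seq (c.1, 0) | c <- active l v] : seq (V * R).
have cone_hpoly x : hpoly l0 x <-> rays gens [set 0] x.
  have -> : rays gens [set 0] x = rays gens [set v] (x + v).
    by apply/propext; rewrite (rays_set1 gens v) addrK.
  rewrite -TC TCh; split=> h.
  - move=> c ca; move: (ca); rewrite mem_filter => /andP[/eqP cv _]; rewrite dotrDr cv gerDr.
    exact: (h (c.1, 0) (map_f _ ca)).
  - move=> _ /mapP[c ca ->] /=; have := h c ca; move: ca; rewrite mem_filter => /andP[/eqP cv _].
    by rewrite dotrDr cv gerDr.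
pose lS := (eta, 1) :: (- eta, -1) :: l0 : seq (V * R).
have SP x : hpoly lS x <-> dotr eta x = 1 /\ rays gens [set 0] x.
  split.
  - move=> h; split; last first.
      by apply/cone_hpoly => c cl; apply: h; rewrite !inE cl !orbT.
    apply/eqP; rewrite eq_le; apply/andP; split; first by apply: (h (eta, 1)); rewrite mem_head.
    rewrite -lerN2 -dotrNl; apply: (h (- eta, -1)); by rewrite !inE eqxx orbT.
  - move=> [h1 /cone_hpoly h2] c; rewrite !inE => /or3P[/eqP ->|/eqP ->|/h2//] /=; first by rewrite h1.
    by rewrite dotrNl h1.
have bS : bdd (hpoly lS) by exists C => x /SP[h /cone_bd]; rewrite h mulr1.
have [ws [uws wsP]] := vertex_seq lS.
have ws_cone w : w \in ws -> dotr eta w = 1 /\ rays gens [set 0] w.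
  by move=> /wsP/vertex_in/SP.
have cone_norm x : rays gens [set 0] x -> x != 0 -> 0 < dotr eta x /\
    hpoly lS ((dotr eta x)^-1 *: x).
  move=> hx x0; have ex : 0 < dotr eta x.
    rewrite -(pmulr_rgt0 _ C0); apply: lt_le_trans (cone_bd x hx); by rewrite normr_gt0.
  split=> //; apply/SP; rewrite dotrZr mulVf ?gt_eqF//; split=> //.
  by apply: rays_scale => //; rewrite invr_ge0 ltW.
have coneE : rays gens [set 0] = rays ws [set 0].
  apply/seteqP; split=> x.
  - move=> hx; have [->|x0] := eqVneq x 0; first exact: sub_rays.
    have [ex hS] := cone_norm x hx x0.
    rewrite (_ : x = dotr eta x *: ((dotr eta x)^-1 *: x)); last first.
      by rewrite scalerA mulfV ?gt_eqF// scale1r.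
    apply: rays_scale; first exact: ltW.
    move: hS; apply: bounded_hpoly_hull => //.
      by apply: convex_rays => y z t -> -> _ /=; rewrite !scaler0 addr0.
    by move=> w /wsP; exact: rays_self.
  - move=> h; have := @rays_absorb _ _ ws gens [set 0] (fun w hw => (ws_cone w hw).2); apply.
    by move: h; apply: rays_sub; exact: sub_rays.
exists ws, eta; split.
- rewrite TC; apply/seteqP; split=> x /rays_set1; first by rewrite coneE => h; apply/rays_set1.
  by rewrite -coneE => h; apply/rays_set1.
- by move=> w /ws_cone[-> _].
- move=> w wws; have [ew hw] := ws_cone w wws.
  have [u' [b' [ub' uE']]] := (wsP w).1 wws.
  have uw : dotr u' w = b' by have : [set w] w by []; rewrite -uE' => -[].
  (* As eta is 1 on the section, this is the homogeneous form of b' - u', which vanishes at w and is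
     positive at the other vertices. *)
  exists (b' *: eta - u'); split; first by rewrite dotrBl dotrZl ew mulr1 uw subrr.
  move=> w' w'ws ww'; have [ew' hw'] := ws_cone w' w'ws.
  have hS : hpoly lS w' by apply/SP.
  rewrite dotrBl dotrZl ew' mulr1 subr_gt0 lt_neqAle ub'// andbT.
  by apply: contra ww' => /eqP E; apply/eqP; have : [set w] w' by rewrite -uE'.
Qed.

Lemma convex_comb (A : set V) I (r : seq I) (b : I -> V) (lam : I -> R) x : convex A -> A x ->
  (forall i, A (x + b i)) -> (forall i, 0 <= lam i) -> \sum_(i <- r) lam i <= 1 ->
  A (x + \sum_(i <- r) lam i *: b i).
Proof.
move=> cA Ax Ab; elim: r lam => [|i r IH] lam lam0.
  by rewrite !big_nil addr0.
rewrite !big_cons => le1.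
have s0 : 0 <= \sum_(j <- r) lam j by apply: sumr_ge0.
have [m0|m0] := leP (1 - lam i) 0.
  have sE : \sum_(j <- r) lam j = 0 by lra.
  have li : lam i = 1 by lra.
  have -> : \sum_(j <- r) lam j *: b j = 0.
    elim: r {IH le1 s0} sE => [|j r IH]; first by rewrite !big_nil.
    rewrite !big_cons => /eqP; rewrite paddr_eq0 ?sumr_ge0// => /andP[/eqP -> /eqP/IH ->].
    by rewrite scale0r addr0.
  by rewrite li scale1r addr0; exact: Ab.
have := IH (fun j => lam j / (1 - lam i)) _ _.
rewrite -mulr_suml ler_pdivrMr// mul1r => H.
have {H}h1 : A (x + \sum_(j <- r) (lam j / (1 - lam i)) *: b j).
  by apply: H; [move=> j; rewrite divr_ge0// ltW|lra].
have := cA _ _ (lam i) (Ab i) h1; rewrite lam0 /= => /(_ _).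
have -> : lam i *: (x + b i) + (1 - lam i) *: (x + \sum_(j <- r) (lam j / (1 - lam i)) *: b j) =
    x + (lam i *: b i + \sum_(j <- r) lam j *: b j).
  rewrite !scalerDr addrACA -scalerDl [lam i + _]addrC subrK scale1r; congr (_ + (_ + _)).
  rewrite scaler_sumr; apply: eq_bigr => j _; rewrite scalerA; congr (_ *: _).
  by field; rewrite gt_eqF.
apply; lra.
Qed.

(** The barycentre of the simplex on the d + 1 points has all barycentric coordinates equal to 1 / N
    with N = d + 1. [invmx B] bounds the change of coordinates by the distance, and changes of at
    most 1 / N^2 in the d free coordinates keep them nonnegative with sum at most 1 - 1 / N^2. *)
Lemma full_dimensional_interior (P : set V) : convex P -> full_dimensional P ->
  exists (p0 : V) (e : R), 0 < e /\ forall x : V, (forall k, `|x 0 k - p0 0 k| <= e) -> P x.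
Proof.
move=> cP [x1 [B [Px1 PB rB]]].
have uB : B \in unitmx by rewrite -row_free_unit -row_leq_rank rB.
pose N := d.+1%:R : R; have N0 : 0 < N by rewrite ltr0n.
pose S := \sum_(k < d) \sum_(i < d) `|invmx B k i| + 1.
have S0 : 0 < S by rewrite ltr_wpDl// sumr_ge0// => k _; rewrite sumr_ge0.
pose p0 := x1 + \sum_(i <- enum 'I_d) N^-1 *: row i B.
exists p0, ((N * N)^-1 / S); split; first by rewrite divr_gt0// invr_gt0 mulr_gt0.
move=> x hx; pose c := (x - p0) *m invmx B.
have cb i : `|c 0 i| <= (N * N)^-1.
  rewrite /c mxE; apply: le_trans (ler_norm_sum _ _ _) _.
  apply: (@le_trans _ _ (\sum_(k < d) (N * N)^-1 / S * `|invmx B k i|)).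
    apply: ler_sum => k _; rewrite normrM ler_wpM2r//; have := hx k; by rewrite !mxE.
  rewrite -mulr_sumr -mulrA ler_piMr ?invr_ge0 ?mulr_ge0 ?(ltW N0)//.
  rewrite mulrC ler_pdivrMr// mul1r /S -[leLHS]addr0; apply: lerD => //.
  by apply: ler_sum => k _; rewrite (bigD1 i)//= lerDl sumr_ge0.
have xE : x = x1 + \sum_(i <- enum 'I_d) (N^-1 + c 0 i) *: row i B.
  have xc : x - p0 = \sum_i c 0 i *: row i B by rewrite -mulmx_sum_row /c mulmxKV.
  rewrite -[LHS](subrK p0) xc /p0 addrC -addrA; congr (_ + _).
  rewrite -[\sum_i _]big_enum /= -big_split /=; apply: eq_bigr => i _.
  by rewrite scalerDl.
rewrite xE; apply: convex_comb => //.
- move=> i; have := cb i; rewrite ler_norml => /andP[h _].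
  have : (N * N)^-1 <= N^-1 by rewrite lef_pV2 ?posrE ?mulr_gt0// ler_pMr// ler1n.
  by move=> h2; rewrite -lerBlDl sub0r (le_trans _ h)// lerN2.
- apply: (@le_trans _ _ (\sum_(i <- enum 'I_d) (N^-1 + (N * N)^-1))).
    by apply: ler_sum => i _; rewrite lerD2l; apply: le_trans (ler_norm _) (cb i).
  rewrite big_enum /= sumr_const card_ord -mulr_natl.
  have NE : d%:R = N - 1 by rewrite /N -natr1 addrK.
  rewrite NE; have -> : (N - 1) * (N^-1 + (N * N)^-1) = 1 - (N * N)^-1 by field; rewrite gt_eqF.
  by rewrite lerBlDr lerDl invr_ge0 mulr_ge0// ltW.
Qed.

Lemma open_polar_rays ws y : (forall w, w \in ws -> w != 0) ->
  open_polar (rays ws [set 0]) (- y) <-> forall w, w \in ws -> 0 < dotr y w.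
Proof.
move=> ws0; split=> [H w wws|H x hx x0].
- by have := H w (rays_self wws) (ws0 w wws); rewrite dotrNl oppr_lt0.
- have [C C0 HC] := norm_bound_exists (fun w hw _ => H w hw).
  rewrite dotrNl oppr_lt0 -(pmulr_rgt0 _ C0).
  by apply: lt_le_trans (norm_rays_bound HC hx); rewrite normr_gt0.
Qed.

End vertex_cones.

(** * Solid angles *)

Section lebesgue_affine.
Variable R : realType.
Local Open Scope ereal_scope.
Local Notation mu := (@lebesgue_measure R).
Local Notation RM := (measurableTypeR R).

Definition affine (x r : R) : RM -> RM := fun y => (x + r * y)%R.

Lemma measurable_affine (x r : R) : measurable_fun setT (affine x r).
Proof.
apply: continuous_measurable_fun => y.
by apply: cvgD; [exact: cvg_cst|apply: cvgM; [exact: cvg_cst|exact: cvg_id]].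
Qed.

Definition lebesgue_affine (x r : R) : {measure set RM -> \bar R}.
Proof.
by refine (pushforward mu (affine x r) : {measure set RM -> \bar R}); exact: measurable_affine.
Defined.

Lemma lebesgue_measure_affine (x r : R) (r0 : (0 < r)%R) (A : set RM) : measurable A ->
  mu A = mscale (NngNum (ltW r0)) (lebesgue_affine x r) A.
Proof.
move=> mA; apply: lebesgue_measure_unique => // _ [[a b] _ <-] /=.
rewrite /mscale /= /pushforward.
have -> : affine x r @^-1` `]a, b]%classic = `]((a - x) / r)%R, ((b - x) / r)%R]%classic.
  apply/seteqP; split=> y /=; rewrite !in_itv /= /affine ltr_pdivrMr// ler_pdivlMr// [(y * r)%R]mulrC.
    by rewrite ltrBlDl lerBrDl.
  by rewrite ltrBlDl lerBrDl.
have := @lebesgue_measure_itv R `]((a - x) / r)%R, ((b - x) / r)%R] => /= h2.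
have := @lebesgue_measure_itv R `]a, b] => /= h1.
apply: (eq_trans h1); rewrite h2 !lte_fin ltr_pM2r ?invr_gt0// ltrD2r.
case: ifP => _; last by rewrite mule0.
rewrite -!EFinB -EFinM; congr _%:E; rewrite /= -mulrBl opprB addrA subrK.
by rewrite mulrC divfK ?gt_eqF.
Qed.

Lemma ge0_integral_affine (x r : R) (f : RM -> \bar R) : (0 < r)%R ->
  measurable_fun setT f -> (forall y, 0 <= f y) ->
  \int[mu]_y f y = r%:E * \int[mu]_y f (x + r * y)%R.
Proof.
move=> r0 mf f0.
rewrite (eq_measure_integral (mscale (NngNum (ltW r0)) (lebesgue_affine x r))); last first.
  by move=> A mA _; exact: lebesgue_measure_affine.
rewrite ge0_integral_mscale//=; congr (_ * _).
by rewrite ge0_integral_pushforward//; exact: measurable_affine.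
Qed.

End lebesgue_affine.

(** Attaches a proof of sigma-finiteness to a bare measure, so that Tonelli's theorem, which expects
    the bundled structure, applies to [lebesgue_tuple]. *)
Definition with_sigma_finite (d : measure_display) (T : measurableType d) (R : realType)
  (m : {measure set T -> \bar R}) (mfin : sigma_finite setT m) : set T -> \bar R := m.

HB.instance Definition _ (d : measure_display) (T : measurableType d) (R : realType)
  (m : {measure set T -> \bar R}) (mfin : sigma_finite setT m) :=
  Measure.copy (with_sigma_finite mfin) m.

HB.instance Definition _ (d : measure_display) (T : measurableType d) (R : realType)
  (m : {measure set T -> \bar R}) (mfin : sigma_finite setT m) :=
  Measure_isSigmaFinite.Build _ _ _ (with_sigma_finite mfin) mfin.

Section lebesgue_tuple_tonelli.
Variable R : realType.
Local Open Scope ereal_scope.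
Local Notation mu := (@lebesgue_measure R).
Local Notation RM := (measurableTypeR R).
Local Notation T := (fun n : nat => n.-tuple RM).

Lemma sigma_finite_lebesgue_tuple n : sigma_finite setT (@lebesgue_tuple R n).
Proof.
elim: n => [|n IH].
  exists (fun=> setT); first by rewrite bigcup_const//; exists 0%N.
  by move=> _; split=> //=; rewrite /dirac indicE in_setT ltry.
pose M : {sigma_finite_measure set (T n) -> \bar R} := with_sigma_finite IH.
have /sigma_finiteP[F [TF ndF Foo]] := IH.
have /sigma_finiteP[G [TG ndG Goo]] := @sigma_finiteT _ _ _ mu.
(* The inverse of [tuple_of_pair], along which the exhaustion of the product is transported. *)
pose swap (t : T n.+1) : (T n * RM)%type := ([tuple of behead t], thead t).
have mswap : measurable_fun setT swap.
  by apply/measurable_fun_pairP; split; [exact: measurable_behead|exact: measurable_tnth].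
exists (fun k => swap @^-1` (F k `*` G k)).
  apply/seteqP; split=> // t _.
  have : (\bigcup_k F k) (swap t).1 by rewrite -TF.
  have : (\bigcup_k G k) (swap t).2 by rewrite -TG.
  move=> [i _ Gi] [j _ Fj]; exists (maxn j i) => //; split.
  - by move: Fj; exact/subsetPset/ndF/leq_maxl.
  - by move: Gi; exact/subsetPset/ndG/leq_maxr.
move=> k; have [mF Fk] := Foo k; have [mG Gk] := Goo k.
have mFG : measurable (F k `*` G k) by exact: measurableX.
split; first by rewrite -[X in measurable X]setTI; exact: mswap.
have -> : lebesgue_tuple R n.+1 (swap @^-1` (F k `*` G k)) = (M \x mu) (F k `*` G k).
  rewrite /= /pushforward; congr (product_measure1 _ _ _); apply/seteqP; split=> -[t y] /=.
    by rewrite /swap /tuple_of_pair /= theadE; have -> : [tuple of behead [the n.+1.-tuple RM of y :: t]] = t by apply: val_inj.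
  by rewrite /swap /tuple_of_pair /= theadE; have -> : [tuple of behead [the n.+1.-tuple RM of y :: t]] = t by apply: val_inj.
rewrite product_measure1E// lte_mul_pinfty// ge0_fin_numE//.
Qed.

Lemma integral_lebesgue_tupleS n (f : T n.+1 -> \bar R) : measurable_fun setT f ->
  (forall t, 0 <= f t) ->
  \int[lebesgue_tuple R n.+1]_t f t =
  \int[lebesgue_tuple R n]_t \int[mu]_y f [the n.+1.-tuple RM of y :: t].
Proof.
move=> mf f0; rewrite [LHS](ge0_integral_pushforward (measurable_tuple_of_pair (n := n)))//.
rewrite preimage_setT.
have mft : measurable_fun setT (f \o @tuple_of_pair R n).
  by apply: measurableT_comp => //; exact: measurable_tuple_of_pair.
exact: (@fubini_tonelli1 _ _ _ _ _ (with_sigma_finite (sigma_finite_lebesgue_tuple n)) mu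
  _ mft (fun z => f0 _)).
Qed.

Lemma measurable_integral_lebesgue n (f : T n.+1 -> \bar R) : measurable_fun setT f ->
  (forall t, 0 <= f t) ->
  measurable_fun setT (fun t : T n => \int[mu]_y f [the n.+1.-tuple RM of y :: t]).
Proof.
move=> mf f0.
have mft : measurable_fun setT (f \o @tuple_of_pair R n).
  by apply: measurableT_comp => //; exact: measurable_tuple_of_pair.
exact: (@measurable_fun_fubini_tonelli_F _ _ (T n) RM R mu _ mft (fun z => f0 _)).
Qed.

Definition affine_tuple n (x : 'I_n -> R) (r : R) (t : T n) : T n :=
  [tuple (x i + r * tnth t i)%R | i < n].

Lemma measurable_affine_tuple n x r : measurable_fun setT (@affine_tuple n x r).
Proof.
apply/measurable_fun_tnthP => i; rewrite (_ : _ \o _ = affine (x i) r \o (@tnth n RM)^~ i).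
  by apply: measurableT_comp; [exact: measurable_affine|exact: measurable_tnth].
by apply/funext => t; rewrite /= tnth_mktuple.
Qed.

Lemma ge0_integral_affine_tuple n x r (f : T n -> \bar R) : (0 < r)%R ->
  measurable_fun setT f -> (forall t, 0 <= f t) ->
  \int[lebesgue_tuple R n]_t f t =
  (r ^+ n)%:E * \int[lebesgue_tuple R n]_t f (affine_tuple x r t).
Proof.
move=> r0; elim: n x f => [|n IH] x f mf f0.
  rewrite expr0 mul1e; apply: eq_integral => t _; congr f.
  by rewrite (tuple0 t) (tuple0 (affine_tuple _ _ _)).
rewrite integral_lebesgue_tupleS// integral_lebesgue_tupleS//; last first.
  by apply: measurableT_comp => //; exact: measurable_affine_tuple.
rewrite (IH (fun i => x (lift ord0 i)))//; last 2 first.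
- exact: measurable_integral_lebesgue.
- by move=> t; apply: integral_ge0.
have maff := measurable_affine_tuple x r.
have mfa : measurable_fun setT (f \o @affine_tuple n.+1 x r) by apply: measurableT_comp.
under eq_integral => t _.
  rewrite (ge0_integral_affine (x ord0) r0)//; last first.
    by apply: measurableT_comp => //; exact: measurable_cons.
  under eq_integral => y _.
    rewrite (_ : f _ = (f \o @affine_tuple n.+1 x r) [the n.+1.-tuple RM of y :: t]); last first.
      rewrite /=; congr f; apply: eq_from_tnth => i.
      rewrite tnth_mktuple; case: (unliftP ord0 i) => [j|] ->.
        by rewrite !tnthS tnth_mktuple.
      by rewrite !tnth0.
    over.
  over.
rewrite ge0_integralZl//; last 3 first.
- exact: (measurable_integral_lebesgue mfa (fun t => f0 _)).
- by move=> t _; apply: integral_ge0 => y _; exact: f0.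
- by rewrite lee_fin ltW.
by rewrite muleA -EFinM -exprSr.
Qed.

End lebesgue_tuple_tonelli.

(** * Integrals of the l^p weight *)

Section weights.
Variable R : realType.
Local Notation mu := (@lebesgue_measure R).
Local Notation RM := (measurableTypeR R).
Implicit Types (a c p : R).

Lemma measurable_expR_comp d (T : measurableType d) (D : set T) (f : T -> R) :
  measurable_fun D f -> measurable_fun D (fun t => expR (f t)).
Proof. by move=> mf; apply: (measurableT_comp (f := @expR R)) => //; exact: measurable_expR. Qed.

Lemma exponential_le_pdf a t : 0 < a -> 0 <= t -> expR (- a * t) <= a^-1 * exponential_pdf a t.
Proof.
move=> a0 t0; rewrite /exponential_pdf patchE mem_set; last by rewrite /= in_itv /= andbT.
by rewrite mulrA mulVf ?gt_eqF// mul1r.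
Qed.

(** Comparison with the density of the exponential law, whose total integral is 1. *)
Lemma integral_pdf_bound a (D : set RM) (f : RM -> R) (k : R) : 0 < a -> measurable D ->
  measurable_fun D f -> 0 <= k ->
  (forall t, D t -> 0 <= f t <= k * (a^-1 * exponential_pdf a t)) ->
  (\int[mu]_(t in D) (f t)%:E < +oo)%E.
Proof.
move=> a0 mD mf k0 H.
apply: (@le_lt_trans _ _ (\int[mu]_t (k * (a^-1 * exponential_pdf a t))%:E)%E).
  apply: (@le_trans _ _ (\int[mu]_(t in D) (k * (a^-1 * exponential_pdf a t))%:E)%E).
    apply: ge0_le_integral => //.
    - by move=> t /H/andP[]; rewrite lee_fin.
    - exact/measurable_EFinP.
    - apply/measurable_EFinP; apply: measurable_funM; first exact: measurable_cst.
      apply: measurable_funM; first exact: measurable_cst.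
      exact: measurable_funTS (measurable_exponential_pdf a).
    - by move=> t /H/andP[_]; rewrite lee_fin.
  apply: ge0_subset_integral => //.
  - apply/measurable_EFinP; apply: measurable_funM; first exact: measurable_cst.
    apply: measurable_funM; first exact: measurable_cst.
    exact: measurable_exponential_pdf.
  - by move=> t _; rewrite lee_fin !mulr_ge0 ?invr_ge0 ?(ltW a0)// exponential_pdf_ge0// ltW.
under eq_integral do rewrite mulrA EFinM.
rewrite ge0_integralZl//=.
- by rewrite integral_exponential_pdf// mule1 ltry.
- apply/measurable_EFinP; exact: measurable_exponential_pdf.
- by move=> t _; rewrite lee_fin exponential_pdf_ge0// ltW.
- by rewrite lee_fin mulr_ge0// invr_ge0 ltW.
Qed.

(** As a real integral, [Gamma] would be 0 by default if the extended integral were infinite, so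
    positivity includes finiteness. The latter follows from t^q <= 1 + t <= 2 exp (t / 2). *)
Lemma Gamma_gt0 (q : R) : 0 <= q -> q <= 1 -> 0 < Gamma (q + 1).
Proof.
move=> q0 q1; rewrite /Gamma /Rintegral addrK.
have pw t : 0 <= t -> t `^ q <= 1 + t.
  move=> t0; have [t1|t1] := leP t 1.
    apply: (@le_trans _ _ 1); last by rewrite lerDl.
    have -> : 1 = 1 `^ q :> R by rewrite powR1.
    by apply: ge0_ler_powR; rewrite ?nnegrE.
  by apply: le_trans (ler1_powR (ltW t1) q1) _; rewrite lerDr.
have mpw : measurable_fun setT (fun t : RM => t `^ q : RM) by exact: measurable_powR.
have mf (D : set RM) : measurable_fun D (fun t : RM => (t `^ q * expR (- t) : R)).
  apply: measurable_funTS; apply: measurable_funM => //; apply: measurable_expR_comp.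
  exact: oppr_measurable.
apply: fine_gt0; apply/andP; split.
- apply: (@lt_le_trans _ _ (\int[mu]_(t in `[1%R, 2%R]) (expR (-2))%:E)%E).
    rewrite integral_cst//= (_ : mu `[1%R, 2%R]%classic = 1%E).
      by rewrite mule1 lte_fin expR_gt0.
    have := @lebesgue_measure_itv R `[1%R, 2%R] => /= ->.
    by rewrite lte_fin ltr1n -EFinB; congr _%:E; lra.
  apply: (@le_trans _ _ (\int[mu]_(t in `[1%R, 2%R]) (t `^ q * expR (- t))%:E)%E).
    apply: ge0_le_integral => //.
    - exact/measurable_EFinP.
    - move=> t; rewrite /= in_itv /= => /andP[t1 t2]; rewrite lee_fin -[leLHS]mul1r.
      apply: ler_pM; rewrite ?expR_ge0//; last by rewrite ler_expR lerN2.
      by rewrite -(powRr0 t); apply: ler_powR.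
  apply: ge0_subset_integral => //.
  - exact/measurable_EFinP.
  - by move=> t _; rewrite lee_fin mulr_ge0 ?powR_ge0 ?expR_ge0.
  - by move=> t; rewrite /= !in_itv /= andbT => /andP[t1 _]; rewrite (lt_le_trans ltr01).
- apply: (@integral_pdf_bound 2^-1 _ _ 2) => // t; rewrite /= in_itv /= andbT => t0.
  rewrite mulr_ge0 ?powR_ge0 ?expR_ge0//=.
  apply: (@le_trans _ _ (2 * expR (- 2^-1 * t))); last first.
    by rewrite ler_pM2l// exponential_le_pdf// ltW.
  have -> : expR (- t) = expR (- 2^-1 * t) * expR (- 2^-1 * t).
    by rewrite -expRD; congr expR; field.
  rewrite mulrA; apply: ler_wpM2r; first exact: expR_ge0.
  apply: le_trans (ler_wpM2r (expR_ge0 _) (pw t (ltW t0))) _.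
  have h : 1 + 2^-1 * t <= expR (2^-1 * t) by exact: expR_ge1Dx.
  rewrite mulNr expRN ler_pdivrMr ?expR_gt0//.
  lra.
Qed.

Lemma solid_angle_const_gt0 p : 1 <= p -> 0 < solid_angle_const p.
Proof.
move=> p1; have p0 : 0 < p by exact: lt_le_trans p1.
apply: powR_gt0; apply: mulr_gt0 => //; apply: Gamma_gt0; first by rewrite invr_ge0 ltW.
by rewrite invf_le1.
Qed.

Definition weight c p (y : RM) : R := expR (- c * `|y| `^ p).

Lemma measurable_weight c p : measurable_fun setT (weight c p).
Proof.
apply: measurable_expR_comp; apply: measurable_funM; first exact: measurable_cst.
apply: (measurableT_comp (f := fun t : RM => t `^ p : RM)); first exact: measurable_powR.
exact: normr_measurable.
Qed.

(** Finiteness: |y|^p >= |y| - 1 for p >= 1, so the weight is at most exp (c - c |y|). Positivity: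
    |y|^p <= 1 on [0, 1]. *)
Lemma weight_integral c p : 0 < c -> 1 <= p ->
  (0 < \int[mu]_y (weight c p y)%:E)%E /\ (\int[mu]_y (weight c p y)%:E < +oo)%E.
Proof.
move=> c0 p1; have p0 : 0 <= p by exact: le_trans p1.
have mw D : measurable_fun D (weight c p) by apply: measurable_funTS; exact: measurable_weight.
split.
- apply: (@lt_le_trans _ _ (\int[mu]_(t in `[0%R, 1%R]) (expR (- c))%:E)%E).
    rewrite integral_cst//= (_ : mu `[0%R, 1%R]%classic = 1%E).
      by rewrite mule1 lte_fin expR_gt0.
    have := @lebesgue_measure_itv R `[0%R, 1%R] => /= ->.
    by rewrite lte_fin ltr01 -EFinB subr0.
  apply: (@le_trans _ _ (\int[mu]_(t in `[0%R, 1%R]) (weight c p t)%:E)%E).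
    apply: ge0_le_integral => //.
    - exact/measurable_EFinP.
    - move=> t; rewrite /= in_itv /= => /andP[t1 t2]; rewrite lee_fin /weight ler_expR mulNr lerN2.
      rewrite ler_piMr ?(ltW c0)//; have -> : 1 = 1 `^ p :> R by rewrite powR1.
      by apply: ge0_ler_powR; rewrite ?nnegrE// ger0_norm.
  apply: ge0_subset_integral => //; first exact/measurable_EFinP.
  by move=> t _; rewrite lee_fin expR_ge0.
- apply: (@le_lt_trans _ _ (\int[mu]_y (expR c * expR (- c * `|y|))%:E)%E).
    apply: ge0_le_integral => //.
    - by move=> t _; rewrite lee_fin expR_ge0.
    - exact/measurable_EFinP.
    - apply/measurable_EFinP; apply: measurable_funM; first exact: measurable_cst.
      apply: measurable_expR_comp; apply: measurable_funM; first exact: measurable_cst.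
      exact: normr_measurable.
    - move=> y _; rewrite lee_fin /weight -expRD ler_expR !mulNr.
      rewrite lerNl opprD opprK addrC -{2}[c]mulr1 -mulrBr ler_pM2l//.
      have [y1|y1] := leP 1 `|y|; first by apply: le_trans (le1r_powR y1 p1); rewrite gerBl.
      by apply: le_trans (powR_ge0 _ _); rewrite subr_le0 ltW.
  rewrite ge0_symfun_integralT; last 3 first.
  + by move=> y; rewrite mulr_ge0// expR_ge0.
  + move=> y; apply: cvgM; first exact: cvg_cst.
    apply: (@continuous_comp _ _ _ (fun y => - c * `|y|) expR); last exact: continuous_expR.
    by apply: cvgM; [exact: cvg_cst|exact: norm_continuous].
  + by move=> y /=; rewrite normrN.
  rewrite lte_mul_pinfty//.
  have -> : [set x : R | 0 <= x] = `[0, +oo[%classic by apply/seteqP; split=> x /=; rewrite in_itv /= andbT.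
  apply: (@integral_pdf_bound c _ _ (expR c)); rewrite ?expR_ge0//.
    apply: measurable_funTS; apply: measurable_funM; first exact: measurable_cst.
    apply: measurable_expR_comp; apply: measurable_funM; first exact: measurable_cst.
    exact: normr_measurable.
  move=> t; rewrite /= in_itv /= andbT => t0; rewrite mulr_ge0 ?expR_ge0//= ger0_norm//.
  by rewrite ler_pM2l ?expR_gt0// exponential_le_pdf.
Qed.

Definition tuple_weight c p n (t : n.-tuple RM) : R := \prod_(i < n) weight c p (tnth t i).

Lemma measurable_tuple_weight c p n : measurable_fun setT (@tuple_weight c p n).
Proof.
apply: measurable_prod => i _.
by apply: (measurableT_comp (f := weight c p)); [exact: measurable_weight|exact: measurable_tnth].
Qed.

Lemma tuple_weight_ge0 c p n t : 0 <= @tuple_weight c p n t.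
Proof. by apply: prodr_ge0 => i _; exact: expR_ge0. Qed.

Lemma tuple_weight_integral c p n : 0 < c -> 1 <= p ->
  (0 < \int[lebesgue_tuple R n]_t (tuple_weight c p t)%:E < +oo)%E.
Proof.
move=> c0 p1; have [w0 woo] := weight_integral c0 p1.
elim: n => [|n /andP[IH0 IHoo]].
  rewrite /= integral_dirac//; last by apply/measurable_EFinP; exact: measurable_tuple_weight.
  by rewrite diracT mul1e /tuple_weight big_ord0 lte_fin ltr01 ltry.
rewrite integral_lebesgue_tupleS//; last 2 first.
- by apply/measurable_EFinP; exact: measurable_tuple_weight.
- by move=> t; rewrite lee_fin tuple_weight_ge0.
under eq_integral => t _.
  under eq_integral => y _.
    rewrite (_ : (tuple_weight c p _)%:E = (tuple_weight c p t)%:E * (weight c p y)%:E)%E; last first.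
      rewrite /tuple_weight big_ord_recl tnth0 mulrC EFinM.
      by under eq_bigr do rewrite tnthS.
    over.
  rewrite ge0_integralZl//=; last 3 first.
  - by apply/measurable_EFinP; exact: measurable_weight.
  - by move=> y _; rewrite lee_fin expR_ge0.
  - by rewrite lee_fin tuple_weight_ge0.
  over.
rewrite ge0_integralZr//=; last 3 first.
- by apply/measurable_EFinP; exact: measurable_tuple_weight.
- by move=> t _; rewrite lee_fin tuple_weight_ge0.
- exact: ltW.
by rewrite mule_gt0// lte_mul_pinfty ?ltW// ge0_fin_numE// ltW.
Qed.

End weights.

(** * Germs and solid angles of functions *)

Section germs.
Variables (R : realType) (V : lmodType R).
Implicit Types (psi phi : V -> R) (x t u : V) (us : seq V) (l : R).

(** r = 0 is excluded: a solid angle sees the directions at [x] and not the value there. *)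
Definition germ_value psi x t l := exists2 r0 : R, 0 < r0 & forall r : R, 0 < r <= r0 -> psi (x + r *: t) = l.

(** Fixing the sequence 1 / (n + 1) makes the germ a pointwise limit of measurable functions of t,
    see [measurable_germ]. *)
Definition germ psi x t : R := lim (psi (x + n.+1%:R^-1 *: t) @[n --> \oo]).

Lemma germ_value_cvg psi x t l (r : nat -> R) : germ_value psi x t l -> (forall n, 0 < r n) ->
  r n @[n --> \oo] --> 0 -> psi (x + r n *: t) @[n --> \oo] --> l.
Proof.
move=> [r0 r00 H] rpos /cvgrPdist_lt/(_ _ r00)[N _ HN].
apply: cvg_near_cst; exists N => // n Nn /=; apply: H; rewrite rpos /=.
by have := HN n Nn; rewrite /= sub0r normrN gtr0_norm// => /ltW.
Qed.

Lemma germ_valueP psi x t l : germ_value psi x t l ->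
  psi (x + n.+1%:R^-1 *: t) @[n --> \oo] --> l /\ germ psi x t = l.
Proof.
move=> H; have C : psi (x + n.+1%:R^-1 *: t) @[n --> \oo] --> l.
  apply: (@germ_value_cvg _ _ _ _ (fun n => n.+1%:R^-1)) => //.
  exact: cvg_harmonic.
by split=> //; exact: cvg_lim.
Qed.

Lemma germ_value_sub psi phi x y t l m : germ_value psi x t l -> germ_value phi y t m ->
  germ_value (fun z => psi z - phi (z - (x - y))) x t (l - m).
Proof.
move=> [r1 r10 H1] [r2 r20 H2]; exists (Num.min r1 r2); first by rewrite lt_min r10.
move=> r /andP[r0]; rewrite le_min => /andP[rr1 rr2].
have -> : x + r *: t - (x - y) = y + r *: t by rewrite opprB addrC addrA subrK.
by rewrite H1 ?H2 ?r0.
Qed.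

(** By convexity the r with x + r t in Q form an interval, so membership is constant for small r >
    0. *)
Lemma germ_value_ind (Q : set V) x t : convex Q -> exists l, germ_value (ind Q) x t l.
Proof.
move=> cQ; have [[r0 r00 H]|H] := pselect (exists2 r0 : R, 0 < r0 & forall r : R, 0 < r <= r0 -> Q (x + r *: t)).
  by exists 1, r0 => // r /H h; rewrite /ind mem_set.
have [[r1 r10 h1]|H1] := pselect (exists2 r1 : R, 0 < r1 & Q (x + r1 *: t)); last first.
  exists 0, 1 => // r /andP[r0 _]; rewrite /ind memNset// => h; by apply: H1; exists r.
have [[r2 r20 h2]|H2] := pselect (exists2 r2 : R, 0 < r2 & forall r : R, 0 < r <= r2 -> ~ Q (x + r *: t)).
  by exists 0, r2 => // r /h2 h; rewrite /ind memNset.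
case: H; exists r1 => // r /andP[r0 rr1].
have [r' [r'0 r'r hr']] : exists r', [/\ 0 < r', r' <= r & Q (x + r' *: t)].
  apply/not_existsP => h; apply: H2; exists r => // r' /andP[r'0 r'r] Qr'; by apply: (h r').
have E s : x + s *: t = x - s *: (- t) by rewrite scalerN opprK.
rewrite E; apply: (@convex_between _ _ Q x (- t) r' r1 r) => //; rewrite -?E//.
by rewrite r'r rr1.
Qed.

End germs.

Section angles.
Variables (R : realType) (p : R) (d : nat).
Hypothesis p1 : 1 <= p.
Local Notation V := 'rV[R]_d.
Local Notation mu := (@lebesgue_tuple R d).
Local Notation RM := (measurableTypeR R).
Local Notation c := (@solid_angle_const R p).
Local Notation W := (@tuple_weight R c p d).
Implicit Types (psi phi : V -> R) (x u : V) (us : seq V) (Q : set V) (t : d.-tuple RM).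

Let p0 : 0 < p. Proof. exact: lt_le_trans p1. Qed.
Let c0 : 0 < c. Proof. exact: solid_angle_const_gt0. Qed.

(** A class that contains the indicators of polyhedra and is stable under [diff], and on which solid
    angles are additive. *)
Definition good psi := [/\ exists M : R, forall x, `|psi x| <= M,
  forall x (v : V), exists l, germ_value psi x v l &
  forall x (r : R), measurable_fun setT (fun t : d.-tuple RM => psi (x + r *: rV_of_tuple t))].

(** The solid angle of a function in place of a set. [solid_angleE] identifies it with the limit
    defining [solid_angle]; functions, unlike sets, can be added and subtracted. *)
Definition angle psi x : R := \int[mu]_t (germ psi x (rV_of_tuple t) * W t).

Definition full_angle : R := \int[mu]_t (W t).

Lemma full_angle_gt0 : 0 < full_angle.
Proof. by apply: fine_gt0; exact: tuple_weight_integral. Qed.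

Lemma integrable_weight : mu.-integrable setT (EFin \o W).
Proof.
apply/integrableP; split; first by apply/measurable_EFinP; exact: measurable_tuple_weight.
under eq_integral do rewrite /= ger0_norm ?tuple_weight_ge0//.
by have /andP[] := @tuple_weight_integral R c p d c0 p1.
Qed.

Lemma measurable_germ psi x : good psi ->
  measurable_fun setT (fun t : d.-tuple RM => germ psi x (rV_of_tuple t)).
Proof.
move=> [_ gpsi mpsi].
apply: (@measurable_fun_cvg _ _ _ _ (fun n t => psi (x + n.+1%:R^-1 *: rV_of_tuple t))) => [n|t _].
  exact: mpsi.
by have [l /germ_valueP[h ->]] := gpsi x (rV_of_tuple t).
Qed.

Lemma germ_bound psi x t (M : R) : good psi -> (forall y, `|psi y| <= M) -> `|germ psi x (rV_of_tuple t)| <= M.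
Proof.
move=> [_ gpsi _] HM; have [l hl] := gpsi x (rV_of_tuple t); have [_ ->] := germ_valueP hl.
by have [r0 r00 /(_ r0)<-] := hl; [exact: HM|rewrite r00 lexx].
Qed.

Lemma integrable_germ psi x : good psi ->
  mu.-integrable setT (EFin \o (fun t => germ psi x (rV_of_tuple t) * W t)).
Proof.
move=> gpsi; have [[M HM] _ _] := gpsi.
apply: (@le_integrable _ _ _ _ _ measurableT _ (EFin \o (fun t => M * W t))).
- apply/measurable_EFinP; apply: measurable_funM; first exact: measurable_germ.
  exact: measurable_tuple_weight.
- move=> t _; rewrite lee_fin normrM [leRHS]ger0_norm.
    by rewrite (ger0_norm (tuple_weight_ge0 _ _ _)) ler_wpM2r ?tuple_weight_ge0// germ_bound.
  by rewrite mulr_ge0 ?tuple_weight_ge0// (le_trans _ (HM 0)).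
- rewrite (_ : EFin \o _ = (fun t => M%:E * (EFin \o W) t)%E); last by apply/funext => t; rewrite /= EFinM.
  by apply: integrableZl => //; exact: integrable_weight.
Qed.

Lemma good_shift_sub psi phi u : good psi -> good phi -> good (fun x => psi x - phi (x - u)).
Proof.
move=> [[M1 H1] g1 m1] [[M2 H2] g2 m2]; split.
- by exists (M1 + M2) => x; apply: le_trans (ler_normB _ _) _; apply: lerD.
- move=> x t; have [l hl] := g1 x t; have [m hm] := g2 (x - u) t; exists (l - m).
  by have := germ_value_sub hl hm; rewrite subKr.
- move=> x r; apply: measurable_funB; first exact: m1.
  by under eq_fun do rewrite addrAC; exact: m2.
Qed.

Lemma good_diff u psi : good psi -> good (diff u psi).
Proof. by move=> g; exact: good_shift_sub. Qed.

Lemma good_diffs us psi : good psi -> good (diffs us psi).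
Proof. by move=> g; elim: us => //= u us; exact: good_diff. Qed.

Lemma angle_shift_sub psi phi u x : good psi -> good phi ->
  angle (fun x => psi x - phi (x - u)) x = angle psi x - angle phi (x - u).
Proof.
move=> g1 g2; rewrite /angle -RintegralB//; [|exact: integrable_germ..].
apply: eq_Rintegral => t _; rewrite -mulrBl; congr (_ * _).
have [_ h1 _] := g1; have [_ h2 _] := g2.
have [l hl] := h1 x (rV_of_tuple t); have [m hm] := h2 (x - u) (rV_of_tuple t).
have := germ_value_sub hl hm; rewrite subKr => hlm.
by rewrite (germ_valueP hl).2 (germ_valueP hm).2 (germ_valueP hlm).2.
Qed.

Lemma angle_diffs us psi x : good psi -> angle (diffs us psi) x = diffs us (angle psi) x.
Proof.
move=> g; elim: us x => //= u us IH x.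
rewrite {1}/diff angle_shift_sub ?IH//; exact: good_diffs.
Qed.

Lemma goodB psi phi : good psi -> good phi -> good (fun x => psi x - phi x).
Proof. by move=> g1 g2; have := good_shift_sub 0 g1 g2; under [X in good X]eq_fun do rewrite subr0. Qed.

Lemma angleB psi phi x : good psi -> good phi ->
  angle (fun x => psi x - phi x) x = angle psi x - angle phi x.
Proof.
move=> g1 g2; have := angle_shift_sub 0 x g1 g2; rewrite subr0.
by under [X in angle X]eq_fun do rewrite subr0.
Qed.

Lemma angle_cst (k : R) psi x : (exists2 e : R, 0 < e & forall y, `|y - x| <= e -> psi y = k) ->
  angle psi x = k * full_angle.
Proof.
move=> [e e0 H]; rewrite -RintegralZl//; last exact: integrable_weight.
apply: eq_Rintegral => t _; congr (_ * _).
have h : germ_value psi x (rV_of_tuple t) k.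
  exists (e / (`|rV_of_tuple t| + 1)); first by rewrite divr_gt0// ltr_wpDl.
  move=> r /andP[r0]; rewrite ler_pdivlMr ?ltr_wpDl// => re; apply: H.
  rewrite addrAC subrr add0r normrZ gtr0_norm//; apply: le_trans re.
  by rewrite ler_pM2l// lerDl.
by rewrite (germ_valueP h).2.
Qed.

Lemma angle_ge0 psi x : good psi -> (forall y, 0 <= psi y) -> 0 <= angle psi x.
Proof.
move=> [_ g _] H; apply: Rintegral_ge0 => t _; rewrite mulr_ge0 ?tuple_weight_ge0//.
have [l hl] := g x (rV_of_tuple t); rewrite (germ_valueP hl).2.
by have [r0 r00 /(_ r0)<-] := hl; [exact: H|rewrite r00 lexx].
Qed.

Lemma angle_le psi x (M : R) : good psi -> (forall y, `|psi y| <= M) -> angle psi x <= M * full_angle.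
Proof.
move=> g H; rewrite -RintegralZl//; last exact: integrable_weight.
apply: le_Rintegral => //; first exact: integrable_germ.
- rewrite (_ : EFin \o _ = (fun t => M%:E * (EFin \o W) t)%E); last by apply/funext => t; rewrite /= EFinM.
  by apply: integrableZl => //; exact: integrable_weight.
- move=> t _; rewrite ler_wpM2r ?tuple_weight_ge0//.
  by apply: le_trans (ler_norm _) _; exact: germ_bound.
Qed.

End angles.

Lemma coord_le_norm (R : realType) (d : nat) (x : 'rV[R]_d) k : `|x 0 k| <= `|x|.
Proof.
rewrite [leRHS]mx_normrE; exact: (le_bigmax _ (fun ij : 'I_1 * 'I_d => `|x ij.1 ij.2|) (0, k)).
Qed.

Section solid_angle_germ.
Variables (R : realType) (p : R) (d : nat).
Hypothesis p1 : 1 <= p.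
Local Notation V := 'rV[R]_d.
Local Notation mu := (@lebesgue_tuple R d).
Local Notation RM := (measurableTypeR R).
Local Notation c := (@solid_angle_const R p).
Local Notation W := (@tuple_weight R c p d).
Implicit Types (x u : V) (Q : set V) (t : d.-tuple RM).

Let p0 : 0 < p. Proof. exact: lt_le_trans p1. Qed.
Let c0 : 0 < c. Proof. exact: solid_angle_const_gt0. Qed.

Lemma lp_norm_powR (x : V) : lp_norm p x `^ p = \sum_k `|x 0 k| `^ p.
Proof.
rewrite /lp_norm -powRrM mulVf ?gt_eqF// powRr1//.
by apply: sumr_ge0 => k _; exact: powR_ge0.
Qed.

Lemma tuple_weightE t : W t = expR (- c * \sum_k `|rV_of_tuple t 0 k| `^ p).
Proof.
rewrite mulr_sumr expR_sum; apply: eq_bigr => k _.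
by rewrite /weight mxE.
Qed.

(** The substitution t = x + e^(1/p) t' absorbs [e]: its Jacobian cancels the prefactor, and the
    exponent becomes that of the fixed weight. *)
Lemma solid_angle_scaled Q x (e : R) : 0 < e -> good (ind Q) ->
  (e `^ (d%:R / p))^-1 * \int[mu]_(t in @rV_of_tuple R d @^-1` Q)
      expR (- (c / e) * lp_norm p (rV_of_tuple t - x) `^ p) =
  \int[mu]_t (ind Q (x + (e `^ p^-1) *: rV_of_tuple t) * W t).
Proof.
move=> e0 [_ _ mQ]; set r := e `^ p^-1; have r0 : 0 < r by exact: powR_gt0.
pose f (t : d.-tuple RM) : R := ind Q (rV_of_tuple t) * expR (- (c / e) * lp_norm p (rV_of_tuple t - x) `^ p).
have mlp : measurable_fun setT (fun t : d.-tuple RM => lp_norm p (rV_of_tuple t - x) `^ p : R).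
  under eq_fun do rewrite lp_norm_powR.
  apply: measurable_sum => k.
  apply: (measurableT_comp (f := fun t : RM => t `^ p : RM)); first exact: measurable_powR.
  apply: (measurableT_comp (f := fun t : RM => `|t| : RM)); first exact: normr_measurable.
  rewrite (_ : (fun t => _) = (fun t : d.-tuple RM => (tnth t k : R) - x 0 k)); last first.
    by apply/funext => t; rewrite !mxE.
  by apply: measurable_funB; [exact: measurable_tnth|exact: measurable_cst].
have mindQ : measurable_fun setT (fun t : d.-tuple RM => ind Q (rV_of_tuple t)).
  have := mQ 0 1; rewrite (_ : (fun t => _) = (fun t : d.-tuple RM => ind Q (rV_of_tuple t)))//.
  by apply/funext => t; rewrite add0r scale1r.
have mf : measurable_fun setT f.
  apply: measurable_funM => //; apply: measurable_expR_comp.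
  by apply: measurable_funM; [exact: measurable_cst|].
have f0 t : 0 <= f t by rewrite mulr_ge0 ?expR_ge0// /ind ler0n.
have -> : \int[mu]_(t in @rV_of_tuple R d @^-1` Q) expR (- (c / e) * lp_norm p (rV_of_tuple t - x) `^ p) =
    \int[mu]_t f t.
  rewrite Rintegral_mkcond; apply: eq_Rintegral => t _; rewrite patchE /f /ind.
  have [h|h] := pselect (Q (rV_of_tuple t)); first by rewrite !mem_set// mul1r.
  by rewrite !memNset// mul0r.
rewrite /Rintegral (ge0_integral_affine_tuple (fun i => x 0 i) r0); last 2 first.
- exact/measurable_EFinP.
- by move=> t; rewrite lee_fin.
rewrite (_ : e `^ (d%:R / p) = r ^+ d); last first.
  by rewrite -powR_mulrn ?(ltW r0)// /r -powRrM mulrC.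
have rd0 : r ^+ d != 0 by rewrite expf_neq0// gt_eqF.
have E t : f (affine_tuple (fun i => x 0 i) r t) = ind Q (x + r *: rV_of_tuple t) * W t.
  rewrite /f tuple_weightE; have -> : rV_of_tuple (affine_tuple (fun i => x 0 i) r t) = x + r *: rV_of_tuple t :> V.
    by apply/rowP => i; rewrite !mxE tnth_mktuple.
  congr (_ * expR _); rewrite lp_norm_powR !mulr_sumr; apply: eq_bigr => k _.
  rewrite !mxE [x 0 k + _]addrC addrK normrM (gtr0_norm r0) powRM ?(ltW r0)//.
  by rewrite -powRrM mulVf ?gt_eqF// powRr1 ?(ltW e0)//; field; rewrite gt_eqF.
have -> : (\int[mu]_t (f (affine_tuple (fun i => x 0 i) r t))%:E)%E =
    (\int[mu]_t (ind Q (x + r *: rV_of_tuple t) * W t)%:E)%E.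
  by apply: eq_integral => t _; rewrite E.
(* At an infinite value both sides are 0, by the default value of [fine]. *)
set I := integral _ _ _; case: I => [I| |] /=.
- by rewrite mulKf.
- by rewrite gt0_muley ?lte_fin ?exprn_gt0//= mulr0.
- by rewrite gt0_muleNy ?lte_fin ?exprn_gt0//= mulr0.
Qed.

(** Dominated convergence with majorant [W]: along any sequence tending to 0 from the right, the
    rescaled indicators converge pointwise to the germ. *)
Lemma solid_angleE Q x : good (ind Q) -> solid_angle p Q x = angle p (ind Q) x.
Proof.
move=> gQ; apply/cvg_lim => //; apply/cvg_at_rightP => u [u0 ucvg].
under eq_fun do rewrite solid_angle_scaled//.
have [_ gv mQ] := gQ.
have int1 : mu.-integrable setT (EFin \o W) by exact: integrable_weight.
have ind01 y : `|ind Q y| <= 1 by rewrite /ind; case: (y \in Q); rewrite ?normr1 ?normr0.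
have bnd (psi : V -> R) t y : `|psi y| <= 1 -> (`|(psi y * W t)%:E| <= (W t)%:E)%E.
  move=> h; rewrite lee_fin normrM (ger0_norm (tuple_weight_ge0 _ _ _)).
  by rewrite ler_piMl// tuple_weight_ge0.
have mW : measurable_fun setT W by exact: measurable_tuple_weight.
have rcvg : u n `^ p^-1 @[n --> \oo] --> 0.
  apply/cvgrPdist_lt => e e0; have e1 : 0 < e `^ p by exact: powR_gt0.
  move/cvgrPdist_lt : ucvg => /(_ _ e1)[N _ HN]; exists N => // n Nn /=.
  have := HN n Nn; rewrite /= !sub0r !normrN gtr0_norm// gtr0_norm ?powR_gt0// => h.
  have -> : e = (e `^ p) `^ p^-1 by rewrite -powRrM mulfV ?gt_eqF// powRr1 ?(ltW e0).
  by apply: gt0_ltr_powR; rewrite ?invr_gt0// nnegrE ?powR_ge0// ltW.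
have D := @dominated_cvg _ _ _ mu setT measurableT
  (fun n t => (ind Q (x + (u n `^ p^-1) *: rV_of_tuple t) * W t)%:E)
  (fun t => (germ (ind Q) x (rV_of_tuple t) * W t)%:E) (EFin \o W).
have {}D : (\int[mu]_t (ind Q (x + (u n `^ p^-1) *: rV_of_tuple t) * W t)%:E)%E @[n --> \oo] -->
    (\int[mu]_t (germ (ind Q) x (rV_of_tuple t) * W t)%:E)%E.
  apply: D => //.
  - by move=> n; apply/measurable_EFinP; apply: measurable_funM.
  - move=> t _; apply: cvg_EFin; first by near=> n.
    apply: cvgMl; have [l hl] := gv x (rV_of_tuple t); rewrite (germ_valueP hl).2.
    by apply: (germ_value_cvg hl) => // n; exact: powR_gt0.
  - by move=> n t _; exact: bnd.
apply: fine_cvg; rewrite /angle /Rintegral fineK//.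
exact: integrable_fin_num (integrable_germ p1 x gQ).
Unshelve. all: by end_near. Qed.

Lemma measurable_hpoly_ind (l : seq (V * R)) x (r : R) :
  measurable_fun setT (fun t : d.-tuple RM => ind (hpoly l) (x + r *: rV_of_tuple t)).
Proof.
have mset : measurable [set t : d.-tuple RM | hpoly l (x + r *: rV_of_tuple t)].
  elim: l => [|a l IH].
    by rewrite (_ : [set _ | _] = setT)//; apply/seteqP; split.
  rewrite (_ : [set _ | _] = [set t : d.-tuple RM | dotr a.1 (x + r *: rV_of_tuple t) <= a.2] `&`
      [set t : d.-tuple RM | hpoly l (x + r *: rV_of_tuple t)]); last first.
    apply/seteqP; split=> t.
    - move=> h; split; first by apply: h; exact: mem_head.
      by move=> b bl; apply: h; rewrite inE bl orbT.
    - by move=> [h1 h2] b; rewrite inE => /predU1P[->//|/h2].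
  apply: measurableI => //.
  have mg : measurable_fun setT (fun t : d.-tuple RM => dotr a.1 (x + r *: rV_of_tuple t) : RM).
    apply: measurable_sum => k; apply: measurable_funM; first exact: measurable_cst.
    rewrite (_ : (fun t => _) = (fun t : d.-tuple RM => x 0 k + r * (tnth t k : R))); last first.
      by apply/funext => t; rewrite !mxE.
    apply: measurable_funD; first exact: measurable_cst.
    by apply: measurable_funM; [exact: measurable_cst|exact: measurable_tnth].
  rewrite (_ : [set _ | _] = setT `&` (fun t : d.-tuple RM => dotr a.1 (x + r *: rV_of_tuple t) : RM) @^-1` `]-oo, a.2]%classic).
    by apply: mg => //; exact: measurable_itv.
  by rewrite setTI; apply/seteqP; split=> t /=; rewrite in_itv.
rewrite (_ : (fun t => _) = \1_[set t : d.-tuple RM | hpoly l (x + r *: rV_of_tuple t)]).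
  exact: measurable_indic.
by apply/funext => t; rewrite indicE /ind; congr (_%:R); congr nat_of_bool; apply/idP/idP; rewrite !inE.
Qed.

Lemma good_ind_hpoly (l : seq (V * R)) : good (ind (hpoly l)).
Proof.
split.
- by exists 1 => x; rewrite /ind; case: (x \in _); rewrite ?normr1 ?normr0.
- by move=> x v; apply: germ_value_ind; exact: hpoly_convex.
- exact: measurable_hpoly_ind.
Qed.

(** A polyhedron is closed, so its indicator vanishes around [x]. Hence a series of angles over the
    whole lattice has the same terms as [alpha]. *)
Lemma angle_notin_hpoly (l : seq (V * R)) x : ~ hpoly l x -> angle p (ind (hpoly l)) x = 0.
Proof.
move=> /existsNP[a /not_implyP[al /negP]]; rewrite -ltNge => ax.
rewrite -[RHS](mul0r (full_angle p d)); apply: angle_cst => //.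
pose K := \sum_k `|a.1 0 k| + 1; have K0 : 0 < K by rewrite ltr_wpDl// sumr_ge0.
exists ((dotr a.1 x - a.2) / 2 / K); first by rewrite !divr_gt0// subr_gt0.
move=> y yx; rewrite /ind memNset// => /(_ a al); apply/negP; rewrite -ltNge.
have : `|dotr a.1 (y - x)| <= (dotr a.1 x - a.2) / 2.
  apply: (@le_trans _ _ (K * ((dotr a.1 x - a.2) / 2 / K))); last by rewrite mulrC divfK// gt_eqF.
  apply: le_trans (ler_norm_sum _ _ _) _; apply: (@le_trans _ _ (K * `|y - x|)); last by rewrite ler_pM2l.
  rewrite /K mulrDl mul1r mulr_suml ler_wpDr//; apply: ler_sum => k _.
  rewrite normrM ler_wpM2l//.
  exact: coord_le_norm.
by rewrite dotrBr ler_norml => /andP[h _]; lra.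
Qed.

End solid_angle_germ.

(** * Unconditional sums over the lattice *)

Lemma ler_sum_subset (R : realType) (I : eqType) (F : I -> R) (s s' : seq I) :
  (forall i, 0 <= F i) -> uniq s -> {subset s <= s'} ->
  \sum_(i <- s) F i <= \sum_(i <- s') F i.
Proof.
move=> F0; elim: s s' => [|a s IH] s' /=; first by rewrite big_nil sumr_ge0.
case/andP => asN us ss'; have as' : a \in s' by apply: ss'; rewrite mem_head.
rewrite (perm_big _ (perm_to_rem as')) !big_cons lerD2l; apply: IH => // i si.
have := ss' i; rewrite (perm_mem (perm_to_rem as')) !inE si orbT => /(_ isT) /orP[/eqP ia|//].
by rewrite -ia si in asN.
Qed.

Section has_sum.
Variables (R : realType) (I : choiceType).
Implicit Types (x y : I -> R[i]) (l : R[i]) (A B : seq I).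
Local Arguments normc : simpl never.

Definition has_sum x l := forall e : R, 0 < e -> exists A0 : seq I, forall A,
  uniq A -> {subset A0 <= A} -> normc (\sum_(i <- A) x i - l) < e.

Lemma family_sumE x l : has_sum x l -> family_sum x = l.
Proof.
move=> H; apply: (@cvg_lim _ _ _ _ summability.totally_filter); first exact: norm_hausdorff.
move=> U /nbhs_normcP[e e0 He]; have [A0 HA] := H e e0.
exists [fset i in A0]%fset => // A /= A0A; apply: He; rewrite /summability.partial_sum.
rewrite -(big_seq_fsetE _ A xpredT x) /=; apply: HA; first exact: fset_uniq.
by move=> i iA; apply: (fsubsetP A0A); rewrite inE.
Qed.

Lemma has_sum_unique x l l' : has_sum x l -> has_sum x l' -> l = l'.
Proof. by move=> /family_sumE <- /family_sumE. Qed.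

Lemma eq_has_sum x y l : x =1 y -> has_sum x l -> has_sum y l.
Proof. by move=> /funext ->. Qed.

Lemma has_sum_finite x A : uniq A -> (forall i, i \notin A -> x i = 0) ->
  has_sum x (\sum_(i <- A) x i).
Proof.
move=> uA x0 e e0; exists A => B uB AB.
suff -> : \sum_(i <- B) x i = \sum_(i <- A) x i by rewrite subrr normc0.
rewrite (bigID (fun i => i \in A)) /= [X in _ + X]big1 ?addr0 => [|i /x0//].
rewrite -big_filter; apply: perm_big; apply: uniq_perm => //; first exact: filter_uniq.
move=> i; rewrite mem_filter; apply/andP/idP => [[]//|iA]; split=> //; exact: AB.
Qed.

Lemma has_sum_reindex x l (f g : I -> I) : cancel f g -> cancel g f ->
  has_sum x l -> has_sum (x \o f) l.
Proof.
move=> fK gK H e e0; have [A0 HA] := H e e0.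
exists (map g A0) => A uA AA; rewrite -(big_map f xpredT x); apply: HA.
  by rewrite map_inj_uniq//; apply: can_inj fK.
by move=> i iA; rewrite -(gK i) map_f//; apply: AA; rewrite map_f.
Qed.

Lemma has_sum_subZ x y l k (a : R[i]) : has_sum x l -> has_sum y k ->
  has_sum (fun i => x i - a * y i) (l - a * k).
Proof.
move=> Hx Hy e e0; have a0 : 0 < normc a + 1 by rewrite ltr_wpDl// normc_ge0.
have [A0 HA] := Hx (e / 2) ltac:(by rewrite divr_gt0).
have [B0 HB] := Hy (e / 2 / (normc a + 1)) ltac:(by rewrite !divr_gt0).
exists (A0 ++ B0) => A uA AA; rewrite sumrB -mulr_sumr.
have {}HA : normc (\sum_(i <- A) x i - l) < e / 2.
  by apply: HA => // i iA; apply: AA; rewrite mem_cat iA.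
have {}HB : normc (\sum_(i <- A) y i - k) < e / 2 / (normc a + 1).
  by apply: HB => // i iA; apply: AA; rewrite mem_cat iA orbT.
set X := \sum_(i <- A) x i in HA *; set Y := \sum_(i <- A) y i in HB *.
have -> : X - a * Y - (l - a * k) = (X - l) + - (a * (Y - k)) by ring.
apply: le_lt_trans (le_normcD _ _) _; rewrite normcN normcM (splitr e).
apply: ltr_leD => //; apply: (@le_trans _ _ ((normc a + 1) * (e / 2 / (normc a + 1)))).
  by apply: ler_pM; rewrite ?normc_ge0 ?ltW// ltrDl.
by rewrite mulrC divfK ?gt_eqF.
Qed.

Definition sums_bounded (b : I -> R) (M : R) := forall A, uniq A -> \sum_(i <- A) b i <= M.

Lemma sums_sup (b : I -> R) (M : R) : (forall i, 0 <= b i) -> sums_bounded b M ->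
  exists L : R, forall e : R, 0 < e -> exists2 A0, uniq A0 & forall A,
    uniq A -> {subset A0 <= A} -> L - e < \sum_(i <- A) b i <= L.
Proof.
move=> b0 bM; pose S := [set t : R | exists2 A, uniq A & t = \sum_(i <- A) b i].
have hS : has_sup S.
  split; first by exists 0; exists [::] => //; rewrite big_nil.
  by exists M => _ [A uA ->]; apply: bM.
exists (sup S) => e e0; have [_ [A0 uA ->] ltA] := sup_adherent e0 hS.
exists A0 => // A uA' AA; apply/andP; split; last first.
  by apply: sup_upper_bound => //; exists A.
by apply: lt_le_trans ltA _; apply: ler_sum_subset.
Qed.

(** [A0] depends on the majorant [b] only and works for all families dominated by [b] at once.
    [wall_denominator] needs this uniformity, as its point s varies. *)
Lemma sums_tail (b : I -> R) (M e : R) : (forall i, 0 <= b i) -> sums_bounded b M -> 0 < e ->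
  exists2 A0, uniq A0 & forall A, uniq A -> {subset A0 <= A} ->
    forall x l, (forall i, normc (x i) <= b i) -> has_sum x l ->
    normc (\sum_(i <- A) x i - l) <= e.
Proof.
move=> b0 bM e0; have [L HL] := sums_sup b0 bM.
have [A0 uA0 HA0] := HL _ e0; exists A0 => // A uA AA x l xb Hx.
apply/ler_addgt0Pr => r r0; have [B0 HB0] := Hx _ r0.
pose B := [seq i <- undup B0 | i \notin A].
have uAB : uniq (A ++ B).
  rewrite cat_uniq uA filter_uniq ?undup_uniq// andbT /=.
  by apply/hasPn => i; rewrite mem_filter => /andP[].
have subAB : {subset B0 <= A ++ B}.
  by move=> i iB; rewrite mem_cat mem_filter mem_undup iB andbT orbN.
have := HB0 _ uAB subAB; rewrite big_cat /=.
set X := \sum_(i <- A) _; set Y := \sum_(i <- B) _ => HXY.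
have -> : X - l = (X + Y - l) + - Y by ring.
apply: le_trans (le_normcD _ _) _; rewrite normcN addrC; apply: lerD (ltW HXY).
apply: le_trans (normc_sum _ _ _) _.
apply: (@le_trans _ _ (\sum_(i <- B) b i)); first by apply: ler_sum.
have /andP[_] := HA0 _ uAB ltac:(by move=> i /AA iA; rewrite mem_cat iA).
have /andP[+ _] := HA0 A uA AA; rewrite big_cat /=.
set s1 := \sum_(i <- A) _; set s2 := \sum_(i <- B) _ => *; lra.
Qed.

Lemma has_sum_bounded x (b : I -> R) (M : R) : (forall i, normc (x i) <= b i) ->
  sums_bounded b M -> exists l, has_sum x l.
Proof.
move=> xb bM; have b0 i : 0 <= b i by apply: le_trans (xb i); apply: normc_ge0.
have bM2 (y : I -> R) : (forall i, `|y i| <= b i) -> sums_bounded (fun i => y i + b i) (M + M).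
  move=> yb A uA; rewrite big_split; apply: lerD; last exact: bM.
  apply: le_trans (bM _ uA); apply: ler_sum => i _; exact: le_trans (ler_norm _) (yb i).
have y0 (y : I -> R) : (forall i, `|y i| <= b i) -> forall i, 0 <= y i + b i.
  by move=> yb i; have := yb i; rewrite ler_norml => /andP[]; lra.
have Reb i : `|complex.Re (x i)| <= b i by apply: le_trans (xb i); apply: normc_Re.
have Imb i : `|complex.Im (x i)| <= b i by apply: le_trans (xb i); apply: normc_Im.
have [L1 H1] := sums_sup (y0 _ Reb) (bM2 _ Reb).
have [L2 H2] := sums_sup (y0 _ Imb) (bM2 _ Imb).
have [L3 H3] := sums_sup b0 bM.
(* Adding [b] made the real and imaginary parts nonnegative, so that suprema of finite sums exist;
   the sum of [b] is subtracted again. *)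
exists ((L1 - L3) +i* (L2 - L3)) => e e0.
have e5 : 0 < e / 5 by rewrite divr_gt0.
have [A1 _ {}H1] := H1 _ e5; have [A2 _ {}H2] := H2 _ e5; have [A3 _ {}H3] := H3 _ e5.
exists (A1 ++ A2 ++ A3) => A uA AA.
apply: le_lt_trans (normc_le _) _.
have /andP[] := H1 A uA ltac:(by move=> i iA; apply: AA; rewrite !mem_cat iA).
have /andP[] := H2 A uA ltac:(by move=> i iA; apply: AA; rewrite !mem_cat iA ?orbT).
have /andP[] := H3 A uA ltac:(by move=> i iA; apply: AA; rewrite !mem_cat iA ?orbT).
rewrite !raddfB !raddf_sum /= !big_split /=.
set u := \sum_(i <- A) b i; set r := \sum_(i <- A) complex.Re _; set t := \sum_(i <- A) complex.Im _.
move=> h1 h2 h3 h4 h5 h6.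
have : `|r + (- L1 - - L3)| <= e / 5 + e / 5 by rewrite ler_norml; apply/andP; split; lra.
have : `|t + (- L2 - - L3)| <= e / 5 + e / 5 by rewrite ler_norml; apply/andP; split; lra.
lra.
Qed.

End has_sum.

(** * Exponential sums over the lattice *)

Section sums_bounded.
Variable R : realType.

Lemma sums_bounded_fibers (I J : choiceType) (F : I -> R) (g : I -> J) (h : J -> R) (C D : R) :
  0 <= C -> (forall n A, uniq A -> (forall m, m \in A -> g m = n) -> \sum_(m <- A) F m <= C * h n) ->
  sums_bounded h D -> sums_bounded F (C * D).
Proof.
move=> C0 HF hD A uA; set B := undup (map g A).
have -> : \sum_(m <- A) F m = \sum_(n <- B) \sum_(m <- A | g m == n) F m.
  rewrite (exchange_big_dep xpredT)//= big_seq [RHS]big_seq; apply: eq_bigr => m mA.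
  rewrite (big_rem (g m)) ?mem_undup ?map_f//= eqxx big_seq_cond big1 ?addr0// => n.
  by rewrite rem_filter ?undup_uniq// mem_filter /= => /andP[/andP[+ _] /eqP gn]; rewrite gn eqxx.
apply: (@le_trans _ _ (\sum_(n <- B) C * h n)); last first.
  by rewrite -mulr_sumr ler_wpM2l// hD// undup_uniq.
apply: ler_sum => n _; rewrite -big_filter; apply: HF; first exact: filter_uniq.
by move=> m; rewrite mem_filter => /andP[/eqP].
Qed.

Lemma sums_bounded_scale (I : choiceType) (F G : I -> R) (K M : R) : 0 <= K ->
  (forall i, F i <= K * G i) -> sums_bounded G M -> sums_bounded F (K * M).
Proof.
move=> K0 FG GM A uA; apply: (@le_trans _ _ (K * \sum_(i <- A) G i)).
  by rewrite mulr_sumr; apply: ler_sum.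
by apply: ler_wpM2l => //; exact: GM.
Qed.

(** A finite set of rows lies in a finite grid, over which the sum of the products is the product of
    the sums. *)
Lemma sums_bounded_prod (I : choiceType) d (F : 'I_d -> I -> R) (C : R) :
  (forall k n, 0 <= F k n) -> (forall k, sums_bounded (F k) C) ->
  sums_bounded (fun m : 'rV[I]_d => \prod_k F k (m 0 k)) (C ^+ d).
Proof.
move=> F0 FC A uA; pose S := undup [seq (m : 'rV[I]_d) 0 k | m <- A, k <- enum 'I_d].
pose row (f : {ffun 'I_d -> seq_sub S}) : 'rV[I]_d := \row_k val (f k).
apply: (@le_trans _ _ (\sum_(m <- map row (index_enum {ffun 'I_d -> seq_sub S})) \prod_k F k (m 0 k))).
  apply: ler_sum_subset => // [m|m mA]; first exact: prodr_ge0.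
  have H k : m 0 k \in S.
    by rewrite mem_undup; apply/allpairsP; exists (m, k); rewrite mem_enum.
  apply/mapP; exists [ffun k => SeqSub (H k)]; first exact: mem_index_enum.
  by apply/rowP => k; rewrite mxE ffunE.
rewrite big_map (eq_bigr (fun f : {ffun 'I_d -> seq_sub S} => \prod_k F k (val (f k)))); last first.
  by move=> f _; apply: eq_bigr => k _; rewrite mxE.
rewrite -(bigA_distr_bigA (fun k (j : seq_sub S) => F k (val j))).
rewrite -[d in X in _ <= X]card_ord -prodr_const; apply: ler_prod => k _.
rewrite sumr_ge0//= -(big_map val xpredT (F k)); apply: FC.
by rewrite map_inj_uniq ?index_enum_uniq//; apply: val_inj.
Qed.

Lemma expR_sub_ge (x : R) : x * expR (- x) <= 1 - expR (- x).
Proof.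
have := expR_ge1Dx x; have := expR_gt0 (- x); have := expRxMexpNx_1 x.
set a := expR x; set b := expR (- x) => ab b0 h.
have : (1 + x) * b <= a * b by rewrite ler_pM2r.
rewrite ab; lra.
Qed.

(* Twice a Laplace distribution function: its increments over unit steps dominate the
   exponential, so that the sums over the integers telescope. *)
Definition laplace_cdf (kap b t : R) :=
  if t <= b then expR (- (kap * (b - t))) else 2 - expR (- (kap * (t - b))).

Lemma laplace_cdf_bound (kap b t : R) : 0 < kap -> 0 <= laplace_cdf kap b t <= 2.
Proof.
move=> k0; have e1 x : 0 <= x -> 0 < expR (- (kap * x)) <= 1.
  by move=> x0; rewrite expR_gt0 -[leRHS]expR0 ler_expR oppr_le0 mulr_ge0// ltW.
rewrite /laplace_cdf; case: (leP t b) => tb.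
  by have /andP[] := e1 (b - t) ltac:(lra); lra.
by have /andP[] := e1 (t - b) ltac:(lra); lra.
Qed.

Lemma laplace_cdf_incr (kap b t : R) : 0 < kap -> expR (- (kap * `|t - b|)) <=
  expR kap / kap * (laplace_cdf kap b (t + 1) - laplace_cdf kap b t).
Proof.
move=> k0; rewrite -ler_pdivrMl ?divr_gt0 ?expR_gt0// invf_div -expRN -mulrA.
have e0 : 0 < expR (- kap) by exact: expR_gt0.
have e1 : expR (- kap) <= 1 by rewrite -[leRHS]expR0 ler_expR; lra.
have main : kap * expR (- kap) <= 1 - expR (- kap) by exact: expR_sub_ge.
rewrite /laplace_cdf; case: (leP (t + 1) b) => t1b.
- have -> : t <= b by lra.
  have -> : `|t - b| = b - t by rewrite ler0_norm; lra.
  have -> : - (kap * (b - t)) = - (kap * (b - (t + 1))) + - kap by ring.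
  rewrite expRD; set x := expR (- (kap * (b - (t + 1)))).
  have x0 : 0 < x by exact: expR_gt0.
  apply: (@le_trans _ _ (x * (kap * expR (- kap)))); last first.
    apply: (@le_trans _ _ (x * (1 - expR (- kap)))); first by rewrite ler_pM2l.
    by rewrite mulrBr mulr1.
  have -> : kap * (expR (- kap) * (x * expR (- kap))) = x * (kap * expR (- kap)) * expR (- kap) by ring.
  by rewrite -[leRHS]mulr1; apply: ler_wpM2l => //; rewrite !mulr_ge0// ltW.
- case: (leP t b) => tb.
    (* The peak b lies between t and t + 1: the increment is (1 - exp (- kap (b - t))) + (1 - exp (-
       kap (t + 1 - b))), and [expR_sub_ge] bounds both parts from below. *)
    have -> : `|t - b| = b - t by rewrite ler0_norm; lra.
    have h1 := expR_sub_ge (kap * (b - t)); have h2 := expR_sub_ge (kap * (t + 1 - b)).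
    have m x : x <= 1 -> expR (- kap) <= expR (- (kap * x)).
      by move=> x1; rewrite ler_expR lerN2 -[leRHS]mulr1 ler_pM2l.
    have m1 := m (b - t) ltac:(lra); have m2 := m (t + 1 - b) ltac:(lra).
    have m3 : expR (- (kap * (b - t))) <= 1.
      by rewrite -[leRHS]expR0 ler_expR oppr_le0 mulr_ge0//; [exact: ltW|lra].
    have g1 : kap * (b - t) * expR (- kap) <= 1 - expR (- (kap * (b - t))).
      by apply: le_trans h1; apply: ler_wpM2l => //; apply: mulr_ge0; [exact: ltW|lra].
    have g2 : kap * (t + 1 - b) * expR (- kap) <= 1 - expR (- (kap * (t + 1 - b))).
      by apply: le_trans h2; apply: ler_wpM2l => //; apply: mulr_ge0; [exact: ltW|lra].
    apply: (@le_trans _ _ (kap * expR (- kap))); last by move: g1 g2; nra.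
    by apply: ler_wpM2l; [exact: ltW|]; rewrite -[leRHS]mulr1; apply: ler_wpM2l => //; exact: ltW.
  have -> : `|t - b| = t - b by rewrite ger0_norm; lra.
  have -> : - (kap * (t + 1 - b)) = - (kap * (t - b)) + - kap by ring.
  rewrite expRD; set x := expR (- (kap * (t - b))).
  have x0 : 0 < x by exact: expR_gt0.
  have -> : 2 - x * expR (- kap) - (2 - x) = x * (1 - expR (- kap)) by ring.
  have -> : kap * (expR (- kap) * x) = x * (kap * expR (- kap)) by ring.
  by rewrite ler_pM2l.
Qed.

(** Telescoping increments of [laplace_cdf], whose values lie in [0, 2]. The bound is uniform in [b]
    and of order 1 / kap as kap tends to 0; the latter is the origin of the 1 / tau in
    [near_wall_bound]. *)
Lemma sums_bounded_exp_dist (kap b : R) : 0 < kap ->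
  sums_bounded (fun n : int => expR (- (kap * `|n%:~R - b|))) (2 * (expR kap / kap)).
Proof.
move=> k0 A uA; pose N := (\sum_(n <- A) absz n)%N.
have AN n : n \in A -> (absz n <= N)%N by move=> nA; rewrite /N (big_rem n)//= leq_addr.
pose f (j : nat) : int := j%:Z - N%:Z.
apply: (@le_trans _ _ (\sum_(n <- map f (iota 0 (2 * N).+1)) expR (- (kap * `|n%:~R - b|)))).
  apply: ler_sum_subset => // n nA.
  have := AN n nA => H; apply/mapP; exists (absz (n + N%:Z)); last by rewrite /f; lia.
  by rewrite mem_iota; lia.
rewrite big_map.
pose G j := expR kap / kap * laplace_cdf kap b (j%:R - N%:R).
apply: (@le_trans _ _ (\sum_(0 <= j < (2 * N).+1) (G j.+1 - G j))).
  rewrite /index_iota subn0; apply: ler_sum => j _; rewrite /G -mulrBr.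
  have -> : (j.+1%:R - N%:R : R) = (f j)%:~R + 1 by rewrite /f intrB -natr1 !pmulrn; ring.
  have -> : (j%:R - N%:R : R) = (f j)%:~R by rewrite /f intrB !pmulrn.
  exact: laplace_cdf_incr.
rewrite telescope_sumr// /G -mulrBr mulrC ler_pM2r; last by rewrite divr_gt0// expR_gt0.
have /andP[h1 h2] := laplace_cdf_bound b (0%:R - N%:R) k0.
have /andP[h3 h4] := laplace_cdf_bound b ((2 * N).+1%:R - N%:R) k0.
lra.
Qed.

Lemma lattice_sum_bound d (kap : R) (b : 'rV[R]_d) : 0 < kap ->
  sums_bounded (fun m : 'rV[int]_d => expR (- (kap * \sum_k `|lattice_point R m 0 k - b 0 k|)))
    ((2 * (expR kap / kap)) ^+ d).
Proof.
move=> k0 A uA.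
have := sums_bounded_prod (fun k n => expR_ge0 _) (fun k => sums_bounded_exp_dist (b 0 k) k0) uA.
apply: le_trans; apply: ler_sum => m _; rewrite mulr_sumr -sumrN expR_sum.
by apply: ler_prod => k _; rewrite expR_ge0 /= mxE.
Qed.

End sums_bounded.

Section lattice_exponentials.
Variables (R : realType) (d : nat).
Local Notation V := 'rV[R]_d.
Local Notation CV := 'rV[R[i]]_d.
Implicit Types (s a b : CV) (m n u : 'rV[int]_d) (us : seq 'rV[int]_d) (psi : V -> R).
Local Arguments normc : simpl never.

Lemma nbhs_boxP a (W : set CV) : nbhs a W <->
  exists2 e : R, 0 < e & forall s, (forall k, normc (s 0 k - a 0 k) < e) -> W s.
Proof.
split.
- case/nbhs_ballP => -[t t'] /=; rewrite ltcE /= => /andP[/eqP -> t0] H.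
  exists t => // s hs; apply: H; split=> [|i k]; first by rewrite ltcR.
  rewrite (ord1 i).
  by rewrite -ball_normE /ball_ /= normrcE ltcR normcB; exact: hs.
- move=> [e e0 H]; apply/nbhs_ballP; exists e%:C; first by rewrite /= ltcR.
  move=> s [_ hs]; apply: H => k; have := hs 0 k.
  by rewrite -ball_normE /ball_ /= normrcE ltcR normcB.
Qed.

Lemma continuous_boxP (f : CV -> R[i]) a : {for a, continuous f} <->
  forall e : R, 0 < e -> exists2 r : R, 0 < r &
  forall s, (forall k, normc (s 0 k - a 0 k) < r) -> normc (f s - f a) < e.
Proof.
split=> [cf e e0|H U /nbhs_normcP[e e0 He]].
- have : nbhs (f a) [set z | normc (z - f a) < e] by apply/nbhs_normcP; exists e.
  by move/cf/nbhs_boxP.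
- by have [r r0 Hr] := H e e0; apply/(nbhs_boxP a (f @^-1` U)); exists r => // s /Hr; exact: He.
Qed.

Definition im_rV s : V := map_mx (@complex.Im R) s.
Definition re_rV s : V := map_mx (@complex.Re R) s.

Definition lexp s m : R[i] :=
  cexp ((0 +i* (2 * pi)) * dotc s (map_mx (real_complex R) (lattice_point R m))).

Lemma lattice_pointD m n : lattice_point R (m + n) = lattice_point R m + lattice_point R n.
Proof. by apply/rowP => k; rewrite !mxE intrD. Qed.

Lemma lattice_pointB m n : lattice_point R (m - n) = lattice_point R m - lattice_point R n.
Proof. by apply/rowP => k; rewrite !mxE intrB. Qed.

Lemma lattice_point_eq0 m : (lattice_point R m == 0) = (m == 0).
Proof.
apply/eqP/eqP => [/rowP H|->]; last by apply/rowP => k; rewrite !mxE.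
by apply/rowP => k; have := H k; rewrite !mxE => /eqP; rewrite intr_eq0 => /eqP.
Qed.

Lemma dotcDr s (x y : CV) : dotc s (x + y) = dotc s x + dotc s y.
Proof. by rewrite /dotc -big_split; apply: eq_bigr => k _; rewrite mxE mulrDr. Qed.

Lemma dotcDl s (x y : CV) : dotc (x + y) s = dotc x s + dotc y s.
Proof. by rewrite /dotc -big_split; apply: eq_bigr => k _; rewrite mxE mulrDl. Qed.

Lemma dotcZl (c : R[i]) s (x : CV) : dotc (c *: s) x = c * dotc s x.
Proof. by rewrite /dotc mulr_sumr; apply: eq_bigr => k _; rewrite mxE mulrA. Qed.

Lemma lexpD s m n : lexp s (m + n) = lexp s m * lexp s n.
Proof. by rewrite /lexp lattice_pointD map_mxD dotcDr mulrDr cexpD. Qed.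

Lemma lexp_periodic s m n : lexp (s + map_mx (real_complex R) (lattice_point R n)) m = lexp s m.
Proof.
rewrite /lexp dotcDl mulrDr cexpD.
have -> : dotc (map_mx (real_complex R) (lattice_point R n)) (map_mx (real_complex R) (lattice_point R m)) =
   ((\sum_k n 0 k * m 0 k)%:~R)%:C :> R[i].
  rewrite /dotc !rmorph_sum /=; apply: eq_bigr => k _.
  by rewrite !mxE !rmorphM.
by rewrite cexp_2pii mulr1.
Qed.

Lemma im_dotc s (y : V) : complex.Im (dotc s (map_mx (real_complex R) y)) = dotr (im_rV s) y.
Proof.
by rewrite /dotc raddf_sum; apply: eq_bigr => k _; rewrite !mxE; case: (s 0 k) => x z /=; rewrite mulr0 add0r.
Qed.

Lemma normc_lexp s m : normc (lexp s m) = expR (- (2 * pi * dotr (im_rV s) (lattice_point R m))).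
Proof.
rewrite /lexp normc_cexp -im_dotc; congr expR.
by case: (dotc _ _) => x y /=; rewrite mul0r sub0r.
Qed.

Lemma cdiff_lexp_line a b m z : cdiff (fun z => lexp (a + z *: b) m) z.
Proof.
set y := map_mx (real_complex R) (lattice_point R m).
have H : cdiff (fun z => (0 +i* (2 * pi)) * (dotc a y + z * dotc b y)) z.
  apply: cdiffM; first exact: cdiff_cst.
  apply: cdiffD; first exact: cdiff_cst.
  by apply: cdiffM; [exact: cdiff_id|exact: cdiff_cst].
apply: cdiff_ext (cdiff_comp H (cdiff_cexp _)) => w.
by rewrite /lexp dotcDl dotcZl.
Qed.

Lemma continuous_lexp m : continuous (lexp^~ m).
Proof.
move=> a; apply/continuous_boxP => e e0.
pose y := map_mx (real_complex R) (lattice_point R m); pose c : R[i] := 0 +i* (2 * pi).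
have [t t0 H] := cdiff_cont (cdiff_cexp (c * dotc a y)) e0.
pose S := \sum_(k < d) normc (c * y 0 k).
have S0 : 0 <= S by apply: sumr_ge0 => k _; exact: normc_ge0.
exists (t / (S + 1)); first by rewrite divr_gt0// ltr_wpDl.
move=> s hs; apply: H; rewrite -mulrBr /dotc -sumrB mulr_sumr.
apply: le_lt_trans (normc_sum _ _ _) _; apply: (@le_lt_trans _ _ (t / (S + 1) * S)).
  rewrite mulr_sumr; apply: ler_sum => k _; rewrite -mulrBl mulrCA normcM.
  by apply: ler_wpM2r; [exact: normc_ge0|exact: ltW].
by rewrite mulrAC ltr_pdivrMr ?ltr_wpDl// ltr_pM2l// ltrDl.
Qed.

Definition has_series psi s l := has_sum (fun m => (psi (lattice_point R m))%:C * lexp s m) l.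

Lemma has_series_diff u psi s l : has_series psi s l ->
  has_series (diff (lattice_point R u) psi) s ((1 - lexp s u) * l).
Proof.
move=> H; have Hs := has_sum_reindex (addrNK u) (addrK u) H.
have := has_sum_subZ (lexp s u) H Hs; rewrite mulrBl mul1r; apply: eq_has_sum => m /=.
rewrite /diff lattice_pointB rmorphB mulrBl; congr (_ - _).
by rewrite mulrCA -lexpD subrKC.
Qed.

Lemma has_series_diffs us psi s l : has_series psi s l ->
  has_series (diffs (map (@lattice_point R d) us) psi) s ((\prod_(u <- us) (1 - lexp s u)) * l).
Proof.
move=> H; elim: us => [|u us IH] /=; first by rewrite big_nil mul1r.
by rewrite big_cons -mulrA; exact: has_series_diff.
Qed.

Lemma bsupp_lattice psi : bsupp psi -> exists2 A : seq 'rV[int]_d, uniq A &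
  forall m, m \notin A -> psi (lattice_point R m) = 0.
Proof.
move=> [M HM]; pose N := `|Num.ceil M|%N.
pose row (f : {ffun 'I_d -> 'I_(2 * N).+1}) : 'rV[int]_d := \row_k ((f k)%:Z - N%:Z).
exists (undup (map row (enum {ffun 'I_d -> 'I_(2 * N).+1}))); first exact: undup_uniq.
move=> m; rewrite mem_undup => mA; apply: HM; rewrite ltNge; apply: contra mA => mM.
have H (k : 'I_d) : (absz (m 0 k + N%:Z)%R < (2 * N).+1)%N /\ 0 <= m 0 k + N%:Z.
  have := le_trans (coord_le_norm (lattice_point R m) k) mM; rewrite mxE.
  rewrite -intr_norm => h; have {}h : `|m 0 k| <= Num.ceil M.
    by rewrite -(ler_int R); apply: le_trans h _; exact: ceil_ge.
  by move: h; rewrite /N; lia.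
apply/mapP; exists [ffun k => Ordinal (H k).1]; first by rewrite mem_enum.
by apply/rowP => k; rewrite mxE ffunE /= gez0_abs ?(H k).2// addrK.
Qed.

End lattice_exponentials.

(** * Analytic continuation in several variables *)

Section holomorphic.
Variables (R : realType) (d : nat).
Local Notation CV := 'rV[R[i]]_d.
Implicit Types (s a b c x y : CV) (W U : set CV) (f g h Q N : CV -> R[i]).
Local Arguments normc : simpl never.

Lemma cdiff_line W g a b z : holomorphic_on W g -> W (a + z *: b) ->
  cdiff (fun z => g (a + z *: b)) z.
Proof.
move=> [_ Hg] /Hg dg; apply/cdiffP.
apply: (@differentiable_comp _ _ _ _ (fun z : R[i] => a + z *: b) g z) => //.
Qed.

Lemma holomorphic_continuous W g s : holomorphic_on W g -> W s -> {for s, continuous g}.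
Proof. by move=> [_ Hg] /Hg /differentiable_continuous. Qed.

Lemma open_neq0 W g s : holomorphic_on W g -> W s -> g s != 0 ->
  exists2 e : R, 0 < e & forall x, (forall k, normc (x 0 k - s 0 k) < e) -> g x != 0.
Proof.
move=> Hg Ws gs; have /continuous_boxP H := holomorphic_continuous Hg Ws.
have [|r r0 Hr] := H (normc (g s)); first by rewrite normc_gt0.
exists r => // x /Hr; apply: contraTneq => ->.
by rewrite sub0r normcN ltxx.
Qed.

Lemma open_boxP U : open U <-> forall s, U s ->
  exists2 e : R, 0 < e & forall x, (forall k, normc (x 0 k - s 0 k) < e) -> U x.
Proof.
rewrite openE; split=> H s /H; first by move/nbhs_boxP.
by move=> ?; apply/nbhs_boxP.
Qed.

Lemma open_box s (e : R) : open [set x : CV | forall k, normc (x 0 k - s 0 k) < e].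
Proof.
apply/open_boxP => x hx.
have [r [r0 Hr]] : exists r : R, 0 < r /\ forall k, normc (x 0 k - s 0 k) + r <= e.
  case: (pselect (exists k : 'I_d, True)) => [[k0 _]|nk]; last first.
    by exists 1; split=> // k; case: nk; exists k.
  pose k1 := [arg max_(k > k0) normc (x 0 k - s 0 k)]%O.
  exists (e - normc (x 0 k1 - s 0 k1)); split; first by rewrite subr_gt0.
  move=> k; rewrite addrCA gerDl subr_le0 /k1; case: arg_maxP => // i _; exact.
exists r => // y hy k; apply: lt_le_trans (Hr k).
rewrite -(subrK (x 0 k) (y 0 k)) -addrA addrC; apply: le_lt_trans (le_normcD _ _) _.
by rewrite ltrD2l.
Qed.

Lemma closure_boxP (A : set CV) x : closure A x <->
  forall e : R, 0 < e -> exists y, A y /\ forall k, normc (y 0 k - x 0 k) < e.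
Proof.
split=> [H e e0|H B /nbhs_boxP[e e0 HB]].
- by apply: (H [set y : CV | forall k, normc (y 0 k - x 0 k) < e]); apply/nbhs_boxP; exists e.
- by have [y [Ay Hy]] := H e e0; exists y; split=> //; exact: HB.
Qed.

(* On a box of radius 8 r, a line through two points of the concentric box of radius r
   can be followed up to the parameter 6. *)
Lemma box_identity a (r : R) b g : 0 < r ->
  (forall c (e : CV) z, (forall k, normc (c 0 k - a 0 k) < r) ->
     (forall k, normc ((c + z *: e) 0 k - a 0 k) < 8 * r) -> cdiff (fun z => g (c + z *: e)) z) ->
  (forall k, normc (b 0 k - a 0 k) < r) ->
  (exists2 e : R, 0 < e & forall x, (forall k, normc (x 0 k - b 0 k) < e) -> g x = 0) ->
  forall c, (forall k, normc (c 0 k - a 0 k) < r) -> g c = 0.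
Proof.
move=> r0 dg hb [e e0 He] c hc.
have cb k : normc ((c - b) 0 k) < 2 * r.
  rewrite !mxE (_ : c 0 k - b 0 k = (c 0 k - a 0 k) + - (b 0 k - a 0 k)); last by ring.
  apply: le_lt_trans (le_normcD _ _) _; rewrite normcN; have := hc k; have := hb k; lra.
have -> : c = b + 1 *: (c - b) by rewrite scale1r addrC subrK.
(* On the line b + z (c - b) differentiability is required for |z| <= 3, where the distance to [a]
   stays below r + 3 (2 r) < 8 r; the radius 3 / 2 covers z = 1, the parameter of [c]. *)
have h2 : (0 : R) < 3 / 2 by lra.
apply: (@accumulating_zeros R (fun z => g (b + z *: (c - b))) _ h2).
- move=> z hz; apply: dg => // k; rewrite mxE addrAC [X in _ + X]mxE.
  apply: le_lt_trans (le_normcD _ _) _; rewrite normcM.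
  have : normc z * normc ((c - b) 0 k) <= 3 * (2 * r).
    by apply: ler_pM; rewrite ?normc_ge0//; [lra|exact: ltW].
  have := hb k; lra.
- move=> t t0; pose t1 := Num.min (t / 2) (e / (2 * (2 * r))).
  have t10 : 0 < t1 by rewrite lt_min !divr_gt0// !mulr_gt0.
  exists t1%:C; split; first by rewrite -normc_gt0 normc_real normr_gt0 gt_eqF.
    rewrite normc_real gtr0_norm//; have : t1 <= t / 2 by rewrite ge_min lexx.
    by move: t0 => /=; lra.
  apply: He => k; rewrite mxE addrAC subrr add0r mxE normcM normc_real gtr0_norm//.
  have h1 : t1 <= e / (2 * (2 * r)) by rewrite ge_min lexx orbT.
  apply: (@le_lt_trans _ _ (e / (2 * (2 * r)) * (2 * r))).
    by apply: ler_pM; [exact: ltW|exact: normc_ge0|exact: h1|exact: ltW].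
  have -> : e / (2 * (2 * r)) * (2 * r) = e / 2 by field; rewrite gt_eqF.
  by move: e0 => /=; lra.
- by rewrite normc1; lra.
Qed.

(** The closure of the interior of the agreement set is open as well: around any of its points f = g
    / h, and Q g - N h vanishes on a box by [box_identity], so the equation holds on the box
    wherever h is nonzero, which is a dense subset. A closure is taken because the values of f at
    the zeros of h are arbitrary. *)
Lemma meromorphic_identity f Q N U : meromorphic f ->
  (forall a b z, cdiff (fun z => Q (a + z *: b)) z) ->
  (forall a b z, cdiff (fun z => N (a + z *: b)) z) ->
  open U -> U !=set0 -> (forall s, U s -> Q s * f s = N s) ->
  exists O, [/\ open O, dense O & forall s, O s -> Q s * f s = N s].
Proof.
move=> mf dQ dN oU U0 HU; pose Z : set CV := [set s | Q s * f s = N s].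
exists Z°; split; [exact: open_interior| |by move=> s /interior_subset].
have clop a : closure Z° a -> exists2 r : R, 0 < r &
    forall x, (forall k, normc (x 0 k - a 0 k) < r) -> closure Z° x.
  move=> ca; have [W [g [h [Wa Hg Hh hdense fgh]]]] := mf a.
  have [r8 r80 Hr8] := (open_boxP W).1 Hg.1 a Wa.
  pose r := r8 / 8; have r0 : 0 < r by rewrite divr_gt0.
  have r8E : 8 * r = r8 by rewrite /r mulrC divfK.
  pose B := [set x : CV | forall k, normc (x 0 k - a 0 k) < r].
  have oB : open B by exact: open_box.
  have Ba : B a by move=> k; rewrite subrr normc0.
  have BW : B `<=` W.
    by move=> x Bx; apply: Hr8 => k; apply: lt_trans (Bx k) _; rewrite -r8E; lra.
  have [b [[Zb Bb] hb]] : exists b, (Z° b /\ B b) /\ h b != 0.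
    have [b0 [Zb0 Bb0]] : Z° `&` B !=set0 by have [y []] := (closure_boxP _ _).1 ca r r0; exists y.
    have [|||b [Zb Bb] hb] := hdense (Z° `&` B); last by exists b.
      by apply: openI => //; exact: open_interior.
      by move=> x [_ /BW].
    by exists b0.
  pose D s := Q s * g s - N s * h s.
  have D0 c : B c -> D c = 0.
    apply: (@box_identity a r b D r0) => //.
      move=> c' e z hc hz; have Wz : W (c' + z *: e) by apply: Hr8 => k; rewrite -r8E.
      by apply: cdiffB; apply: cdiffM => //; [exact: cdiff_line Hg Wz|exact: cdiff_line Hh Wz].
    have [e1 e10 He1] := open_neq0 Hh (BW _ Bb) hb.
    have [e2 e20 He2] := (open_boxP _).1 (open_interior Z) b Zb.
    have [e3 e30 He3] := (open_boxP _).1 oB b Bb.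
    exists (Num.min e1 (Num.min e2 e3)); first by rewrite !lt_min e10 e20.
    move=> x hx; have h0 : h x != 0.
      by apply: He1 => k; apply: lt_le_trans (hx k) _; rewrite ge_min lexx.
    have Zx : Z x.
      apply: interior_subset; apply: He2 => k; apply: lt_le_trans (hx k) _.
      by rewrite !ge_min lexx !orbT.
    have Bx : B x.
      by apply: He3 => k; apply: lt_le_trans (hx k) _; rewrite !ge_min lexx !orbT.
    by rewrite /D -Zx fgh ?mulrA ?divfK ?subrr//; exact: BW.
  exists r; first exact: r0.
  move=> x Bx; apply/closure_boxP.
  move=> e e0.
  pose O := [set y : CV | forall k, normc (y 0 k - x 0 k) < e] `&` B.
  have oO : open O by apply: openI => //; exact: open_box.
  have [||y [Oy By] hy] := hdense O oO; [by move=> y [_ /BW]|by exists x; split=> // k; rewrite subrr normc0|].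
  exists y; split; last exact: Oy.
  have [e1 e10 He1] := open_neq0 Hh (BW _ By) hy.
  have [e3 e30 He3] := (open_boxP _).1 oB y By.
  apply/nbhs_boxP; exists (Num.min e1 e3); first by rewrite lt_min e10.
  move=> w hw; have h0 : h w != 0.
    by apply: He1 => k; apply: lt_le_trans (hw k) _; rewrite ge_min lexx.
  have Bw : B w by apply: He3 => k; apply: lt_le_trans (hw k) _; rewrite ge_min lexx orbT.
  rewrite /Z /= (fgh _ (BW _ Bw) h0); apply: (mulIf h0); rewrite mulrA divfK//.
  by apply/eqP; rewrite -subr_eq0; apply/eqP; exact: D0.
have [u0 Uu0] := U0.
have Zu0 : closure Z° u0.
  apply: subset_closure; rewrite /interior; apply: filterS (open_nbhs_nbhs (conj oU Uu0)).
  exact: HU.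
move=> O [c Oc] oO; have [r r0 Hr] := (open_boxP O).1 oO c Oc.
suff /closure_boxP/(_ r r0)[x [Zx Ox]] : closure Z° c by exists x; split=> //; exact: Hr.
(* A segment from a point of U to an arbitrary point reduces the connectedness of C^d to that of
   [0, 1]. *)
pose gam (t : R) : CV := u0 + t%:C *: (c - u0).
pose I01 : set R := [set` `[0, 1]%R].
pose T : set R := I01 `&` (gam @^-1` closure Z°).
have gamC t : exists2 M : R, 0 < M & forall t' k, normc ((gam t' - gam t) 0 k) <= `|t' - t| * M.
  have [M [M0 HM]] := @seq_bound R _ (enum 'I_d) (fun k => normc ((c - u0) 0 k)).
  exists M => // t' k; rewrite /gam opprD addrACA subrr add0r -scalerBl -rmorphB mxE normcM normc_real.
  by apply: ler_wpM2l => //; apply: HM; rewrite mem_enum.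
have cgam : continuous gam.
  move=> t V /nbhs_boxP[e e0 HV]; have [M M0 HM] := gamC t.
  apply/nbhs_ballP; exists (e / M); first by rewrite /= divr_gt0.
  move=> t'; rewrite -ball_normE /ball_ /= distrC => ht; apply: HV => k.
  by have := HM t' k; rewrite !mxE => h; apply: le_lt_trans h _; rewrite -ltr_pdivlMr.
have pO : open (gam @^-1` closure Z°).
  by apply: open_comp => [t _|]; [exact: cgam|apply/open_boxP => s /clop].
have pC : closed (gam @^-1` closure Z°).
  apply: (@closed_comp _ _ gam (closure Z°)); last exact: closed_closure.
  by move=> t _; exact: cgam.
have TE : T = I01.
  apply: (@segment_connected R 0 1).
  - exists 0; split; first by rewrite /I01 /= in_itv /= lexx ler01.
    have g0 : gam 0 = u0 by rewrite /gam rmorph0 scale0r addr0.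
    by rewrite /preimage /= g0.
  - by exists (gam @^-1` closure Z°); [exact: pO|].
  - by exists (gam @^-1` closure Z°); [exact: pC|].
have g1 : gam 1 = c by rewrite /gam rmorph1 scale1r addrC subrK.
have : T 1 by rewrite TE /I01 /= in_itv /= ler01 lexx.
by move=> [_]; rewrite /preimage /= g1.
Qed.

End holomorphic.

(** * Rationality of the edges *)

Section cone_series_bounds.
Variables (R : realType) (d : nat).
Local Notation V := 'rV[R]_d.
Implicit Types (x y z v w eta : V) (ws : seq V) (m : 'rV[int]_d).
Local Notation lp := (@lattice_point R d).

(** The modulus of the m-th term of the series with nonnegative coefficients c at a point with
    imaginary part Y, see [normc_term]. *)
Definition cone_weight (c : V -> R) (Y : V) m : R := c (lp m) * expR (- (2 * pi * dotr Y (lp m))).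

Lemma rV_neq0 x : x != 0 -> exists i, x 0 i != 0.
Proof.
move=> x0; apply/existsP; apply: contraNT x0 => /existsPn H; apply/eqP/rowP => k.
by have := H k; rewrite negbK mxE => /eqP.
Qed.

Lemma two_pi_gt0 : 0 < 2 * pi :> R. Proof. by rewrite mulr_gt0// pi_gt0. Qed.

Lemma normr_dotr_le x y : `|dotr x y| <= \sum_k `|x 0 k| * `|y 0 k|.
Proof. by apply: le_trans (ler_norm_sum _ _ _) _; apply: ler_sum => k _; rewrite normrM. Qed.

(* The exponent of the cone series dominates a seminorm that only has to be compared with
   it on the generators. *)
Lemma cone_weight_le (c : V -> R) (Om : R) ws v Y (nu : V -> R) :
  (forall x, 0 <= c x <= Om) -> (forall x, c x != 0 -> rays ws [set 0] (x - v)) ->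
  (forall x z, nu (x + z) <= nu x + nu z) ->
  (forall (s : R) x, 0 <= s -> nu (s *: x) <= s * nu x) ->
  (forall w, w \in ws -> nu w <= dotr Y w) -> forall m,
  0 <= cone_weight c Y m <= Om * expR (- (2 * pi * dotr Y v)) * expR (- (2 * pi * nu (lp m - v))).
Proof.
move=> c01 csup nuD nuZ nuw m; have /andP[c0 c1] := c01 (lp m).
have Om0 : 0 <= Om by exact: le_trans c1.
rewrite /cone_weight mulr_ge0 ?expR_ge0//=.
have [->|cn] := eqVneq (c (lp m)) 0; first by rewrite mul0r !mulr_ge0// expR_ge0.
rewrite -[leRHS]mulrA -expRD; apply: ler_pM; rewrite ?expR_ge0//.
have nuw1 w : w \in ws -> nu w <= 1 * dotr Y w by rewrite mul1r; exact: nuw.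
have := rays_bound nuD nuZ nuw1 (csup _ cn).
rewrite mul1r dotrBr ler_expR -opprD lerN2 -mulrDr ler_pM2l ?two_pi_gt0//; lra.
Qed.

Definition l1 x : R := \sum_k `|x 0 k|.

Lemma l1D x y : l1 (x + y) <= l1 x + l1 y.
Proof. by rewrite /l1 -big_split; apply: ler_sum => k _; rewrite mxE ler_normD. Qed.

Lemma l1Z (s : R) x : l1 (s *: x) = `|s| * l1 x.
Proof. by rewrite /l1 mulr_sumr; apply: eq_bigr => k _; rewrite mxE normrM. Qed.

Lemma cone_weight_bounded (c : V -> R) (Om : R) ws v Y :
  (forall x, 0 <= c x <= Om) -> (forall x, c x != 0 -> rays ws [set 0] (x - v)) ->
  (forall w, w \in ws -> 0 < dotr Y w) -> exists M, sums_bounded (cone_weight c Y) M.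
Proof.
move=> c01 csup Yw; have [C [C0 HC]] := @seq_bound R _ ws (fun w => l1 w / dotr Y w).
pose K := Om * expR (- (2 * pi * dotr Y v)); pose kap := 2 * pi / C.
have kap0 : 0 < kap by rewrite divr_gt0// two_pi_gt0.
have Om0 : 0 <= Om by have /andP[] := c01 0; apply: le_trans.
have bd m := @cone_weight_le c Om ws v Y (fun x => C^-1 * l1 x) c01 csup _ _ _ m.
exists (K * (2 * (expR kap / kap)) ^+ d).
apply: sums_bounded_scale (lattice_sum_bound v kap0); first by rewrite mulr_ge0// expR_ge0.
move=> m; apply: le_trans (proj2 (andP (bd _ _ _ m))) _.
- by move=> x z; rewrite -mulrDr ler_pM2l ?invr_gt0// l1D.
- by move=> s x s0; rewrite l1Z ger0_norm// mulrCA.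
- by move=> w wws; rewrite ler_pdivrMl// -ler_pdivrMr ?HC// Yw.
- rewrite -/K /kap mulrA; apply: ler_wpM2l; first by rewrite mulr_ge0// expR_ge0.
  suff -> : l1 (lp m - v) = \sum_k `|lp m 0 k - v 0 k| by [].
  by apply: eq_bigr => k _; rewrite !mxE.
Qed.

(* Sums over the fibres of the i-th coordinate are bounded uniformly, and the i-th coordinate
   itself contributes a factor of order 1 / tau. *)
Lemma near_wall_bound (c : V -> R) (Om : R) ws v w0 y eta :
  (forall x, 0 <= c x <= Om) -> (forall x, c x != 0 -> rays ws [set 0] (x - v)) ->
  w0 != 0 -> dotr y w0 = 0 -> (forall w, w \in ws -> w != w0 -> 0 < dotr y w) ->
  0 < dotr eta w0 -> (forall w, w \in ws -> 0 < dotr eta w) ->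
  exists tau0 C : R, [/\ 0 < tau0, 0 <= C & forall tau : R, 0 < tau <= tau0 ->
    sums_bounded (cone_weight c (y + tau *: eta)) (C / tau)].
Proof.
move=> c01 csup w00 yw0 yw ew0 ew.
have [i wi0] := rV_neq0 w00.
(* With this factor the term tau q |z_i| of [nu] equals <tau eta, z> at z = w0, where y contributes
   nothing. *)
pose q := dotr eta w0 / `|w0 0 i|; have q0 : 0 < q by rewrite divr_gt0// normr_gt0.
(* The projection along [w0] onto the hyperplane z_i = 0. Since it kills [w0], its coefficient [kap]
   in [nu] need not shrink with tau. *)
pose pr z : V := z - (z 0 i / w0 0 i) *: w0.
pose ws' := [seq w <- ws | w != w0].
have [C1 [C10 HC1]] := @seq_bound R _ ws' (fun w => l1 (pr w) / dotr y w).
have [C2 [C20 HC2]] := @seq_bound R _ ws' (fun w => q * `|w 0 i| / dotr y w).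
(* The factors 2 let each of the two terms of [nu] use half of <y, w> at the generators other than
   [w0]. *)
pose kap := (2 * C1)^-1; have kap0 : 0 < kap by rewrite invr_gt0 mulr_gt0.
pose tau0 := (2 * C2)^-1; have tau00 : 0 < tau0 by rewrite invr_gt0 mulr_gt0.
have Om0 : 0 <= Om by have /andP[] := c01 0; apply: le_trans.
pose K := Om * expR (2 * pi * (`|dotr y v| + tau0 * `|dotr eta v|)).
have K0 : 0 <= K by rewrite mulr_ge0// expR_ge0.
pose S := (2 * (expR (2 * pi * kap) / (2 * pi * kap))) ^+ d.
have S0 : 0 <= S by rewrite exprn_ge0// mulr_ge0// divr_ge0 ?expR_ge0 ?mulr_ge0 ?pi_ge0 ?ltW.
pose D := 2 * expR (2 * pi * (tau0 * q)) / (2 * pi * q).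
exists tau0, (K * S * D); split => //.
  apply: mulr_ge0; [by apply: mulr_ge0|apply: divr_ge0]; first by apply: mulr_ge0; rewrite ?expR_ge0.
  by apply: mulr_ge0; rewrite ltW// two_pi_gt0.
move=> tau /andP[t0 tt0].
pose nu z := kap * l1 (pr z) + tau * q * `|z 0 i|.
have prD x z : pr (x + z) = pr x + pr z.
  by rewrite /pr !mxE mulrDl scalerDl opprD addrACA.
have prZ (s : R) z : pr (s *: z) = s *: pr z.
  by rewrite /pr !mxE scalerBr scalerA mulrA.
have tq0 : 0 <= tau * q by rewrite mulr_ge0// ltW.
have nuD x z : nu (x + z) <= nu x + nu z.
  rewrite /nu prD mxE [leRHS]addrACA -!mulrDr; apply: lerD; apply: ler_wpM2l => //; [exact: ltW|exact: l1D|exact: ler_normD].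
have nuZ (s : R) x : 0 <= s -> nu (s *: x) <= s * nu x.
  by move=> s0; rewrite /nu prZ l1Z mxE normrM ger0_norm// mulrDr !(mulrCA s).
have nuw w : w \in ws -> nu w <= dotr (y + tau *: eta) w.
  move=> wws; rewrite dotrDl dotrZl; have [->|wn] := eqVneq w w0.
    have pr0 : pr w0 = 0 *: 0 by rewrite scale0r /pr divff// scale1r subrr.
    by rewrite /nu pr0 l1Z normr0 mul0r mulr0 add0r yw0 add0r -mulrA /q divfK// normr_eq0.
  have yw_ := yw w wws wn; have ew_ := ew w wws.
  have := HC1 w; rewrite mem_filter wn wws ler_pdivrMr// => /(_ isT) h1.
  have := HC2 w; rewrite mem_filter wn wws ler_pdivrMr// => /(_ isT) h2.
  have : kap * l1 (pr w) <= dotr y w / 2.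
    by rewrite /kap invfM -mulrA mulrC ler_pM2r// ler_pdivrMl.
  have : tau * q * `|w 0 i| <= dotr y w / 2.
    apply: (@le_trans _ _ (tau0 * (C2 * dotr y w))).
      by rewrite -mulrA; apply: ler_pM => //; [exact: ltW|rewrite mulr_ge0// ltW].
    by rewrite /tau0 invfM -mulrA mulKf ?gt_eqF// mulrC.
  have := mulr_gt0 t0 ew_.
  rewrite /nu; lra.
have bd := cone_weight_le c01 csup nuD nuZ nuw.
have -> : K * S * D / tau = K * (S * (D / tau)) by ring.
have kap1 : 0 < 2 * pi * kap by rewrite mulr_gt0// two_pi_gt0.
pose a := 2 * pi * (tau * q); have a0 : 0 < a by apply: mulr_gt0; [exact: two_pi_gt0|exact: mulr_gt0].
pose F (m : 'rV[int]_d) : R := expR (- (2 * pi * kap * l1 (pr (lp m - v)))) *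
   expR (- (a * `|(m 0 i)%:~R - v 0 i|)).
apply: (@sums_bounded_scale _ _ _ F) => // [m|].
  apply: le_trans (proj2 (andP (bd m))) _; rewrite /K -[leLHS]mulrA -[leRHS]mulrA; apply: ler_wpM2l => //.
  rewrite /F -!expRD ler_expR /nu /a !mxE.
  have -> : 2 * pi * (kap * l1 (pr (lp m - v)) + tau * q * `|(m 0 i)%:~R - v 0 i|) =
    2 * pi * kap * l1 (pr (lp m - v)) + 2 * pi * (tau * q) * `|(m 0 i)%:~R - v 0 i| by ring.
  suff : - (2 * pi * dotr (y + tau *: eta) v) <= 2 * pi * (`|dotr y v| + tau0 * `|dotr eta v|) by lra.
  rewrite -mulrN; apply: ler_wpM2l; first by rewrite ltW// two_pi_gt0.
  rewrite dotrDl dotrZl opprD; apply: lerD; first by rewrite -normrN ler_norm.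
  apply: le_trans (ler_norm _) _; rewrite normrN normrM ger0_norm; last exact: ltW.
  by apply: ler_wpM2r.
have hD : sums_bounded (fun n : int => expR (- (a * `|n%:~R - v 0 i|))) (D / tau).
  move=> A uA; apply: le_trans (sums_bounded_exp_dist (v 0 i) a0 uA) _.
  have -> : D / tau = 2 * (expR (2 * pi * (tau0 * q)) / a).
    have aux (E Q t u : R) : 2 * E / (Q * u) / t = 2 * (E / (Q * (t * u))).
      by rewrite !invfM -!mulrA (mulrC u^-1).
    exact: aux.
  rewrite ler_pM2l// ler_pM2r ?invr_gt0// ler_expR /a ler_pM2l ?two_pi_gt0//.
  by rewrite ler_pM2r.
apply: (sums_bounded_fibers (g := fun m : 'rV[int]_d => m 0 i) S0 _ hD) => n A uA An.
(* On the fibre m_i = n the projection of m - v is m - b, so the fibre sum is part of a lattice sum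
   about [b], bounded independently of n. *)
pose b : V := v + ((n%:~R - v 0 i) / w0 0 i) *: w0.
rewrite /F (eq_big_seq (fun m : 'rV[int]_d => expR (- (2 * pi * kap * \sum_k `|lp m 0 k - b 0 k|)) *
    expR (- (a * `|n%:~R - v 0 i|)))); last first.
  move=> m mA; have mi := An m mA; rewrite mi; congr (expR (- (_ * _)) * _).
  rewrite /l1 /pr; apply: eq_bigr => k _; rewrite !mxE mi; congr `| _ |; ring.
by rewrite -mulr_suml ler_pM2r ?expR_gt0//; apply: lattice_sum_bound.
Qed.

End cone_series_bounds.

(** * Lower bound near an edge, and irrational directions *)

Section cone_series_lower_bound.
Variables (R : realType) (d : nat).
Local Notation V := 'rV[R]_d.
Implicit Types (x y z v w eta : V) (ws : seq V) (m : 'rV[int]_d).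
Local Notation lp := (@lattice_point R d).

Definition floorv x : 'rV[int]_d := \row_k Num.floor (x 0 k).

Lemma floorv_dist x k : 0 <= x 0 k - lp (floorv x) 0 k < 1.
Proof. by have := floor_itv (x 0 k); rewrite intrD !mxE => /andP[h1 h2]; apply/andP; split; lra. Qed.

(** Rounding the points X + n L w0 along the edge gives lattice points well inside the cone, where c
    = Om. The exponent at the n-th one grows like n tau only, so about 1 / tau of them have a weight
    bounded below. *)
Lemma near_wall_lower_bound (c : V -> R) (Om e : R) ws v w0 y eta (p1 : V) :
  (forall x, 0 <= c x) -> 0 < Om ->
  (forall x, (forall z, (forall k, `|z 0 k - x 0 k| <= 1) -> rays ws [set 0] (z - v)) -> c x = Om) ->
  0 < e -> (forall x, (forall k, `|x 0 k - p1 0 k| <= e) -> rays ws [set 0] x) ->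
  w0 \in ws -> w0 != 0 -> dotr y w0 = 0 -> 0 < dotr eta w0 ->
  exists2 c0 : R, 0 < c0 & forall tau : R, 0 < tau <= 1 -> exists2 A, uniq A &
    c0 <= tau * \sum_(m <- A) cone_weight c (y + tau *: eta) m.
Proof.
move=> c0 Om0 cint e0 hp1 wws w00 yw0 ew0.
have [i wi0] := rV_neq0 w00.
(* The i-th coordinates of consecutive points differ by 1, so the rounded points are distinct. *)
pose L := `|w0 0 i|^-1; have L0 : 0 < L by rewrite invr_gt0 normr_gt0.
(* The scaling by 2 / e leaves room for a cube of half-width 2: 1 for the rounding and 1 for the
   hypothesis on [c]. *)
pose X : V := v + (2 / e) *: p1.
pose pt (n : nat) : V := X + (n%:R * L) *: w0; pose mm n := floorv (pt n).
have cmm n : c (lp (mm n)) = Om.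
  apply: cint => z hz.
  have -> : z - v = (2 / e) *: (p1 + (e / 2) *: (z - pt n)) + (n%:R * L) *: w0.
    have ee : 2 / e * (e / 2) = 1 by rewrite mulrA divfK ?gt_eqF// divff.
    by rewrite scalerDr scalerA ee scale1r /pt /X; apply/rowP => k; rewrite !mxE; ring.
  apply: rays_add => //; first by rewrite mulr_ge0// ltW.
  apply: rays_scale; first by rewrite divr_ge0// ltW.
  apply: hp1 => k; have := floorv_dist (pt n) k; have := hz k; rewrite /mm; move: (pt n) => x.
  rewrite ler_norml => /andP[h1 h2] /andP[h3 h4].
  rewrite mxE addrAC subrr add0r mxE normrM gtr0_norm ?divr_gt0// -mulrA ger_pMr//.
  rewrite ler_pdivrMl// mulr1 mxE ler_norml [(- x) 0 k]mxE; apply/andP; split; lra.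
have mm_inj : injective mm.
  move=> n n' /rowP/(_ i); rewrite /mm !mxE => E.
  have h (j : nat) := floorv_dist (pt j) i.
  have := h n; have := h n'; rewrite !mxE E => /andP[h1 h2] /andP[h3 h4].
  have {h1 h2 h3 h4} : `|(n%:R - n'%:R) * (L * w0 0 i)| < 1 by rewrite ltr_norml; apply/andP; split; lra.
  rewrite normrM normrM (gtr0_norm L0) /L mulVf ?normr_eq0// mulr1.
  have -> : n%:R - n'%:R = (n%:Z - n'%:Z)%:~R :> R by rewrite intrB !pmulrn.
  rewrite -intr_norm (_ : 1 = 1%:~R :> R)// ltr_int; lia.
pose B := `|dotr y X| + `|dotr eta X| + (l1 y + l1 eta) + L * dotr eta w0.
pose c1 := Om * expR (- (2 * pi * B)).
have c10 : 0 < c1 by rewrite mulr_gt0// expR_gt0.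
exists c1 => // tau /andP[t0 t1].
pose N := (Num.truncn tau^-1).+1; exists (map mm (iota 0 N)); first by rewrite map_inj_uniq// iota_uniq.
have term n : (n < N)%N -> c1 <= cone_weight c (y + tau *: eta) (mm n).
  move=> nN; rewrite /cone_weight cmm /c1 ler_pM2l// ler_expR lerN2 ler_pM2l ?two_pi_gt0//.
  have nt : n%:R * tau <= 1.
    by rewrite -ler_pdivlMr// mul1r -truncn_ge_nat ?invr_ge0 ?ltW.
  set Y := y + tau *: eta; pose er := pt n - lp (mm n).
  have -> : lp (mm n) = X + (n%:R * L) *: w0 - er by rewrite /er opprB addrC subrK.
  rewrite dotrBr dotrDr dotrZr.
  have h1 : - dotr Y er <= l1 y + l1 eta.
    apply: le_trans (ler_norm _) _; rewrite normrN; apply: le_trans (normr_dotr_le _ _) _.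
    rewrite /l1 -big_split; apply: ler_sum => k _ /=.
    have := floorv_dist (pt n) k; rewrite -/(mm n) => /andP[h1 h2].
    have -> : `|er 0 k| = pt n 0 k - lp (mm n) 0 k by rewrite /er mxE [X in `|_ + X|]mxE ger0_norm.
    apply: (@le_trans _ _ `|Y 0 k|); first by rewrite ler_piMr// ltW.
    rewrite mxE; apply: le_trans (ler_normD _ _) _; rewrite lerD2l mxE normrM (gtr0_norm t0).
    by apply: ler_piMl.
  have h2 : n%:R * L * dotr Y w0 <= L * dotr eta w0.
    rewrite /Y dotrDl dotrZl yw0 add0r.
    have -> : n%:R * L * (tau * dotr eta w0) = n%:R * tau * (L * dotr eta w0) by ring.
    by rewrite ler_piMl// mulr_ge0// ltW.
  have h3 : dotr Y X <= `|dotr y X| + `|dotr eta X|.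
    rewrite /Y dotrDl dotrZl; apply: lerD; first exact: ler_norm.
    apply: le_trans (ler_norm _) _; rewrite normrM (gtr0_norm t0); exact: ler_piMl.
  by rewrite /B; lra.
rewrite big_map; apply: (@le_trans _ _ (tau * \sum_(n <- iota 0 N) c1)).
  rewrite big_const_seq count_predT size_iota iter_addr_0 -mulr_natr mulrCA ler_pMr//.
  by rewrite mulrC -ler_pdivrMr// mul1r ltW// truncnS_gt.
rewrite ler_pM2l// big_seq [leRHS]big_seq; apply: ler_sum => n; rewrite mem_iota add0n => /andP[_ nN].
exact: term.
Qed.

(** The values <m, w> form a subgroup of the reals that contains the coordinates of w. Without small
    nonzero elements it would consist of the multiples of its least positive element u, and w / u
    would be a lattice point. *)
Lemma irrational_small (w : V) : w != 0 ->
  (forall (t : R) m, t != 0 -> lp m <> t *: w) ->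
  forall e : R, 0 < e -> exists m, dotr (lp m) w != 0 /\ `|dotr (lp m) w| < e.
Proof.
move=> w0 irr e e0; apply: contrapT => none.
pose G := [set t : R | exists m, t = dotr (lp m) w].
have GB t t' : G t -> G t' -> G (t - t').
  by move=> [m ->] [m' ->]; exists (m - m'); rewrite lattice_pointB dotrBl.
have GN t : G t -> G (- t).
  by move=> Gt; have := GB _ _ Gt Gt; rewrite subrr -sub0r => /GB; apply.
have Gmul t : G t -> forall n : nat, G (n%:R * t).
  move=> Gt; elim=> [|n IH]; first by rewrite mul0r; have := GB _ _ Gt Gt; rewrite subrr.
  by rewrite -natr1 mulrDl mul1r -[t in _ + t]opprK; apply: GB => //; exact: GN.
have Ge t : G t -> 0 < t -> e <= t.
  move=> [m tE] t0; rewrite leNgt; apply/negP => te; apply: none; exists m.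
  by rewrite -tE gt_eqF// gtr0_norm.
have Gw k : G (w 0 k).
  exists (delta_mx 0 k); rewrite /dotr (bigD1 k)//= !mxE !eqxx mul1r big1 ?addr0// => j jk.
  by rewrite !mxE (negbTE jk) mul0r.
have [k wk] := rV_neq0 w0.
(* An element with the least integer part of t / e is the least positive one: a smaller one would
   differ from it by less than the gap [e]. *)
pose P n := `[< exists t, [/\ G t, 0 < t & Num.truncn (t / e) = n] >].
have exP : exists n, P n.
  exists (Num.truncn (`|w 0 k| / e)); apply/asboolP; exists `|w 0 k|; split=> //; last by rewrite normr_gt0.
  by case: (ger0P (w 0 k)) => _; [exact: Gw|exact/GN/Gw].
have [n /asboolP[u [Gu u0 un]] nmin] := ex_minnP exP.
have umin t : G t -> 0 < t -> u <= t.
  move=> Gt t0; rewrite leNgt; apply/negP => tu.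
  have h1 : (n <= Num.truncn (t / e))%N by apply: nmin; apply/asboolP; exists t.
  have h2 : n%:R * e <= t.
    by rewrite -ler_pdivlMr// -truncn_ge_nat// divr_ge0// ltW.
  have h3 : u < n.+1%:R * e by rewrite -un -ltr_pdivrMr// truncnS_gt.
  have := Ge _ (GB _ _ Gu Gt); rewrite subr_gt0 => /(_ tu).
  by move: h3; rewrite -natr1 mulrDl mul1r; lra.
have Gu' t : G t -> exists j : int, t = j%:~R * u.
  suff pos s : G s -> 0 <= s -> exists j : int, s = j%:~R * u.
    move=> Gt; case: (ger0P t) => t0; first exact: pos.
    have [|j jE] := pos _ (GN _ Gt); first by rewrite oppr_ge0 ltW.
    by exists (- j); rewrite mulrNz mulNr -jE opprK.
  move=> Gs s0; pose j := Num.truncn (s / u); exists j%:Z.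
  have h1 : j%:R * u <= s by rewrite -ler_pdivlMr//; rewrite truncn_le divr_ge0// ltW.
  have h2 : s < j.+1%:R * u by rewrite -ltr_pdivrMr// truncnS_gt.
  rewrite -pmulrn; apply/eqP; rewrite -subr_eq0; apply/negPn/negP => ne.
  have := umin _ (GB _ _ Gs (Gmul _ Gu j)).
  rewrite lt_neqAle eq_sym ne subr_ge0 h1 => /(_ isT).
  by move: h2; rewrite -natr1 mulrDl mul1r; lra.
pose m : 'rV[int]_d := \row_k proj1_sig (cid (Gu' _ (Gw k))).
apply: (irr u^-1 m); first by rewrite invr_eq0 gt_eqF.
by apply/rowP => j; rewrite !mxE; case: cid => q /= ->; rewrite mulrC mulfK// gt_eqF.
Qed.

End cone_series_lower_bound.

(** * The denominator over a wall of the domain of convergence *)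

Section wall.
Variables (R : realType) (d : nat).
Local Notation V := 'rV[R]_d.
Local Notation CV := 'rV[R[i]]_d.
Implicit Types (x y z v w eta : V) (ws : seq V) (m : 'rV[int]_d) (s : CV).
Local Notation lp := (@lattice_point R d).
Local Arguments normc : simpl never.

Definition cplx x y : CV := \row_k (x 0 k +i* y 0 k).

Lemma im_rV_cplx x y : im_rV (cplx x y) = y.
Proof. by apply/rowP => k; rewrite !mxE. Qed.

Lemma re_rV_cplx x y : re_rV (cplx x y) = x.
Proof. by apply/rowP => k; rewrite !mxE. Qed.

Lemma dotr_im_close s y w (e : R) : (forall k, normc (s 0 k - cplx 0 y 0 k) < e) ->
  `|dotr (im_rV s - y) w| <= e * l1 w.
Proof.
move=> hs; apply: le_trans (normr_dotr_le _ _) _; rewrite /l1 mulr_sumr; apply: ler_sum => k _.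
apply: ler_wpM2r => //; apply: le_trans (ltW (hs k)).
apply: le_trans (normc_Im _); rewrite raddfB !mxE /=; exact: lexx.
Qed.

Lemma im_rVD s s' : im_rV (s + s') = im_rV s + im_rV s'. Proof. exact: map_mxD. Qed.

Lemma im_rVZ (a : R[i]) x : im_rV (a *: cplx x 0) = complex.Im a *: x.
Proof. by apply/rowP => k; rewrite !mxE; case: a => b c /=; rewrite mulr0 add0r. Qed.

Lemma im_rV_real y : im_rV (map_mx (real_complex R) y) = 0.
Proof. by apply/rowP => k; rewrite !mxE. Qed.

Lemma lexp_imag y m : lexp (cplx 0 y) m = (expR (- (2 * pi * dotr y (lp m))))%:C.
Proof.
have E : dotc (cplx 0 y) (map_mx (real_complex R) (lp m)) = 0 +i* dotr y (lp m).
  apply/eqP; rewrite eq_complex /= im_dotc im_rV_cplx eqxx andbT; apply/eqP.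
  by rewrite /dotc raddf_sum big1// => k _; rewrite !mxE /= mul0r mulr0 subrr.
rewrite /lexp E /cexp; apply/eqP; rewrite eq_complex /=.
by rewrite !mul0r !mulr0 !subr0 !addr0 sin0 cos0 sub0r !mulr0 !mulr1 !eqxx.
Qed.

Lemma normc_term (c : V -> R) s m : (forall x, 0 <= c x) ->
  normc ((c (lp m))%:C * lexp s m) = cone_weight c (im_rV s) m.
Proof. by move=> c0; rewrite normcM normc_real ger0_norm// normc_lexp. Qed.

(** An exponential is monotone in b, hence at most the sum of its values at the ends of [-del, del];
    the majorant no longer depends on b. *)
Lemma cone_weight_convex (c : V -> R) Y x (b del : R) m : (forall x, 0 <= c x) -> `|b| <= del ->
  cone_weight c (Y + b *: x) m <= cone_weight c (Y + del *: x) m + cone_weight c (Y - del *: x) m.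
Proof.
move=> c0; rewrite ler_norml => /andP[b1 b2]; rewrite /cone_weight -mulrDr; apply: ler_wpM2l => //.
rewrite dotrBl !dotrDl !dotrZl; set X := dotr x _; set A := dotr Y _.
have [X0|X0] := lerP 0 X.
- apply: (@le_trans _ _ (expR (- (2 * pi * (A - del * X))))); last by rewrite lerDr expR_ge0.
  by rewrite ler_expR lerN2 ler_pM2l ?two_pi_gt0// lerD2l -mulNr; apply: ler_wpM2r.
- apply: (@le_trans _ _ (expR (- (2 * pi * (A + del * X))))); last by rewrite lerDl expR_ge0.
  rewrite ler_expR lerN2 ler_pM2l ?two_pi_gt0// lerD2l ler_wnM2r// ltW//.
Qed.

(** What the rationality argument uses of the solid angles of a cone: bounded, supported in the
    cone, and constant where the unit cube about the point lies in the cone. *)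
Record cone_data (c : V -> R) (Om : R) ws v := ConeData {
  cd_gt0 : 0 < Om;
  cd_bound : forall x, 0 <= c x <= Om;
  cd_supp : forall x, c x != 0 -> rays ws [set 0] (x - v);
  cd_int : forall x, (forall z, (forall k, `|z 0 k - x 0 k| <= 1) -> rays ws [set 0] (z - v)) -> c x = Om;
  cd_full : exists (p1 : V) (e : R), 0 < e /\ forall x, (forall k, `|x 0 k - p1 0 k| <= e) -> rays ws [set 0] x
}.

Variables (c : V -> R) (Om : R) (ws : seq V) (v w0 eta : V) (f : CV -> R[i]).
Hypotheses (cd : cone_data c Om ws v) (w0ws : w0 \in ws) (w00 : w0 != 0).
Hypothesis eta_gt0 : forall w, w \in ws -> 0 < dotr eta w.
Hypothesis f_sum : forall s, (forall w, w \in ws -> 0 < dotr (im_rV s) w) -> has_series c s (f s).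

Let c_ge0 x : 0 <= c x. Proof. by have /andP[] := cd_bound cd x. Qed.

(* If the denominator did not vanish at a point s0 over the wall <Im s, w0> = 0, then
   tau * f (s0 + i tau eta) would tend to 0 with tau near s0; the two constants theorem, applied
   along the real direction x, would carry this decay to the point i y, where the positive
   terms of the series force tau * f to stay away from 0. *)
Lemma wall_denominator x y n W g h : dotr x w0 = 0 -> dotr y w0 = 0 ->
  (forall w, w \in ws -> w != w0 -> 0 < dotr y w) ->
  holomorphic_on W g -> holomorphic_on W h -> (forall s, W s -> h s != 0 -> f s = g s / h s) ->
  W (cplx x y + map_mx (real_complex R) (lp n)) -> h (cplx x y + map_mx (real_complex R) (lp n)) = 0.
Proof.
move=> xw0 yw0 yw Hg Hh fgh; set k := map_mx _ _; set s0 := _ + k => Ws0.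
apply/eqP/negPn/negP => hs0.
(* [C4] yields a [del] such that, for |b| <= del, adding b x consumes at most half of <y, w> at the
   generators other than [w0]. *)
have [C4 [C40 HC4]] := @seq_bound R _ [seq w <- ws | w != w0] (fun w => `|dotr x w| / dotr y w).
pose del := (2 * C4)^-1; have del0 : 0 < del by rewrite invr_gt0 mulr_gt0.
have ybx (b : R) w : `|b| <= del -> w \in ws -> w != w0 -> 0 < dotr (y + b *: x) w.
  move=> bdel wws wn; rewrite dotrDl dotrZl; have y0 := yw w wws wn.
  have := HC4 w; rewrite mem_filter wn wws ler_pdivrMr// => /(_ isT) h1.
  have h2 : `|b * dotr x w| <= dotr y w / 2.
    rewrite normrM; apply: (@le_trans _ _ (del * (C4 * dotr y w))); first exact: ler_pM.
    by rewrite /del invfM -mulrA mulKf ?gt_eqF// mulrC.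
  move: h2; rewrite ler_norml => /andP[h2 _]; lra.
have ybx0 (b : R) : dotr (y + b *: x) w0 = 0 by rewrite dotrDl dotrZl xw0 yw0 mulr0 addr0.
have dd : `|del| <= del by rewrite gtr0_norm.
have dn : `|- del| <= del by rewrite normrN gtr0_norm.
have [tau1 [C1 [tau10 C10 H1]]] := near_wall_bound (cd_bound cd) (cd_supp cd) w00 (ybx0 del)
   (fun w => @ybx del w dd) (eta_gt0 w0ws) eta_gt0.
have [tau2 [C2 [tau20 C20 H2]]] := near_wall_bound (cd_bound cd) (cd_supp cd) w00 (ybx0 (- del))
   (fun w => @ybx (- del) w dn) (eta_gt0 w0ws) eta_gt0.
have [p1 [e1 [e10 hp1]]] := cd_full cd.
have [c0 c00 Hc0] := near_wall_lower_bound c_ge0 (cd_gt0 cd) (cd_int cd) e10 hp1 w0ws w00 yw0 (eta_gt0 w0ws).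
have [rho rho0 [M M0 fM]] : exists2 rho : R, 0 < rho & exists2 M : R, 0 <= M &
    forall s, (forall k, normc (s 0 k - s0 0 k) < rho) -> normc (f s) <= M.
  have [r1 r10 Hr1] := open_neq0 Hh Ws0 hs0.
  have [r2 r20 Hr2] := (open_boxP W).1 Hg.1 s0 Ws0.
  have [r3 r30 Hr3] := (continuous_boxP g s0).1 (holomorphic_continuous Hg Ws0) 1 ltr01.
  have hh0 : 0 < normc (h s0) / 2 by rewrite divr_gt0// normc_gt0.
  have [r4 r40 Hr4] := (continuous_boxP h s0).1 (holomorphic_continuous Hh Ws0) _ hh0.
  exists (Num.min (Num.min r1 r2) (Num.min r3 r4)); first by rewrite !lt_min r10 r20 r30.
  exists ((normc (g s0) + 1) / (normc (h s0) / 2)).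
    by rewrite divr_ge0 ?addr_ge0 ?normc_ge0// ltW.
  move=> s hs.
  have K (P : R) : Num.min (Num.min r1 r2) (Num.min r3 r4) <= P -> forall k, normc (s 0 k - s0 0 k) < P.
    by move=> hP j; apply: lt_le_trans (hs j) hP.
  have {}Hr1 := Hr1 s (K r1 ltac:(by rewrite !ge_min lexx)).
  have {}Hr2 := Hr2 s (K r2 ltac:(by rewrite !ge_min lexx !orbT)).
  have {}Hr3 := Hr3 s (K r3 ltac:(by rewrite !ge_min lexx !orbT)).
  have {}Hr4 := Hr4 s (K r4 ltac:(by rewrite !ge_min lexx !orbT)).
  rewrite fgh// normcM normcV ler_pdivrMr ?normc_gt0//.
  apply: (@le_trans _ _ (normc (g s0) + 1)).
    by rewrite -[g s](subrK (g s0)) addrC; apply: le_trans (le_normcD _ _) _; rewrite lerD2l ltW.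
  rewrite -[leLHS](@divfK _ (normc (h s0) / 2)) ?gt_eqF//; apply: ler_wpM2l.
    by rewrite divr_ge0 ?addr_ge0 ?normc_ge0// ltW.
  have := lerB_normc (h s0) (h s); rewrite normcB.
  by move: Hr4; lra.
have [Cx [Cx0 HCx]] := @seq_bound R _ (enum 'I_d) (fun k => `|x 0 k|).
have [Ce [Ce0 HCe]] := @seq_bound R _ (enum 'I_d) (fun k => `|eta 0 k|).
pose r := Num.min (rho / (4 * Cx)) del.
have r0 : 0 < r by rewrite lt_min del0 andbT divr_gt0// mulr_gt0.
have C0 : 0 <= C1 + C2 by rewrite addr_ge0.
have c02 : 0 < c0 / 2 by rewrite divr_gt0.
have [e' e'0 He'] := strip_two_constants del0 r0 c02 C0.
(* The bounds of order 1 / tau hold, the points used near [s0] stay within [rho], and tau times the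
   bound [M] plus a truncation error 1 is below the threshold. *)
have [tau [t0 t1 [tt1 tt2 te te']]] : exists tau : R, [/\ 0 < tau, tau <= 1 &
    [/\ tau <= tau1, tau <= tau2, tau * (4 * Ce) <= rho & tau * (M + 1) <= e']].
  exists (Num.min (Num.min 1 (Num.min tau1 tau2)) (Num.min (rho / (4 * Ce)) (e' / (M + 1)))).
  have Ce4 : 0 < 4 * Ce by rewrite mulr_gt0.
  have M1 : 0 < M + 1 by rewrite ltr_wpDl.
  split; last split; rewrite -?ler_pdivlMr// ?lt_min ?ge_min ?lexx ?orbT//.
  by rewrite ltr01 tau10 tau20 !divr_gt0.
pose Y := y + tau *: eta.
(* From i Y at z = 0 to x + i Y at z = 1. As <x, w0> = 0, the imaginary part keeps the same pairing
   with [w0] for all z. *)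
pose ss (z : R[i]) : CV := cplx 0 Y + z *: cplx x 0.
have imss (z : R[i]) : im_rV (ss z) = Y + complex.Im z *: x by rewrite im_rVD im_rV_cplx im_rVZ.
pose b m := cone_weight c (Y + del *: x) m + cone_weight c (Y - del *: x) m.
have bB : sums_bounded b ((C1 + C2) / tau).
  move=> A uA; rewrite big_split /= mulrDl; apply: lerD.
    rewrite /Y [y + _ + _]addrAC; apply: H1 => //; exact/andP.
  rewrite /Y [y + _ - _]addrAC -scaleNr; apply: H2 => //; exact/andP.
have b0 m : 0 <= b m by rewrite addr_ge0// mulr_ge0// ?expR_ge0.
have termb (z : R[i]) m : `|complex.Im z| <= del -> normc ((c (lp m))%:C * lexp (ss z) m) <= b m.
  by move=> hz; rewrite normc_term// imss; exact: cone_weight_convex.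
(* [A0] truncates the series with error at most 1 at all points over the strip at once, and [A1]
   carries the lower bound at z = 0; the finite sum [F] is entire in z. *)
have [A0 uA0 HA0] := sums_tail b0 bB ltr01.
have [A1 uA1 HA1] := Hc0 tau ltac:(by rewrite t0 t1).
pose A := undup (A0 ++ A1); have uA : uniq A by exact: undup_uniq.
pose F (z : R[i]) := tau%:C * \sum_(m <- A) (c (lp m))%:C * lexp (ss z) m.
have : normc (F 0) <= c0 / 2.
  apply: He'.
  - move=> z hz; split.
      apply: cdiffM; first exact: cdiff_cst.
      apply: cdiff_sum => m; apply: cdiffM; [exact: cdiff_cst|exact: cdiff_lexp_line].
    rewrite normcM normc_real gtr0_norm// mulrC -ler_pdivlMr//.
    apply: le_trans (normc_sum _ _ _) _; apply: le_trans (bB _ uA).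
    by apply: ler_sum => m _; exact: termb.
  - move=> z hz; rewrite normcM normc_real gtr0_norm//; apply: le_trans te'.
    rewrite ler_pM2l//.
    have hzi : `|complex.Im z| <= del.
      have := normc_Im (z - 1); rewrite raddfB /= subr0 => h1.
      by apply: le_trans h1 _; apply: le_trans hz _; rewrite ge_min lexx orbT.
    (* The lattice translation [k] does not change the terms, so the bound on f near [s0] is a bound
       on the series at [ss z]. *)
    have hs : has_series c (ss z) (f (ss z + k)).
      have : has_series c (ss z + k) (f (ss z + k)).
        apply: f_sum => w wws; rewrite im_rVD im_rV_real addr0 imss /Y addrAC dotrDl dotrZl.
        have [->|wn] := eqVneq w w0; first by rewrite ybx0 add0r mulr_gt0// eta_gt0.
        by rewrite addr_gt0 ?ybx// mulr_gt0// eta_gt0.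
      by apply: eq_has_sum => m; rewrite lexp_periodic.
    have := HA0 A uA _ _ _ (fun m => termb z m hzi) hs.
    move=> /(_ ltac:(by move=> i iA; rewrite mem_undup mem_cat iA)).
    set SA := \sum_(m <- A) _ => h1.
    have h2 : normc (f (ss z + k)) <= M.
      apply: fM => j; rewrite !mxE.
      have -> : 0 +i* (y 0 j + tau * eta 0 j) + z * (x 0 j +i* 0) + (n 0 j)%:~R%:C -
          (x 0 j +i* y 0 j + (n 0 j)%:~R%:C) = (z - 1) * (x 0 j)%:C + (0 +i* 1) * (tau * eta 0 j)%:C.
        by case: (z) => z1 z2; apply/eqP; rewrite eq_complex /=; apply/andP; split; apply/eqP; ring.
      apply: le_lt_trans (le_normcD _ _) _; rewrite !normcM !normc_real.
      have -> : normc (0 +i* 1 : R[i]) = 1 by rewrite /normc /= expr0n /= add0r expr1n sqrtr1.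
      rewrite mul1r normrM (gtr0_norm t0).
      have h3 : normc (z - 1) * `|x 0 j| <= rho / (4 * Cx) * Cx.
        apply: ler_pM; rewrite ?normc_ge0//; last by apply: HCx; rewrite mem_enum.
        by apply: le_trans hz _; rewrite ge_min lexx.
      have h4 : tau * `|eta 0 j| <= rho / 4.
        apply: (@le_trans _ _ (tau * Ce)); first by rewrite ler_pM2l// HCe// mem_enum.
        by move: te; rewrite mulrCA; lra.
      have h5 : rho / (4 * Cx) * Cx = rho / 4 by rewrite invfM mulrA divfK ?gt_eqF.
      by move: h3; rewrite h5; lra.
    rewrite -(subrK (f (ss z + k)) SA) addrC; apply: le_trans (le_normcD _ _) _; exact: lerD.
have -> : F 0 = (tau * \sum_(m <- A) cone_weight c Y m)%:C.
  rewrite /F rmorphM rmorph_sum /=; congr (_ * _); apply: eq_bigr => m _.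
  by rewrite /ss scale0r addr0 lexp_imag -rmorphM.
rewrite normc_real => h1.
have h2 : tau * \sum_(m <- A1) cone_weight c Y m <= tau * \sum_(m <- A) cone_weight c Y m.
  rewrite ler_pM2l//; apply: ler_sum_subset => // [m|m mA]; first by rewrite mulr_ge0// expR_ge0.
  by rewrite mem_undup mem_cat mA orbT.
have := le_trans HA1 (le_trans h2 (le_trans (ler_norm _) h1)); lra.
Qed.

(** Near i y0 write s = s1 + z0 u with <u, w0> = 1 and <s1, w0> = 0. On the complex line s1 + z u
    the small values z = <m, w0> are zeros of h by [wall_denominator]; they accumulate at 0, so h
    vanishes on a disc of the line that contains s. *)
Lemma edge_rational y0 : meromorphic f -> dotr y0 w0 = 0 ->
  (forall w, w \in ws -> w != w0 -> 0 < dotr y0 w) ->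
  exists (t : R) m, t != 0 /\ lp m = t *: w0.
Proof.
move=> mf yw0 yw; apply: contrapT => irr.
have small : forall e : R, 0 < e -> exists m, dotr (lp m) w0 != 0 /\ `|dotr (lp m) w0| < e.
  by apply: irrational_small => // t m t0 E; apply: irr; exists t, m.
have [W [g [h [Wa Hg Hh hdense fgh]]]] := mf (cplx 0 y0).
have [e e0 He] := (open_boxP W).1 Hg.1 _ Wa.
pose S := l1 w0; pose N := dotr w0 w0.
have [i wi] := rV_neq0 w00.
have Sk k : `|w0 0 k| <= S by rewrite /S /l1 (bigD1 k)//= lerDl sumr_ge0.
have S0 : 0 < S by apply: lt_le_trans (Sk i); rewrite normr_gt0.
have N0 : 0 < N.
  rewrite /N /dotr (bigD1 i)//= ltr_pwDl ?sumr_ge0// => [|k _]; last by rewrite -expr2 sqr_ge0.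
  by rewrite -expr2 lt_neqAle sqr_ge0 andbT eq_sym sqrf_eq0.
have [C [C0 HC]] := @seq_bound R _ [seq w <- ws | w != w0] (fun w => l1 w / dotr y0 w).
(* Moving by 2 r u changes a coordinate by at most e / 4. *)
pose r := e * N / (8 * S); have r0 : 0 < r by rewrite divr_gt0 ?mulr_gt0.
have rSN : 2 * r * (S / N) = e / 4 by rewrite /r; field; rewrite (gt_eqF S0) (gt_eqF N0).
pose D := 1 + S * S / N; have D0 : 0 < D by rewrite ltr_pwDl// divr_ge0 ?mulr_ge0// ltW.
(* The three entries give |z0| < r, [s1] within e / 2 of i y0, and Im s1 still positive on the other
   generators. *)
pose rho := Num.min (r / (2 * S)) (Num.min (e / (2 * D)) ((2 * C * D)^-1)).
have rho0 : 0 < rho by rewrite !lt_min invr_gt0 !divr_gt0 ?mulr_gt0.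
have rho1 : rho * S <= r / 2.
  apply: (@le_trans _ _ (r / (2 * S) * S)); first by rewrite ler_pM2r// ge_min lexx.
  by rewrite invfM mulrA divfK ?gt_eqF.
have rho2 : rho * D <= e / 2.
  apply: (@le_trans _ _ (e / (2 * D) * D)); first by rewrite ler_pM2r// !ge_min lexx orbT.
  by rewrite invfM mulrA divfK ?gt_eqF.
have rho3 : rho * D * C <= 2^-1.
  have hr : rho <= (2 * C * D)^-1 by rewrite !ge_min lexx !orbT.
  apply: (@le_trans _ _ ((2 * C * D)^-1 * D * C)).
    by rewrite ler_pM2r// ler_pM2r.
  by rewrite !invfM mulfVK ?gt_eqF// divfK ?gt_eqF.
pose wc : CV := map_mx (real_complex R) w0.
pose u : CV := N^-1%:C *: wc.
have cdot s : dotc s wc = dotr (re_rV s) w0 +i* dotr (im_rV s) w0.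
  apply/eqP; rewrite eq_complex /= im_dotc eqxx andbT; apply/eqP.
  by rewrite /dotc raddf_sum; apply: eq_bigr => k _; rewrite !mxE /=; case: (s 0 k) => p q /=; rewrite mulr0 subr0.
have uwc : dotc u wc = 1.
  rewrite dotcZl cdot; have -> : im_rV wc = 0 by exact: im_rV_real.
  have -> : re_rV wc = w0 by apply/rowP => k; rewrite !mxE.
  have -> : dotr 0 w0 = 0 by rewrite dotrC dotr0r.
  by rewrite -/N -[N +i* 0]/(N%:C) -rmorphM mulVf ?gt_eqF.
have hz s : (forall k, normc (s 0 k - cplx 0 y0 0 k) < rho) -> h s = 0.
  move=> hs; pose z0 := dotc s wc; pose s1 := s - z0 *: u.
  have z0S : normc z0 <= rho * S.
    have -> : z0 = \sum_k (s 0 k - cplx 0 y0 0 k) * wc 0 k.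
      have E0 : dotc (cplx 0 y0) wc = 0.
        by rewrite cdot im_rV_cplx re_rV_cplx yw0 dotrC dotr0r.
      rewrite /z0 -[LHS]subr0 -[in LHS]E0 /dotc -sumrB; apply: eq_bigr => k _.
      by rewrite mulrBl.
    apply: le_trans (normc_sum _ _ _) _.
    rewrite /S /l1 mulr_sumr; apply: ler_sum => k _; rewrite normcM [wc 0 k]mxE normc_real.
    by apply: ler_wpM2r => //; exact: ltW.
  have z0r : normc z0 < r by apply: le_lt_trans z0S _; lra.
  have uk k : normc (u 0 k) <= S / N.
    by rewrite mxE normcM mxE !normc_real gtr0_norm ?invr_gt0// mulrC ler_pM2r ?invr_gt0.
  have s1k k : normc (s1 0 k - cplx 0 y0 0 k) < rho * D.
    have -> : s1 0 k = s 0 k - z0 * u 0 k by rewrite /s1 mxE [X in _ + X]mxE [X in - X]mxE.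
    rewrite addrAC; apply: le_lt_trans (le_normcD _ _) _.
    rewrite normcN normcM /D mulrDr mulr1; apply: ltr_leD; first exact: hs.
    have -> : rho * (S * S / N) = rho * S * (S / N) by rewrite !mulrA.
    by apply: ler_pM; rewrite ?normc_ge0.
  have uE (z : R[i]) k : (s1 + z *: u) 0 k = s1 0 k + z * u 0 k.
    by rewrite mxE [X in _ + X = _]mxE.
  have ss : s = s1 + z0 *: u by rewrite subrK.
  rewrite ss; apply: (@accumulating_zeros R (fun z : R[i] => h (s1 + z *: u)) r r0 _ _ z0 z0r).
  - move=> z hzz; apply: cdiff_line Hh _; apply: He => k.
    rewrite uE addrAC; apply: le_lt_trans (le_normcD _ _) _; rewrite normcM.
    have : normc z * normc (u 0 k) <= 2 * r * (S / N) by apply: ler_pM; rewrite ?normc_ge0.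
    rewrite rSN; have := s1k k; lra.
  - move=> t t0; have [m [m0]] := small (Num.min t r) ltac:(by rewrite lt_min t0).
    rewrite lt_min => /andP[mt mr].
    exists (dotr (lp m) w0)%:C; split; [|by rewrite normc_real|].
      by rewrite -normc_gt0 normc_real normr_gt0.
    have s1w : dotc s1 wc = 0.
      by rewrite /s1 dotcDl -scaleNr dotcZl uwc mulr1 subrr.
    have [rs1 is1] : dotr (re_rV s1) w0 = 0 /\ dotr (im_rV s1) w0 = 0.
      by move: s1w; rewrite cdot => /eqP; rewrite eq_complex /= => /andP[/eqP -> /eqP ->].
    (* Subtracting the lattice vector m makes the pairing of the real part with [w0] equal to 0, as
       [wall_denominator] requires. *)
    pose x := re_rV s1 + (dotr (lp m) w0 / N) *: w0 - lp m.
    have E : s1 + (dotr (lp m) w0)%:C *: u = cplx x (im_rV s1) + map_mx (real_complex R) (lp m).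
      apply/rowP => k; rewrite !mxE; move: (s 0 k - _) => [a1 a2].
      by apply/eqP; rewrite eq_complex /=; apply/andP; split; apply/eqP; ring.
    rewrite E; apply: (wall_denominator _ is1 _ Hg Hh fgh).
    + by rewrite /x dotrBl dotrDl rs1 dotrZl divfK ?gt_eqF// add0r subrr.
    + move=> w wws wn; have := HC w; rewrite mem_filter wn wws ler_pdivrMr ?yw// => /(_ isT) hC.
      have hd := dotr_im_close w s1k.
      have h2 : rho * D * l1 w <= dotr y0 w / 2.
        apply: (@le_trans _ _ (rho * D * (C * dotr y0 w))); first by rewrite ler_pM2l// mulr_gt0.
        by rewrite mulrA [leRHS]mulrC ler_pM2r// yw.
      move: (le_trans hd h2); rewrite dotrBl ler_norml => /andP[h3 _].
      have := yw w wws wn; lra.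
    + rewrite -E; apply: He => k; rewrite uE addrAC.
      apply: le_lt_trans (le_normcD _ _) _; rewrite normcM normc_real.
      have h5 : `|dotr (lp m) w0| * normc (u 0 k) <= r * (S / N).
        by apply: ler_pM; rewrite ?normc_ge0//; exact: ltW.
      have h6 : 2 * (r * (S / N)) = e / 4 by rewrite mulrA rSN.
      have := s1k k; lra.
have [|||s [Bs _]] := hdense ([set s : CV | forall k, normc (s 0 k - cplx 0 y0 0 k) < rho] `&` W).
- by apply: openI; [exact: open_box|exact: Hg.1].
- by move=> s [].
- by exists (cplx 0 y0); split=> // k; rewrite subrr normc0.
- by rewrite hz// eqxx.
Qed.

End wall.

(** * Vertex cones and Brion's theorem *)

Section vertex_cone_series.
Variables (R : realType) (p : R) (d : nat).
Hypothesis p1 : 1 <= p.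
Local Notation V := 'rV[R]_d.
Local Notation CV := 'rV[R[i]]_d.
Local Notation lp := (@lattice_point R d).
Implicit Types (x y z v w eta : V) (ws : seq V) (m u : 'rV[int]_d) (s : CV) (l : seq (V * R)).
Local Arguments normc : simpl never.

Lemma ray_scale (A : set V) (t : R) w : 0 < t -> ray A (t *: w) = ray A w.
Proof.
move=> t0; apply/seteqP; split=> x [r r0 h].
- by exists (r * t); [rewrite mulr_ge0// ltW|rewrite -scalerA].
- by exists (r / t); [rewrite divr_ge0// ltW|rewrite scalerA divfK// gt_eqF].
Qed.

Lemma rays_lattice ws (A : set V) :
  (forall w, w \in ws -> exists (t : R) m, 0 < t /\ lp m = t *: w) ->
  exists us : seq 'rV[int]_d, [/\ rays ws A = rays (map lp us) A,
    forall u, u \in us -> exists (t : R) w, [/\ 0 < t, lp u = t *: w & w \in ws] &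
    forall w, w \in ws -> exists (t : R) u, [/\ 0 < t, lp u = t *: w & u \in us]].
Proof.
elim: ws => [|w ws IH] H; first by exists [::].
have [|us [E Hus Hws]] := IH; first by move=> x xs; apply: H; rewrite inE xs orbT.
have [t [m [t0 tm]]] := H w (mem_head _ _).
exists (m :: us); split=> /= [|u|x]; first by rewrite tm ray_scale// E.
- rewrite inE => /predU1P[->|/Hus[r [x [r0 rx xw]]]]; first by exists t, w; rewrite mem_head.
  by exists r, x; rewrite inE xw orbT.
- rewrite inE => /predU1P[->|/Hws[r [u [r0 ru uus]]]]; first by exists t, m; rewrite mem_head.
  by exists r, u; rewrite inE uus orbT.
Qed.

Lemma bsupp_angle (psi : V -> R) : bsupp psi -> bsupp (angle p psi).
Proof.
move=> [M H]; exists (M + 1) => x hx; rewrite -[RHS](mul0r (full_angle p d)).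
apply: (angle_cst p1); exists 1 => // y hy; apply: H.
have := ler_normD (x - y) y; rewrite subrK distrC; lra.
Qed.

Lemma alpha_series l s t : has_series (angle p (ind (hpoly l))) s t -> alpha p (hpoly l) s = t.
Proof.
move=> H; rewrite /alpha; apply: family_sumE; apply: eq_has_sum H => m.
case: ifPn => [_|mP]; first by rewrite (solid_angleE p1)//; exact: good_ind_hpoly.
by rewrite (angle_notin_hpoly p1) ?mul0r// => h; move: mP; rewrite mem_set.
Qed.

Lemma angle_subsum (psi : V -> R) (I : eqType) (r : seq I) (F : I -> V -> R) :
  good psi -> (forall i, i \in r -> good (F i)) ->
  good (fun x => psi x - \sum_(i <- r) F i x) /\ forall x,
  angle p (fun x => psi x - \sum_(i <- r) F i x) x = angle p psi x - \sum_(i <- r) angle p (F i) x.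
Proof.
move=> gpsi; elim: r => [|i r IH] gF.
  under eq_fun do rewrite big_nil subr0.
  by split=> // x; rewrite big_nil subr0; congr (angle p _ x); apply/funext => y; rewrite big_nil subr0.
have [IH1 IH2] := IH (fun j jr => gF j (mem_behead (s := _ :: _) jr)).
have gi := gF i (mem_head _ _).
have E : (fun x => psi x - \sum_(j <- i :: r) F j x) = (fun x => psi x - \sum_(j <- r) F j x - F i x).
  by apply/funext => x; rewrite big_cons opprD addrCA addrC.
rewrite E; split; first exact: goodB.
by move=> x; rewrite (angleB p1)// IH2 big_cons opprD addrCA addrC.
Qed.

Lemma tangent_cone_self l x y : hpoly l x -> tangent_cone (hpoly l) y x.
Proof. by exists x, 1; split; rewrite // scale1r addrC subrK. Qed.

Lemma vertex_cone_data l v ws : hpoly l v -> convex (hpoly l) -> full_dimensional (hpoly l) ->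
  tangent_cone (hpoly l) v = rays ws [set v] ->
  cone_data (angle p (ind (tangent_cone (hpoly l) v))) (full_angle p d) ws v.
Proof.
move=> lv cl fl E; have KE := tangent_cone_hpoly lv.
have gK : good (ind (tangent_cone (hpoly l) v)) by rewrite KE; exact: good_ind_hpoly.
have KP z : rays ws [set 0] (z - v) <-> tangent_cone (hpoly l) v z.
  by rewrite E; have [] := rays_set1 ws v z.
split.
- exact: (full_angle_gt0 _ p1).
- move=> x; apply/andP; split; first by apply: angle_ge0 => // y; rewrite /ind ler0n.
  rewrite -[leRHS]mul1r; apply: (angle_le p1) => // y.
  by rewrite /ind; case: (_ \in _); rewrite ?normr1 ?normr0.
- move=> x cx; apply/KP; apply: contrapT => nx; move/eqP: cx; apply.
  by move: nx; rewrite KE; exact: (angle_notin_hpoly p1).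
- move=> x Hx; rewrite -[RHS]mul1r; apply: (angle_cst p1); exists 1 => // y hy.
  rewrite /ind mem_set//; apply/KP; apply: Hx => k.
  by apply: le_trans hy; have := coord_le_norm (y - x) k; rewrite !mxE.
- have [q [e [e0 Hq]]] := full_dimensional_interior cl fl.
  exists (q - v), e; split=> // x hx; rewrite -[x](addrK v); apply/KP.
  apply: tangent_cone_self; apply: Hq => k; have := hx k; rewrite !mxE.
  by congr (`| _ | <= _); ring.
Qed.

Lemma cone_series_exists (c : V -> R) (Om : R) ws v s : cone_data c Om ws v ->
  (forall w, w \in ws -> 0 < dotr (im_rV s) w) -> exists t, has_series c s t.
Proof.
move=> cd sw; have [M HM] := cone_weight_bounded (cd_bound cd) (cd_supp cd) sw.
apply: (has_sum_bounded _ HM) => m; rewrite normc_term// => x.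
by have /andP[] := cd_bound cd x.
Qed.

Lemma convergence_domainP (K : set V) v ws s : K = rays ws [set v] -> (forall w, w \in ws -> w != 0) ->
  (forall w, w \in ws -> 0 < dotr (im_rV s) w) -> convergence_domain v K s.
Proof.
move=> E w0 sw; rewrite /convergence_domain /=.
have -> : [set z | K (v + z)] = rays ws [set 0].
  rewrite E; apply/seteqP; split=> z /=; have [h1 h2] := rays_set1 ws v (v + z).
    by move/h1; rewrite addrC addKr.
  by move=> hz; apply: h2; rewrite addrC addKr.
exact/open_polar_rays.
Qed.

(** The edge directions are rescaled to lattice vectors by positive factors, which changes neither
    the cone nor the positivity conditions on Im s. *)
Lemma vertex_cone_lattice_generators l v (f : CV -> R[i]) :
  bdd (hpoly l) -> full_dimensional (hpoly l) -> vertex (hpoly l) v ->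
  mero_continuation (convergence_domain v (tangent_cone (hpoly l) v))
    (alpha p (tangent_cone (hpoly l) v)) f ->
  exists (us : seq 'rV[int]_d) eta, [/\ tangent_cone (hpoly l) v = rays (map lp us) [set v],
    forall u, u \in us -> 0 < dotr eta (lp u) &
    forall s, (forall u, u \in us -> 0 < dotr (im_rV s) (lp u)) ->
      has_series (angle p (ind (tangent_cone (hpoly l) v))) s (f s)].
Proof.
move=> bP fP vv [mf fE]; have [ws [eta [E etaw wall]]] := vertex_cone_generators bP vv.
have lv := vertex_in vv; have cd := vertex_cone_data lv (@hpoly_convex _ _ l) fP E.
have w0 w : w \in ws -> w != 0.
  by move=> wws; have := etaw w wws; apply: contraTneq => ->; rewrite dotr0r ltxx.
have f_sum s : (forall w, w \in ws -> 0 < dotr (im_rV s) w) ->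
    has_series (angle p (ind (tangent_cone (hpoly l) v))) s (f s).
  move=> sw; rewrite fE; last exact: (convergence_domainP E w0 sw).
  have [t ht] := cone_series_exists cd sw; suff -> : alpha p (tangent_cone (hpoly l) v) s = t by [].
  by move: ht; rewrite (tangent_cone_hpoly lv); exact: alpha_series.
have [|us [Eus Hus Hws]] := @rays_lattice ws [set v].
  move=> w wws; have [y [yw yw']] := wall w wws.
  have [t [m [t0 tm]]] := edge_rational cd wws (w0 w wws) etaw f_sum mf yw yw'.
  have [tp|tn] := ltrP 0 t; first by exists t, m.
  exists (- t), (- m); split=> //; first by rewrite oppr_gt0 lt_neqAle t0.
  by rewrite scaleNr -tm -sub0r lattice_pointB (eqP (_ : lp 0 == 0)) ?lattice_point_eq0// sub0r.
exists us, eta; split=> [|u uus|s su]; first by rewrite E.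
  have [t [w [t0 -> wws]]] := Hus u uus; by rewrite dotrZr mulr_gt0// etaw.
apply: f_sum => w wws; have [t [u [t0 uE uus]]] := Hws w wws.
by have := su u uus; rewrite uE dotrZr pmulr_rgt0.
Qed.

End vertex_cone_series.

(** * Clearing the denominators of the cone series *)

Section brion_series.
Variables (R : realType) (d : nat).
Local Notation V := 'rV[R]_d.
Local Notation CV := 'rV[R[i]]_d.
Local Notation lp := (@lattice_point R d).
Implicit Types (x y z v w eta : V) (m u : 'rV[int]_d) (us : seq 'rV[int]_d) (s : CV) (l : seq (V * R)).
Local Arguments normc : simpl never.

Definition diff_factor us s : R[i] := \prod_(u <- us) (1 - lexp s u).

Lemma cdiff_diff_factor us (a b : CV) (z : R[i]) : cdiff (fun z : R[i] => diff_factor us (a + z *: b)) z.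
Proof.
rewrite /diff_factor; elim: us => [|u us IH].
  by apply: cdiff_ext (cdiff_cst 1 z) => w; rewrite big_nil.
apply: (@cdiff_ext _ (fun w : R[i] => (1 - lexp (a + w *: b) u) * \prod_(u <- us) (1 - lexp (a + w *: b) u))).
  by move=> w; rewrite big_cons.
by apply: cdiffM => //; apply: cdiffB; [exact: cdiff_cst|exact: cdiff_lexp_line].
Qed.

(** For density: at a point where [lexp s u] = 1, an imaginary shift by a small positive multiple of
    u changes the modulus. *)
Lemma open_dense_lexp u : u != 0 -> open [set s : CV | 1 - lexp s u != 0] /\ dense [set s : CV | 1 - lexp s u != 0].
Proof.
move=> u0; split.
  apply/open_boxP => s /= hs; have h0 : 0 < normc (1 - lexp s u) by rewrite normc_gt0.
  have [r r0 Hr] := (continuous_boxP _ s).1 (@continuous_lexp R d u s) _ h0.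
  exists r => // x /Hr; apply: contraTneq => /eqP; rewrite subr_eq0 => /eqP <-.
  by rewrite ltxx.
move=> O [s Os] oO; have [r r0 Hr] := (open_boxP O).1 oO s Os.
have [hs|hs] := eqVneq (1 - lexp s u) 0; last by exists s.
have [C [C0 HC]] := @seq_bound R _ (enum 'I_d) (fun k => `|lp u 0 k|).
pose t := r / (2 * C); have t0 : 0 < t by rewrite divr_gt0 ?mulr_gt0.
pose s' := s + cplx 0 (t *: lp u); exists s'; split.
  apply: Hr => k; rewrite /s' mxE addrAC subrr add0r !mxE.
  apply: le_lt_trans (normc_le _) _; rewrite /= normr0 add0r normrM gtr0_norm//.
  apply: (@le_lt_trans _ _ (t * C)).
    by rewrite ler_pM2l//; have := HC k (mem_enum _ _); rewrite mxE.
  rewrite /t invfM mulrA divfK ?gt_eqF//; move: r0 => /=; lra.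
have pos : 0 < dotr (lp u) (lp u).
  have [i ui] : exists i, lp u 0 i != 0 by apply: rV_neq0; rewrite lattice_point_eq0.
  rewrite /dotr (bigD1 i)//= ltr_pwDl ?sumr_ge0// => [|k _]; last by rewrite -expr2 sqr_ge0.
  by rewrite -expr2 lt_neqAle sqr_ge0 andbT eq_sym sqrf_eq0.
have pos2 : 0 < 2 * pi * (t * dotr (lp u) (lp u)) by apply: mulr_gt0; [exact: two_pi_gt0|exact: mulr_gt0].
rewrite /= subr_eq0 eq_sym; apply/eqP => /(congr1 (@normc R)).
rewrite normc_lexp normc1 im_rVD im_rV_cplx dotrDl dotrZl mulrDr opprD expRD.
have -> : expR (- (2 * pi * dotr (im_rV s) (lp u))) = 1.
  by rewrite -normc_lexp; move/eqP: hs; rewrite subr_eq0 => /eqP <-; rewrite normc1.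
rewrite mul1r -[RHS]expR0 => /expR_inj; move: pos2.
set X := 2 * pi * _ => *; lra.
Qed.

Lemma open_dense_bigI (I : eqType) (r : seq I) (Q : I -> CV -> Prop) :
  (forall i, i \in r -> exists O, [/\ open O, dense O & forall s, O s -> Q i s]) ->
  exists O, [/\ open O, dense O & forall s i, O s -> i \in r -> Q i s].
Proof.
elim: r => [|j r IH] H; first by exists setT; split; [exact: openT|by move=> O [s Os] _; exists s|].
have [|O [oO dO HO]] := IH; first by move=> i ir; apply: H; rewrite inE ir orbT.
have [B [oB dB HB]] := H j (mem_head _ _).
exists (B `&` O); split; [exact: openI|exact: denseI|].
move=> s i [s1 s2]; rewrite inE => /predU1P[->|ir]; [exact: HB|exact: HO].
Qed.

Lemma diff_factor_neq0 us : (forall u, u \in us -> u != 0) ->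
  exists O, [/\ open O, dense O & forall s, O s -> diff_factor us s != 0].
Proof.
move=> us0; have [|O [oO dO HO]] := @open_dense_bigI _ us (fun u s => 1 - lexp s u != 0).
  by move=> u /us0/open_dense_lexp[oE dE]; exists [set s : CV | 1 - lexp s u != 0].
by exists O; split=> // s Os; rewrite prodf_seq_neq0; apply/allP => u uus; exact: HO.
Qed.

(* The factor turns the series into a finite sum where it converges, and the identity theorem
   extends the resulting equation to a dense open set. *)
Lemma diff_factor_cone us (vs : seq 'rV[int]_d) (f : CV -> R[i]) (c : V -> R) eta :
  bsupp (diffs (map lp us) c) -> (forall u, u \in vs -> 0 < dotr eta (lp u)) -> meromorphic f ->
  (forall s, (forall u, u \in vs -> 0 < dotr (im_rV s) (lp u)) -> has_series c s (f s)) ->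
  exists N : CV -> R[i], (forall s, has_series (diffs (map lp us) c) s (N s)) /\
    exists O, [/\ open O, dense O & forall s, O s -> diff_factor us s * f s = N s].
Proof.
move=> bc etau mf fc; have [A uA HA] := bsupp_lattice bc.
pose N s := \sum_(m <- A) (diffs (map lp us) c (lp m))%:C * lexp s m.
have hN s : has_series (diffs (map lp us) c) s (N s).
  by apply: has_sum_finite => // m mA; rewrite HA// mul0r.
exists N; split=> //.
have [C [C0 HC]] := @seq_bound R _ vs (fun u => l1 (lp u) / dotr eta (lp u)).
(* A box about i eta inside the domain of convergence: on it the pairings of Im s with the
   generators lose at most half of their value at eta. *)
pose T := [set s : CV | forall k, normc (s 0 k - cplx 0 eta 0 k) < (2 * C)^-1].
have oT : open T by exact: open_box.
apply: (@meromorphic_identity _ _ f (diff_factor us) N T mf _ _ oT).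
- by move=> a b z; exact: cdiff_diff_factor.
- move=> a b z; apply: cdiff_sum => m; apply: cdiffM; [exact: cdiff_cst|exact: cdiff_lexp_line].
- by exists (cplx 0 eta) => k; rewrite subrr normc0 invr_gt0 mulr_gt0.
move=> s Ts; apply: has_sum_unique (hN s); apply: has_series_diffs; apply: fc => u uvs.
have := HC u uvs; rewrite ler_pdivrMr ?etau// => hC.
have hd := dotr_im_close (lp u) Ts.
have h2 : (2 * C)^-1 * l1 (lp u) <= dotr eta (lp u) / 2.
  rewrite invfM -mulrA mulrC ler_pM2r// ler_pdivrMl//.
move: (le_trans hd h2); rewrite dotrBl ler_norml => /andP[h3 _].
have := etau u uvs; lra.
Qed.

Lemma has_series_sum (I : eqType) (r : seq I) (F : I -> V -> R) (N : I -> R[i]) (psi : V -> R) s t :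
  has_series psi s t -> (forall i, i \in r -> has_series (F i) s (N i)) ->
  has_series (fun x => psi x - \sum_(i <- r) F i x) s (t - \sum_(i <- r) N i).
Proof.
move=> Hp; elim: r => [|i r IH] HF.
  by rewrite big_nil subr0; apply: eq_has_sum Hp => m; rewrite big_nil subr0.
rewrite big_cons opprD addrCA addrC -[N i]mul1r.
have {}IH := IH (fun j jr => HF j (mem_behead (s := _ :: _) jr)).
apply: eq_has_sum (has_sum_subZ 1 IH (HF i (mem_head _ _))) => m.
by rewrite big_cons mul1r -mulrBl -rmorphB opprD addrCA [in RHS]addrC.
Qed.

End brion_series.

(* alphaK v is the meromorphic function on C^d that continues the series
   alpha_(K_v). *)
Theorem theorem4p1 (R : realType) (p : R) (hp : 1 <= p) (d : nat)
    (P : set 'rV[R]_d) (hP : polytope P)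
    (alphaK : 'rV[R]_d -> 'rV[R[i]]_d -> R[i])
    (halphaK : forall v, vertex P v ->
       mero_continuation (convergence_domain v (tangent_cone P v))
         (alpha p (tangent_cone P v)) (alphaK v)) :
  mero_eq (alpha p P) (fun s => \sum_(v \in vertex P) alphaK v s).
Proof.
pose lp := @lattice_point R d.
case: hP => /polyhedron_hpoly[l PE] bP fP; move: bP fP halphaK; rewrite {}PE {P} => /bounded_set_bdd bP fP halphaK.
pose P := hpoly l; have cP : convex P by exact: hpoly_convex.
have [r [ur rP]] := vertex_seq l.
pose K v := tangent_cone P v.
have gens v : exists us : seq 'rV[int]_d, v \in r -> K v = rays (map lp us) [set v] /\
    exists eta, (forall u, u \in us -> 0 < dotr eta (lp u)) /\
    forall s, (forall u, u \in us -> 0 < dotr (im_rV s) (lp u)) ->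
      has_series (angle p (ind (K v))) s (alphaK v s).
  have [vr|_] := boolP (v \in r); last by exists [::].
  have vv := (rP v).1 vr.
  have [us [eta [E etau us_sum]]] := vertex_cone_lattice_generators hp bP fP vv (halphaK v vv).
  by exists us => _; split=> //; exists eta.
have [gen genP] := choice gens.
(* The generators of all vertex cones together, so that a single product of operators serves every
   cone. *)
pose us := flatten (map gen r); pose U := map lp us.
have us0 u : u \in us -> u != 0.
  move=> /flatten_mapP[v vr uv]; have [_ [eta [etau _]]] := genP v vr.
  by have := etau u uv; apply: contraTneq => ->; rewrite (eqP (_ : lp 0 == 0)) ?lattice_point_eq0// dotr0r ltxx.
have bK v : v \in r -> bsupp (diffs U (ind (K v))).
  move=> vr; have [r1 [r2 rE]] : exists r1 r2, r = r1 ++ v :: r2.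
    by case/splitPr: vr => r1 r2; exists r1, r2.
  (* The operators commute, so those of the generators of [K v] may act first; they create the
     bounded support, which the others preserve. *)
  rewrite (genP v vr).1 /U /us rE map_cat flatten_cat /= !map_cat !diffs_cat (diffs_comm (map lp (gen v))).
  do 2 apply: bsupp_diffs; apply: bsupp_diffs_rays.
    by move=> y z t -> -> _ /=; rewrite -scalerDl addrC subrK scale1r.
  by exists `|v| => x ->.
have gP : good (ind P) by exact: good_ind_hpoly.
have gK v : v \in r -> good (ind (K v)).
  by move=> /rP/vertex_in lv; rewrite /K (tangent_cone_hpoly lv); exact: good_ind_hpoly.
have hullP C : convex C -> (forall v, v \in r -> C v) -> P `<=` C.
  by move=> cC rC; apply: bounded_hpoly_hull => // v /rP; exact: rC.
have r0 : r != [::].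
  apply/eqP => rn; have [x [B [Px _ _]]] := fP.
  by apply: (hullP set0) Px => //; rewrite rn.
have KE v : v \in r -> K v = rays [seq w - v | w <- r] [set v].
  by move=> /rP vv; apply: tangent_cone_rays => //; exact: vertex_in.
(* Along the differences of vertices the expression becomes 0 by [brion_mod_differences]; its
   bounded support allows these operators to be cancelled, and only lattice differences remain. *)
have zero x : diffs U (fun x => ind P x - \sum_(v <- r) ind (K v) x) x = 0.
  move: x; apply: (@bsupp_diffs_inj _ _ (edge_differences r)).
  - have [M HM] : bsupp (fun x => diffs U (ind P) x - \sum_(v <- r) diffs U (ind (K v)) x).
      apply: bsuppB; first by apply/bsupp_diffs/bsupp_ind.
      elim: (r) bK => [|v r' IH] bK'; first by exists 0 => x _; rewrite big_nil.
      have [M1 H1] := IH (fun w wr => bK' w (mem_behead (s := _ :: _) wr)).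
      have [M2 H2] := bK' v (mem_head _ _).
      exists (Num.max M1 M2) => x; rewrite gt_max => /andP[h1 h2].
      by rewrite big_cons H1// H2// addr0.
    by exists M => x /HM; rewrite diffsB diffs_sum.
  - exact: edge_differences_neq0.
  - move=> x; rewrite diffs_comm -[RHS](diffs0 U x); apply: diffs_local => y.
    rewrite diffsB diffs_sum (@brion_mod_differences _ _ P r K)// ?subrr// => v /rP; exact: vertex_in.
pose cP' := angle p (ind P); pose cK v := angle p (ind (K v)).
(* [angle] commutes with the operators and with finite sums, which carries the identity from
   indicators over to the coefficients of the series. *)
have split_P x : diffs U cP' x = \sum_(v <- r) diffs U (cK v) x.
  have [gG aG] := angle_subsum hp (F := fun v => ind (K v)) gP gK.
  have : angle p (diffs U (fun x => ind P x - \sum_(v <- r) ind (K v) x)) x = 0.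
    have -> : diffs U (fun x => ind P x - \sum_(v <- r) ind (K v) x) = fun=> 0 by apply/funext.
    by rewrite (angle_cst hp (k := 0)) ?mul0r//; exists 1.
  rewrite (angle_diffs hp)//.
  have -> : angle p (fun x => ind P x - \sum_(v <- r) ind (K v) x) =
      fun x => cP' x - \sum_(v <- r) cK v x by apply/funext.
  by rewrite diffsB diffs_sum => /eqP; rewrite subr_eq0 => /eqP.
have bcK v : v \in r -> bsupp (diffs U (cK v)).
  move=> vr; have -> : diffs U (cK v) = angle p (diffs U (ind (K v))).
    by apply/funext => x; rewrite (angle_diffs hp)//; exact: gK.
  by apply: bsupp_angle => //; exact: bK.
have NK v : exists N : 'rV[R[i]]_d -> R[i], v \in r ->
    (forall s, has_series (diffs U (cK v)) s (N s)) /\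
    exists O, [/\ open O, dense O & forall s, O s -> diff_factor us s * alphaK v s = N s].
  have [vr|_] := boolP (v \in r); last by exists (fun=> 0).
  have [_ [eta [etau fc]]] := genP v vr; have [mf _] := halphaK v ((rP v).1 vr).
  by have [N HN] := diff_factor_cone (bcK v vr) etau mf fc; exists N.
have [N HN] := choice NK.
have [Oa [oOa dOa HOa]] := open_dense_bigI (fun v vr => (HN v vr).2).
have [Ob [oOb dOb HOb]] := @diff_factor_neq0 R d us us0.
exists (Oa `&` Ob); split; [exact: openI|exact: denseI|move=> s [s1 s2]].
have [A uA HA] : exists2 A : seq 'rV[int]_d, uniq A & forall m, m \notin A -> cP' (lp m) = 0.
  by apply: bsupp_lattice; apply: (bsupp_angle hp); exact: bsupp_ind.
have hP : has_series cP' s (alpha p P s).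
  have h : has_series cP' s (\sum_(m <- A) (cP' (lp m))%:C * lexp s m).
    by apply: has_sum_finite => // m mA; rewrite HA// mul0r.
  by rewrite (alpha_series hp h).
(* Off the zeros of the factor it suffices to compare the products, which are sums of the same
   differenced coefficients. *)
apply: (mulfI (HOb s s2)).
have -> : diff_factor us s * alpha p P s = \sum_(v <- r) N v s.
  apply/eqP; rewrite -subr_eq0; apply/eqP.
  have h := has_series_sum (has_series_diffs us hP) (fun v vr => (HN v vr).1 s).
  apply: has_sum_unique h _.
  have h0 : has_sum (fun _ : 'rV[int]_d => 0 : R[i]) 0.
    by have := @has_sum_finite R 'rV[int]_d (fun=> 0) [::] isT (fun _ _ => erefl); rewrite big_nil.
  by apply: eq_has_sum h0 => m; rewrite -/lp -/U split_P subrr mul0r.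
have -> : vertex P = [set` r] by apply/seteqP; split=> v /rP.
rewrite -fsbig_seq// mulr_sumr big_seq [RHS]big_seq; apply: eq_bigr => v vr.
by rewrite HOa.
Qed.
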